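(* Let $X_1,\dots,X_r$ be uniformly noncreasy Banach spaces and let $\|\cdot\|_\psi$ be an absolute normalized norm on $\mathbb{R}^r$ which is strictly monotone. Then the direct sum $(X_1\oplus\dots\oplus X_r)_\psi$ has the super fixed point property for asymptotically nonexpansive mappings in the intermediate sense.
   Context: A Banach space $X$ is uniformly noncreasy if for every $\varepsilon>0$ there is $\delta>0$ such that whenever $f,g\in S_{X^*}$ with $\|f-g\|\ge\varepsilon$, the set $\{x\in B_X: f(x)\ge1-\delta,\ g(x)\ge1-\delta\}$ has diameter at most $\varepsilon$. A norm on $\mathbb{R}^r$ is absolute if $\|(x_1,\dots,x_r)\|=\|(|x_1|,\dots,|x_r|)\|$, normalized if standard unit vectors have norm 1, strictly monotone if $\|(x_i)\|<\|(y_i)\|$ whenever $|x_i|\le|y_i|$ for all $i$ with strict inequality for some $i$. $(X_1\oplus\dots\oplus X_r)_\psi$ is $X_1\times\dots\times X_r$ with norm $\|(x_1,\dots,x_r)\|_\psi=\|(\|x_1\|,\dots,\|x_r\|)\|_\psi$. A mapping $T:C\to C$ is asymptotically nonexpansive in the intermediate sense if $T$ is continuous and $\limsup_{n\to\infty}\sup_{x,y\in C}(\|T^nx-T^ny\|-\|x-y\|)\le0$. $X$ has the super fixed point property for such mappings if every Banach space finitely representable in $X$ has the property that every such $T:C\to C$ on a nonempty bounded closed convex subset $C$ has a fixed point. *)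

(* Defs.v *)
From HB Require Import structures.
From mathcomp Require Import all_boot all_order all_algebra.
From mathcomp Require Import all_classical all_reals all_analysis.
Set Implicit Arguments. Unset Strict Implicit. Unset Printing Implicit Defensive.
Import Order.TTheory GRing.Theory Num.Theory.
Import numFieldNormedType.Exports.
Local Open Scope classical_set_scope.
Local Open Scope ring_scope.

Section Noncreasy.
Variables (R : realType) (X : normedModType R).

Definition unit_ball : set X := [set x : X | `|x| <= 1].

Definition dual_elt (f : X -> R) : Prop :=
  [/\ forall x y, f (x + y) = f x + f y,
      forall (a : R) x, f (a *: x) = a * f x
    & continuous f].

Definition dual_norm (f : X -> R) : R := sup [set `|f x| | x in unit_ball].

Definition dual_sphere (f : X -> R) : Prop := dual_elt f /\ dual_norm f = 1.

Definition diam (A : set X) : R := sup [set `|x - y| | x in A & y in A].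

Definition uniformly_noncreasy : Prop :=
  forall eps : R, 0 < eps -> exists2 delta : R, 0 < delta &
    forall f g : X -> R, dual_sphere f -> dual_sphere g ->
      eps <= dual_norm (f \- g) ->
      diam [set x | unit_ball x /\ 1 - delta <= f x /\ 1 - delta <= g x] <= eps.

End Noncreasy.

Record absnorm (R : realType) (r : nat) := AbsNorm {
  psi_fun :> ('I_r -> R) -> R;
  psi_eq0 : forall x, psi_fun x = 0 -> x = (fun _ => 0);
  psi_hom : forall (a : R) x, psi_fun (fun i => a * x i) = `|a| * psi_fun x;
  psi_triangle : forall x y, psi_fun (fun i => x i + y i) <= psi_fun x + psi_fun y;
  psi_abs : forall x, psi_fun x = psi_fun (fun i => `|x i|);
  psi_normalized : forall i, psi_fun (fun j => (j == i)%:R) = 1 }.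

Definition strictly_monotone (R : realType) (r : nat) (psi : ('I_r -> R) -> R) :=
  forall x y : 'I_r -> R, (forall i, `|x i| <= `|y i|) ->
    (exists i, `|x i| < `|y i|) -> psi x < psi y.

Section PsiSum.
Variables (R : realType) (r : nat) (X : 'I_r -> normedModType R).

Definition psum_type := {dffun forall i : 'I_r, X i}.
HB.instance Definition _ := Choice.on psum_type.

Definition psum_zero : psum_type := [ffun i => 0 : X i].
Definition psum_add (x y : psum_type) : psum_type := [ffun i => x i + y i].
Definition psum_opp (x : psum_type) : psum_type := [ffun i => - x i].
Definition psum_scale (a : R) (x : psum_type) : psum_type := [ffun i => a *: x i].

Lemma psum_addA : associative psum_add.
Proof. by move=> x y z; apply/ffunP => i; rewrite !ffunE addrA. Qed.
Lemma psum_addC : commutative psum_add.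
Proof. by move=> x y; apply/ffunP => i; rewrite !ffunE addrC. Qed.
Lemma psum_add0 : left_id psum_zero psum_add.
Proof. by move=> x; apply/ffunP => i; rewrite !ffunE add0r. Qed.
Lemma psum_addN : left_inverse psum_zero psum_opp psum_add.
Proof. by move=> x; apply/ffunP => i; rewrite !ffunE addNr. Qed.

HB.instance Definition _ :=
  GRing.isZmodule.Build psum_type psum_addA psum_addC psum_add0 psum_addN.

Lemma psum_scaleA a b (x : psum_type) :
  psum_scale a (psum_scale b x) = psum_scale (a * b) x.
Proof. by apply/ffunP => i; rewrite !ffunE scalerA. Qed.
Lemma psum_scale1 : left_id 1 psum_scale.
Proof. by move=> x; apply/ffunP => i; rewrite !ffunE scale1r. Qed.
Lemma psum_scaleDr : right_distributive psum_scale +%R.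
Proof. by move=> a x y; apply/ffunP => i; rewrite !ffunE scalerDr. Qed.
Lemma psum_scaleDl (x : psum_type) :
  {morph psum_scale^~ x : a b / a + b}.
Proof. by move=> a b; apply/ffunP => i; rewrite !ffunE scalerDl. Qed.

HB.instance Definition _ :=
  GRing.Zmodule_isLmodule.Build R psum_type
    psum_scaleA psum_scale1 psum_scaleDr psum_scaleDl.

Definition psum_norm (psi : absnorm R r) (x : psum_type) : R :=
  psi (fun i => `|x i|).

End PsiSum.

Section FPP.
Variable (R : realType).

Definition asymp_nonexp_intermediate (Y : normedModType R) (C : set Y)
    (T : Y -> Y) : Prop :=
  [/\ (forall x, C x -> C (T x)),
      {within C, continuous T}
    & (limn_esup (fun n : nat =>
         ereal_sup [set (`|iter n T x - iter n T y| - `|x - y|)%:E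
                   | x in C & y in C]) <= 0)%E].

Definition fpp_ani (Y : normedModType R) : Prop :=
  forall (C : set Y), C !=set0 -> bounded_set C -> closed C ->
    @convex_set R Y C ->
    forall T : Y -> Y, asymp_nonexp_intermediate C T ->
      exists2 x, C x & T x = x.

(* Y is finitely representable in the normed space (Z, nZ): for every
   finite-dimensional subspace F = span(y_0,...,y_{n-1}) of Y and every
   eps > 0 there is a linear map T : F -> Z (determined by z_i = T y_i) with
   ||u|| <= nZ (T u) <= (1+eps) ||u|| for all u in F. *)
Definition fin_representable (Y : normedModType R) (Z : lmodType R)
    (nZ : Z -> R) : Prop :=
  forall (n : nat) (y : 'I_n -> Y) (eps : R), 0 < eps ->
    exists z : 'I_n -> Z, forall a : 'I_n -> R,
      `|\sum_(i < n) a i *: y i| <= nZ (\sum_(i < n) a i *: z i)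
      <= (1 + eps) * `|\sum_(i < n) a i *: y i|.

Definition super_fpp_ani (Z : lmodType R) (nZ : Z -> R) : Prop :=
  forall Y : completeNormedModType R, fin_representable Y nZ -> fpp_ani Y.

End FPP.

(* Main.v *)
(* Finite representability and an ultrafilter limit give the space Y itself seminorms q_i
   with |y| = psi (q_1 y, ..., q_r y), each of them noncreasy; this structure passes to
   ultrapowers, and it implies the intersection property of reflexive spaces, hence weak
   limits along ultrafilters.

   For a minimal invariant convex set K of a family of nonexpansive maps, every net of
   approximate fixed points is at least as far from each point of K as some extremal net is.
   If this distance is positive, join two extremal nets at that distance from each other by
   approximate fixed points metrically between them: strict monotonicity makes the joining
   net metrically between them in each coordinate, and noncreasiness of q_i puts it on the
   segment modulo q_i. Treating the coordinates one after another gives a contradiction. So a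
   family has a common fixed point as soon as it has approximate common fixed points in
   nets; these come from iteration for one map, from Bruck's retraction for finitely many
   commuting maps, and from the finite case in an ultrapower for all commuting families.

   For T asymptotically nonexpansive in the intermediate sense the maps
   (u_n) |-> (T^(mu n + n) u_n), for mu : nat -> nat, are commuting and nonexpansive on the
   ultrapower over nat. Their common fixed points improve almost fixed points of the powers
   of T geometrically, so that some z satisfies T^n z --> z and therefore T z = z. *)
Require Import Defs.
From HB Require Import structures.
From mathcomp Require Import all_boot all_order all_algebra.
From mathcomp Require Import all_classical all_reals all_analysis.
From mathcomp Require Import ring lra.
Set Implicit Arguments. Unset Strict Implicit. Unset Printing Implicit Defensive.
Import Order.TTheory GRing.Theory Num.Theory.
Import numFieldNormedType.Exports.
Local Open Scope classical_set_scope.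
Local Open Scope ring_scope.

(** * Sublinear functionals *)

(** No quotient is ever taken. An ultrapower is the space of bounded nets with limit seminorms, so
    nets at distance zero stay distinct; this is why closed sets absorb null perturbations and why
    maps commute and fix points only up to distance zero.

    The obstacle in a minimal set is that a noncreasy sphere may contain segments. Joining two
    extremal nets once only produces a segment in the sphere of some coordinate, which is no
    contradiction. The segment is therefore remembered. If a later step moves the same coordinate
    again, a functional norming the new net norms the remembered segment together with a second,
    distant functional: a crease. Every step moves some coordinate, so [r + 1] steps are impossible.

    The two nets joined at each step must be independent. Products of ultrafilters provide this:
    with iterated limits, the second net is weakly null for every functional attached to the
    first. *)

Section Sublinear.
Variables (R : realType) (V : lmodType R).
Implicit Types (p q : V -> R) (Q : set (V * R)).

Definition lin (f : V -> R) := forall a x y, f (a *: x + y) = a * f x + f y.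

Definition sublinear p :=
  (forall x y, p (x + y) <= p x + p y) /\
  (forall a x, 0 < a -> p (a *: x) = a * p x).

Definition seminorm q :=
  (forall x y, q (x + y) <= q x + q y) /\
  (forall a x, q (a *: x) = `|a| * q x).

Lemma lin0 f : lin f -> f 0 = 0.
Proof. by move=> h; have := h 1 0 0; rewrite scaler0 addr0 => ?; lra. Qed.

Lemma linZ f a x : lin f -> f (a *: x) = a * f x.
Proof. by move=> h; have := h a x 0; rewrite (lin0 h) !addr0. Qed.

Lemma linD f x y : lin f -> f (x + y) = f x + f y.
Proof. by move=> h; have := h 1 x y; rewrite scale1r mul1r. Qed.

Lemma linN f x : lin f -> f (- x) = - f x.
Proof. by move=> h; rewrite -scaleN1r linZ// mulN1r. Qed.

Lemma linB f x y : lin f -> f (x - y) = f x - f y.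
Proof. by move=> h; rewrite linD// linN. Qed.

Lemma linMl f a : lin f -> lin (fun x => a * f x).
Proof. by move=> h b x y; rewrite h; ring. Qed.

Lemma seminormN q x : seminorm q -> q (- x) = q x.
Proof. by case=> _ h; rewrite -scaleN1r h normrN1 mul1r. Qed.

Lemma seminorm0 q : seminorm q -> q 0 = 0.
Proof. by case=> _ h; rewrite -(scale0r 0) h normr0 mul0r. Qed.

Lemma seminorm_ge0 q x : seminorm q -> 0 <= q x.
Proof.
move=> qs; have := qs.1 x (- x).
by rewrite subrr seminorm0// seminormN// => ?; lra.
Qed.

Lemma seminormB q x y : seminorm q -> q (x - y) = q (y - x).
Proof. by move=> qs; rewrite -(seminormN (y - x) qs) opprB. Qed.

Lemma seminormBD q x y z : seminorm q -> q (x - z) <= q (x - y) + q (y - z).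
Proof. by move=> qs; rewrite -(subrKA y); exact: qs.1. Qed.

Lemma seminorm_sublinear q : seminorm q -> sublinear q.
Proof. by case=> h1 h2; split=> // a x a0; rewrite h2 gtr0_norm. Qed.

Lemma lin_ge f q x : seminorm q -> lin f -> (forall x, f x <= q x) -> - q x <= f x.
Proof. by move=> qs fl fq; have := fq (- x); rewrite linN// seminormN// => ?; lra. Qed.

Lemma lin_norm f q x : seminorm q -> lin f -> (forall x, f x <= q x) -> `|f x| <= q x.
Proof. by move=> qs fl fq; rewrite ler_norml fq lin_ge. Qed.

(** A pair [(v, c)] stands for the demand [c <= f v] on a functional [f]. *)
Definition convex_pairs Q := forall u v s t, Q u -> Q v -> 0 <= s -> 0 <= t ->
  s + t = 1 -> Q (s *: u.1 + t *: v.1, s * u.2 + t * v.2).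

(** The auxiliary function of the Mazur-Orlicz theorem. For nonempty [Q], a linear functional lies
    below it exactly when it lies below [p] and meets every demand in [Q]. *)
Definition lowered p Q x :=
  inf [set p (x + tu.1 *: tu.2.1) - tu.1 * tu.2.2 | tu in
        [set tu : R * (V * R) | 0 <= tu.1 /\ Q tu.2]].

Section Lowered.
Variables (p : V -> R) (Q : set (V * R)).
Hypotheses (ps : sublinear p) (Qc : convex_pairs Q) (Q0 : Q !=set0).
Hypothesis (Qp : forall u, Q u -> u.2 <= p u.1).

Lemma sublinear0 : p 0 = 0.
Proof. by have := ps.2 2 0 ltac:(lra); rewrite scaler0 => ?; lra. Qed.

Let lb x : lbound [set p (x + tu.1 *: tu.2.1) - tu.1 * tu.2.2 | tu in
        [set tu : R * (V * R) | 0 <= tu.1 /\ Q tu.2]] (- p (- x)).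
Proof.
move=> _ [[t u] /= [t0 Qu] <-].
have := ps.1 (x + t *: u.1) (- x); rewrite addrAC subrr add0r.
suff : t * u.2 <= p (t *: u.1) by lra.
move: t0; rewrite le_eqVlt => /predU1P[<-|t0].
  by rewrite mul0r scale0r sublinear0.
by rewrite ps.2// ler_pM2l// Qp.
Qed.

Lemma lowered_le x t u : 0 <= t -> Q u -> lowered p Q x <= p (x + t *: u.1) - t * u.2.
Proof.
by move=> t0 Qu; apply: ge_inf; [exists (- p (- x)); exact: lb|exists (t, u)].
Qed.

Let nonempty x : [set p (x + tu.1 *: tu.2.1) - tu.1 * tu.2.2 | tu in
        [set tu : R * (V * R) | 0 <= tu.1 /\ Q tu.2]] !=set0.
Proof. by case: Q0 => u Qu; exists (p (x + 0 *: u.1) - 0 * u.2); exists (0, u). Qed.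

Lemma lowered_approx x e : 0 < e -> exists t u,
  [/\ 0 <= t, Q u & p (x + t *: u.1) - t * u.2 < lowered p Q x + e].
Proof.
move=> e0; have [|_ [[t u] [/= t0 Qu] <-] h] := @inf_adherent _ _ _ e0 (conj (nonempty x) _).
  by exists (- p (- x)); exact: lb.
by exists t, u.
Qed.

Lemma lowered_lep x : lowered p Q x <= p x.
Proof.
case: Q0 => u Qu; have := lowered_le x (lexx 0) Qu.
by rewrite scale0r addr0 mul0r subr0.
Qed.

Lemma lowered_opp u : Q u -> lowered p Q (- u.1) <= - u.2.
Proof.
move=> Qu; have := lowered_le (- u.1) ler01 Qu.
by rewrite scale1r addNr sublinear0 mul1r sub0r.
Qed.

(** Subadditivity is where convexity of [Q] enters: demands used with weights [t] and [s] merge into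
    one demand used with weight [t + s]; both weights vanishing is a separate case. *)
Lemma lowered_sublinear : sublinear (lowered p Q).
Proof.
split=> [x y|a x a0].
  apply/ler_addgt0Pr => e e0; have e20 : 0 < e / 2 by lra.
  have [t [u [t0 Qu hu]]] := lowered_approx x e20.
  have [s [v [s0 Qv hv]]] := lowered_approx y e20.
  suff : lowered p Q (x + y) <= (p (x + t *: u.1) - t * u.2) + (p (y + s *: v.1) - s * v.2) by lra.
  have sub := ps.1 (x + t *: u.1) (y + s *: v.1).
  have [ts0|ts0] := eqVneq (t + s) 0.
    have [-> ->] : t = 0 /\ s = 0 by split; lra.
    rewrite !scale0r !addr0 !mul0r !subr0 (le_trans (lowered_lep _))//; exact: ps.1.
  have tsp : 0 < t + s by rewrite lt_def ts0 addr_ge0.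
  have Qw := @Qc u v (t / (t + s)) (s / (t + s)) Qu Qv
     (divr_ge0 t0 (ltW tsp)) (divr_ge0 s0 (ltW tsp)) ltac:(by rewrite -mulrDl divff).
  have /= := lowered_le (x + y) (ltW tsp) Qw.
  have cancel b : (t + s) * (b / (t + s)) = b by rewrite mulrC mulfVK.
  rewrite scalerDr !scalerA mulrDr !(mulrA (t + s) (_ / _)) !cancel.
  by move: sub; rewrite addrACA => ? ?; lra.
have aux b z : 0 < b -> lowered p Q (b *: z) <= b * lowered p Q z.
  move=> b0; rewrite mulrC -ler_pdivrMr//.
  apply/ler_addgt0Pr => e e0; have [t [u [t0 Qu hu]]] := lowered_approx z e0.
  rewrite ler_pdivrMr//.
  have := lowered_le (b *: z) (mulr_ge0 (ltW b0) t0) Qu.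
  rewrite -scalerA -scalerDr ps.2// => h; apply: (le_trans h).
  by rewrite -mulrA -mulrBr mulrC ler_pM2r//; exact: ltW.
apply/eqP; rewrite eq_le aux//=.
have ai0 : 0 < a^-1 by rewrite invr_gt0.
have := aux a^-1 (a *: x) ai0.
by rewrite scalerA mulVf ?gt_eqF// scale1r mulrC ler_pdivlMr// mulrC.
Qed.

End Lowered.

Lemma exists_lin_le p : sublinear p -> exists2 f, lin f & forall x, f x <= p x.
Proof.
move=> ps.
pose T := {f | sublinear f /\ forall x, f x <= p x}.
(* The order is reversed, so that a maximal element for Zorn's lemma is a minimal sublinear
   functional. *)
pose r (f g : T) := `[< forall x, sval g x <= sval f x >].
have rr t : r t t by apply/asboolP.
have rt (f g h : T) : r f g -> r g h -> r f h.
  by move=> /asboolP fg /asboolP gh; apply/asboolP => x; exact: le_trans (gh x) (fg x).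
pose t0 : T := exist _ p (conj ps (fun x => lexx _)).
have [A Ar|] := @ZL_preorder T t0 r rr rt.
  have [[f0 Af0]|A0] := pselect (A !=set0); last first.
    by exists t0 => s As; exfalso; apply: A0; exists s.
  pose S x := [set sval f x | f in A].
  have Slb x : lbound (S x) (- p (- x)).
    move=> _ [f Af <-]; case: f Af => f [fs fp] /= _.
    have := fs.1 x (- x); have := fp (- x); rewrite subrr (sublinear0 fs).
    by move=> ? ?; lra.
  have Sn x : S x !=set0 by exists (sval f0 x); exists f0.
  pose g x := inf (S x).
  have gle x (f : T) : A f -> g x <= sval f x.
    by move=> Af; apply: ge_inf; [exists (- p (- x)); exact: Slb|exists f].
  have gap x e : 0 < e -> exists2 f, A f & sval f x < g x + e.
    move=> e0; have [|_ [f Af <-] h] := @inf_adherent _ _ _ e0 (conj (Sn x) _).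
      by exists (- p (- x)); exact: Slb.
    by exists f.
  have gs : sublinear g.
    split=> [x y|a x a0].
      apply/ler_addgt0Pr => e e0; have e20 : 0 < e / 2 by lra.
      have [f1 Af1 h1] := gap x _ e20; have [f2 Af2 h2] := gap y _ e20.
      have [f [Af hx hy]] : exists f : T, [/\ A f, sval f x <= sval f1 x & sval f y <= sval f2 y].
        by case: (Ar _ _ Af1 Af2) => /asboolP h; [exists f2|exists f1]; split.
      have := gle (x + y) f Af; have := (svalP f).1.1 x y.
      by move=> ? ?; lra.
    apply/eqP; rewrite eq_le; apply/andP; split.
      rewrite mulrC -ler_pdivrMr//; apply/ler_addgt0Pr => e e0.
      have [f Af h] := gap x _ e0; rewrite ler_pdivrMr//.
      apply: (le_trans (gle _ _ Af)); rewrite (svalP f).1.2// mulrC ler_pM2r//; exact: ltW.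
    apply/ler_addgt0Pr => e e0; have [f Af h] := gap (a *: x) _ e0.
    apply: le_trans (ltW h); rewrite (svalP f).1.2// ler_pM2l//; exact: gle.
  have gp x : g x <= p x by apply: le_trans (gle x f0 Af0) _; exact: (svalP f0).2.
  by exists (exist _ g (conj gs gp)) => f Af; apply/asboolP => x; exact: gle.
move=> [f [fs fp]] fmax; exists f => //.
(* a minimal sublinear functional is odd, hence linear *)
have fN u : f (- u) = - f u.
  pose Q : set (V * R) := [set (u, f u)].
  have Qc : convex_pairs Q.
    by move=> _ _ s t -> -> _ _ st /=; rewrite -scalerDl -mulrDl st scale1r mul1r.
  have Q0 : Q !=set0 by exists (u, f u).
  have Qp w : Q w -> w.2 <= f w.1 by move=> ->.
  have Ls := lowered_sublinear fs Qc Q0 Qp.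
  have Lf := lowered_lep fs Q0 Qp.
  have Lo := @lowered_opp _ _ fs Qp (u, f u) erefl.
  pose t : T := exist _ _ (conj Ls (fun x => le_trans (Lf x) (fp x))).
  have /asboolP/= h := fmax t ltac:(by apply/asboolP => x; exact: Lf).
  have := h (- u); have := fs.1 u (- u); rewrite subrr (sublinear0 fs) /= in Lo *.
  by move=> ? ?; lra.
have fD x y : f (x + y) = f x + f y.
  apply/eqP; rewrite eq_le fs.1/=; have := fs.1 (x + y) (- y).
  by rewrite addrK fN => ?; lra.
have fZ a x : f (a *: x) = a * f x.
  have [a0|a0|->] := ltgtP a 0; last by rewrite scale0r mul0r (sublinear0 fs).
    by rewrite -(opprK a) scaleNr fN fs.2 ?oppr_gt0//; ring.
  by rewrite fs.2.
by move=> a x y; rewrite fD fZ.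
Qed.

Lemma mazur_orlicz p Q : sublinear p -> convex_pairs Q ->
  (forall u, Q u -> u.2 <= p u.1) ->
  exists f, [/\ lin f, forall x, f x <= p x & forall u, Q u -> u.2 <= f u.1].
Proof.
move=> ps Qc Qp; have [Q0|Q0] := pselect (Q !=set0); last first.
  have [f fl fp] := exists_lin_le ps; exists f; split=> // u Qu.
  by exfalso; apply: Q0; exists u.
have [f fl fp] := exists_lin_le (lowered_sublinear ps Qc Q0 Qp).
exists f; split=> // [x|u Qu].
  exact: le_trans (fp x) (lowered_lep ps Q0 Qp x).
have := fp (- u.1); have := lowered_opp ps Qp Qu.
by rewrite (linN _ fl) => ? ?; lra.
Qed.

Lemma norming q v : seminorm q ->
  exists f, [/\ lin f, forall x, f x <= q x & f v = q v].
Proof.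
move=> qs; have [|_ ->//|f [fl fq /(_ _ erefl)/= fv]] :=
    @mazur_orlicz q [set (v, q v)] (seminorm_sublinear qs).
  by move=> _ _ s t -> -> _ _ st /=; rewrite -scalerDl -mulrDl st scale1r mul1r.
by exists f; split=> //; apply/eqP; rewrite eq_le fv fq.
Qed.

End Sublinear.

(** * Limits along ultrafilters *)

Section UltraLimits.
Variables (R : realType) (M : Type) (U : set_system M).
Context {UU : UltraFilter U}.
Implicit Types (f g : M -> R) (A B : set M).

Definition ulimit (f : M -> R) (l : R) :=
  forall e, 0 < e -> U [set m | `|f m - l| < e].

Lemma ultra_setT A : (forall m, A m) -> U A.
Proof. by move=> h; apply: filterS (@filterT _ U _) => m _. Qed.

Lemma ultraI A B : U A -> U B -> U (A `&` B).
Proof. exact: filterI. Qed.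

Lemma ultra_ex A : U A -> exists m, A m.
Proof. exact: filter_ex. Qed.

Lemma ultra_notin A : ~ U A -> U (~` A).
Proof. by move=> nA; have [] := @in_ultra_setVsetC _ U A UU. Qed.

Lemma ultra_exists_fin (I : finType) (P : I -> set M) :
  U [set m | exists i, P i m] -> exists i, U (P i).
Proof.
move=> h; apply: contrapT => /forallNP nU.
have : U [set m | forall i, ~ P i m].
  apply: filterS (@filter_forall _ I (fun i m => ~ P i m) U _ _) => // i.
  exact: ultra_notin.
by move/(filterI h)/ultra_ex => [m [[i Pi] /(_ i)]].
Qed.

Lemma ulimit_ex f C : (forall m, `|f m| <= C) -> exists l, ulimit f l.
Proof.
move=> fC; pose S := [set t | U [set m | t <= f m]].
have SC : ubound S C.
  by move=> t /ultra_ex [m /= tm]; apply: le_trans tm (le_trans (ler_norm _) (fC m)).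
have Sn : S !=set0.
  exists (- C); apply: ultra_setT => m /=.
  by have := fC m; rewrite ler_norml => /andP[].
exists (sup S) => e e0.
have [t St ht] := sup_adherent e0 (conj Sn (ex_intro _ C SC)).
have : U [set m | f m < sup S + e / 2].
  have h : ~ S (sup S + e / 2).
    by move=> /(@ub_le_sup _ S (ex_intro _ C SC)) ?; lra.
  apply: (filterS _ (ultra_notin h)) => m /= /negP; by rewrite -ltNge.
move=> /(filterI St); apply: filterS => m [/= h1 h2].
by rewrite ltr_norml; apply/andP; split; lra.
Qed.

Lemma ulimit_near f l t : ulimit f l -> l < t -> U [set m | f m < t].
Proof.
move=> fl lt; have := fl (t - l) ltac:(lra); apply: filterS => m /=.
by rewrite ltr_norml => /andP[_ ?]; lra.
Qed.

Lemma ulimit_near_gt f l t : ulimit f l -> t < l -> U [set m | t < f m].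
Proof.
move=> fl lt; have := fl (l - t) ltac:(lra); apply: filterS => m /=.
by rewrite ltr_norml => /andP[? _]; lra.
Qed.

Lemma ulimit_le f g k l : ulimit f k -> ulimit g l -> U [set m | f m <= g m] -> k <= l.
Proof.
move=> fk gl fg; rewrite leNgt; apply/negP => lk.
have h1 := @ulimit_near g l ((k + l) / 2) gl ltac:(lra).
have h2 := @ulimit_near_gt f k ((k + l) / 2) fk ltac:(lra).
by have [m /= [[? ?] ?]] := ultra_ex (filterI (filterI h1 h2) fg); lra.
Qed.

Lemma ulimit_cst c : ulimit (fun=> c) c.
Proof. by move=> e e0; apply: ultra_setT => m /=; rewrite subrr normr0. Qed.

Lemma ulimit_le_cst f k t : ulimit f k -> U [set m | f m <= t] -> k <= t.
Proof. by move=> fk; exact: ulimit_le fk (ulimit_cst t). Qed.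

Lemma ulimit_ge_cst f k t : ulimit f k -> U [set m | t <= f m] -> t <= k.
Proof. by move=> fk; exact: ulimit_le (ulimit_cst t) fk. Qed.

Lemma ulimit_uniq f k l : ulimit f k -> ulimit f l -> k = l.
Proof.
move=> fk fl; apply/eqP; rewrite eq_le.
by rewrite (@ulimit_le f f k l)// ?(@ulimit_le f f l k)//; apply: ultra_setT => m /=.
Qed.

Lemma ulimit_near_eq f g l : U [set m | f m = g m] -> ulimit f l -> ulimit g l.
Proof.
by move=> fg fl e e0; apply: filterS (filterI fg (fl e e0)) => m [/= <-].
Qed.

Lemma eq_ulimit f g l : (forall m, f m = g m) -> ulimit f l -> ulimit g l.
Proof. by move=> fg; apply: ulimit_near_eq; exact: ultra_setT. Qed.

Lemma ulimitD f g k l : ulimit f k -> ulimit g l -> ulimit (fun m => f m + g m) (k + l).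
Proof.
move=> fk gl e e0; have e20 : 0 < e / 2 by lra.
apply: filterS (filterI (fk _ e20) (gl _ e20)) => m [/=].
by rewrite !ltr_norml => /andP[? ?] /andP[? ?]; apply/andP; split; lra.
Qed.

Lemma ulimitZ a f k : ulimit f k -> ulimit (fun m => a * f m) (a * k).
Proof.
move=> fk e e0; have a0 : 0 < `|a| + 1 by rewrite ltr_pwDr.
apply: filterS (fk (e / (`|a| + 1)) (divr_gt0 e0 a0)) => m /=.
rewrite ltr_pdivlMr// -mulrBr normrM => h.
apply: le_lt_trans h; rewrite mulrDr mulr1 mulrC lerDl; exact: normr_ge0.
Qed.

Lemma ulimitN f k : ulimit f k -> ulimit (fun m => - f m) (- k).
Proof.
move=> fk; rewrite -mulN1r; apply: eq_ulimit (ulimitZ (-1) fk) => m.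
by rewrite mulN1r.
Qed.

Lemma ulimitB f g k l : ulimit f k -> ulimit g l -> ulimit (fun m => f m - g m) (k - l).
Proof. by move=> fk gl; apply: ulimitD => //; exact: ulimitN. Qed.

Lemma ulimit_squeeze0 f g : U [set m | `|f m| <= g m] -> ulimit g 0 -> ulimit f 0.
Proof.
move=> fg g0 e e0; apply: filterS (filterI fg (g0 e e0)) => m [/= h1].
by rewrite !subr0 => h2; apply: le_lt_trans h1 (le_lt_trans (ler_norm _) h2).
Qed.

Lemma ulimit_sum (I : finType) (F : I -> M -> R) (l : I -> R) :
  (forall i, ulimit (F i) (l i)) -> ulimit (fun m => \sum_i F i m) (\sum_i l i).
Proof.
move=> h; rewrite /index_enum -enumT; elim: (enum I) => [|i s IH].
  rewrite big_nil; apply: eq_ulimit (ulimit_cst 0) => m; by rewrite big_nil.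
rewrite big_cons; apply: eq_ulimit (ulimitD (h i) IH) => m.
by rewrite big_cons.
Qed.

Lemma ulimit_le0 f : (forall e, 0 < e -> U [set m | `|f m| <= e]) -> ulimit f 0.
Proof.
move=> h e e0; have := h (e / 2) ltac:(lra); apply: filterS => m /=.
by rewrite subr0 => ?; lra.
Qed.

Definition ulim (f : M -> R) : R := xget 0 [set l | ulimit f l].

Lemma ulimE f l : ulimit f l -> ulim f = l.
Proof.
move=> fl; rewrite /ulim; case: xgetP => [k -> /= fk|/(_ l)//].
exact: ulimit_uniq fk fl.
Qed.

Lemma ulimP f C : (forall m, `|f m| <= C) -> ulimit f (ulim f).
Proof. by move=> /ulimit_ex[l fl]; rewrite (ulimE fl). Qed.

End UltraLimits.

Lemma ultraP M (U : set_system M) : ProperFilter U ->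
  (forall A, U A \/ U (~` A)) -> UltraFilter U.
Proof.
move=> UF UA; split=> // G GF UG; apply/seteqP; split=> // A GA.
have [//|/UG GnA] := UA A.
by have [m []] := filter_ex (filterI GA GnA).
Qed.

(** [P t s] is read as [s] coming after [t]; directedness makes the tails a proper filter, which an
    ultrafilter refines. *)
Lemma directed_ultra (T : Type) (P : T -> T -> Prop) (t0 : T) :
  (forall t, P t t) -> (forall r s t, P r s -> P s t -> P r t) ->
  (forall s t, exists u, P s u /\ P t u) ->
  exists U : set_system T, UltraFilter U /\ forall t, U [set s | P t s].
Proof.
move=> Pr Pt Pd.
have FF : ProperFilter (filter_from setT (fun t => [set s | P t s])).
  apply: filter_from_proper; last by move=> t _; exists t; exact: Pr.
  apply: filter_from_filter; first by exists t0.
  move=> s t _ _; have [u [su tu]] := Pd s t; exists u => // v /= uv.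
  by split; [exact: Pt su uv|exact: Pt tu uv].
have [U [UU FU]] := ultraFilterLemma FF.
by exists U; split=> // t; apply: FU; exists t.
Qed.

Section UltraProduct.
Variables (R : realType) (M N : Type) (U : set_system M) (W : set_system N).
Context {UU : UltraFilter U} {WW : UltraFilter W}.

(** The Fubini product. Limits along it are iterated with the second index going first, so the
    second net is far out relative to each fixed index of the first. *)
Definition uprod : set_system (M * N) :=
  [set A | U [set m | W [set n | A (m, n)]]].

Lemma uprod_ultra : UltraFilter uprod.
Proof.
apply: ultraP.
  apply: Build_ProperFilter_ex.
      by move=> A /(@ultra_ex M U _) [m /(@ultra_ex N W _) [n Amn]]; exists (m, n).
  split.
  - by apply: (@ultra_setT M U _) => m; exact: (@ultra_setT N W _).
  - move=> A B; rewrite /uprod /= => UA UB; apply: (filterS (F := U) _ (filterI UA UB)) => m [/= h1 h2].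
    exact: filterS (filterI h1 h2).
  - by move=> A B AB; apply: (filterS (F := U)) => m /=; apply: (filterS (F := W)) => n; exact: AB.
move=> A; have [|nA] := pselect (uprod A); [by left|right].
apply: (filterS (F := U) _ (@ultra_notin M U _ _ nA)) => m /= h.
exact: ultra_notin.
Qed.

Local Existing Instance uprod_ultra.

Lemma ulimit_uprod (F : M * N -> R) (g : M -> R) l :
  (forall m, ulimit W (fun n => F (m, n)) (g m)) -> ulimit U g l ->
  ulimit uprod F l.
Proof.
move=> Fg gl e e0; have := gl (e / 2) ltac:(lra); apply: filterS => m /= h1.
have := Fg m (e / 2) ltac:(lra); apply: filterS => n /=; move: h1.
by rewrite !ltr_norml => /andP[? ?] /andP[? ?]; apply/andP; split; lra.
Qed.

Lemma ulimit_fst (f : M -> R) l : ulimit U f l ->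
  ulimit uprod (fun mn => f mn.1) l.
Proof. by apply: (@ulimit_uprod _ f) => m /=; exact: ulimit_cst. Qed.

Lemma ulimit_snd (f : N -> R) l : ulimit W f l ->
  ulimit uprod (fun mn => f mn.2) l.
Proof. by move=> fl; apply: (@ulimit_uprod _ (fun=> l)) => //; exact: ulimit_cst. Qed.

End UltraProduct.
Arguments ulimit {R M} U f l.
Arguments ulim {R M} U f.
Arguments uprod {M N} U W.

(** * Noncreasy seminorms *)

Section AbsNorm.
Variables (R : realType) (r : nat) (psi : absnorm R r).
Hypothesis psi_sm : strictly_monotone psi.
Implicit Types x y : 'I_r -> R.

Lemma psi0 : psi (fun=> 0) = 0.
Proof.
have e : psi (fun=> 0 * 0) = 0.
  by apply: etrans (psi_hom psi 0 (fun=> 0)) _; rewrite normr0 mul0r.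
by rewrite -[RHS]e; congr (psi _); apply/funext => i; rewrite mul0r.
Qed.

Lemma psi_mono x y : (forall i, 0 <= x i <= y i) -> psi x <= psi y.
Proof.
move=> xy; have [h|/forallNP h] := pselect (exists i, x i < y i); last first.
  suff -> : x = y by [].
  apply/funext => i; apply/eqP; rewrite eq_le; have /andP[_ ->]/= := xy i.
  by rewrite leNgt; exact/negP.
have n i : `|x i| = x i /\ `|y i| = y i.
  have /andP[x0 xyi] := xy i; split; apply: ger0_norm => //; exact: le_trans xyi.
apply/ltW/psi_sm => [i|].
  by have [-> ->] := n i; have /andP[] := xy i.
by case: h => i xyi; exists i; have [-> ->] := n i.
Qed.

(** A strict inequality in one coordinate would make [psi y] larger. This rigidity turns metric
    equalities in the sum into equalities in every coordinate. *)
Lemma psi_le_eq x y : (forall i, 0 <= x i <= y i) -> psi y <= psi x -> x = y.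
Proof.
move=> xy yx; apply/funext => i; apply/eqP; rewrite eq_le; have /andP[_ ->]/= := xy i.
rewrite leNgt; apply/negP => h; move: yx; rewrite leNgt => /negP; apply.
have n j : `|x j| = x j /\ `|y j| = y j.
  have /andP[x0 xyj] := xy j; split; apply: ger0_norm => //; exact: le_trans xyj.
apply: psi_sm => [j|]; first by have [-> ->] := n j; have /andP[] := xy j.
by exists i; have [-> ->] := n i.
Qed.

Lemma psi_coord x i : (forall j, 0 <= x j) -> x i <= psi x.
Proof.
move=> x0; rewrite -[leLHS]mulr1 -[in leLHS](psi_normalized psi i).
rewrite -[in leLHS](ger0_norm (x0 i)) -psi_hom; apply: psi_mono => j.
by case: eqVneq => [->|_]; rewrite ?mulr1 ?mulr0 lexx x0.
Qed.

Lemma psi_le_sum x : psi x <= \sum_i `|x i|.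
Proof.
have aux (s : seq 'I_r) (F : 'I_r -> 'I_r -> R) :
    psi (fun j => \sum_(i <- s) F i j) <= \sum_(i <- s) psi (F i).
  elim: s => [|i s IH].
    by rewrite big_nil; under [X in psi X]eq_fun do rewrite big_nil; rewrite psi0.
  rewrite big_cons; under [X in psi X]eq_fun do rewrite big_cons.
  by apply: (le_trans (psi_triangle _ _ _)); rewrite lerD2l.
have := aux (index_enum 'I_r) (fun i j => x i * (j == i)%:R).
set y := fun j => _; have -> : y = x.
  apply/funext => j; rewrite /y (bigD1 j)//= eqxx mulr1 big1 ?addr0// => i.
  by rewrite eq_sym => /negPf ->; rewrite mulr0.
move=> h; apply: (le_trans h); apply: ler_sum => i _.
by rewrite psi_hom psi_normalized mulr1.
Qed.

Lemma psi_dist x y : psi x <= psi y + \sum_i `|x i - y i|.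
Proof.
have := psi_triangle psi y (fun i => x i - y i).
under [X in psi X]eq_fun do rewrite subrKC.
by have := psi_le_sum (fun i => x i - y i) => ? ?; lra.
Qed.

Lemma ulimit_psi M (U : set_system M) {UU : UltraFilter U} (F : 'I_r -> M -> R) l :
  (forall i, ulimit U (F i) (l i)) -> ulimit U (fun m => psi (fun i => F i m)) (psi l).
Proof.
move=> h; suff : ulimit U (fun m => psi (fun i => F i m) - psi l) 0.
  by move=> /ulimitD/(_ (ulimit_cst (psi l))); rewrite add0r;
     apply: eq_ulimit => m; rewrite subrK.
apply: (@ulimit_squeeze0 _ _ _ _ _ (fun m => \sum_i `|F i m - l i|)).
  apply: ultra_setT => m; have := psi_dist (fun i => F i m) l.
  have := psi_dist l (fun i => F i m); under eq_bigr do rewrite distrC.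
  by move=> ? ? /=; rewrite ler_norml; apply/andP; split; lra.
suff : ulimit U (fun m => \sum_i `|F i m - l i|) (\sum_(i < r) 0) by rewrite big1.
apply: ulimit_sum => i; apply: ulimit_le0 => e e0.
by apply: filterS (h i e e0) => m /=; rewrite normr_id => /ltW.
Qed.

End AbsNorm.

Section SumSeminorm.
Variables (R : realType) (r : nat) (psi : absnorm R r) (V : lmodType R).
Hypothesis psi_sm : strictly_monotone psi.
Variable q : 'I_r -> V -> R.
Hypothesis qs : forall i, seminorm (q i).

Definition sumnorm (v : V) := psi (fun i => q i v).

Lemma sumnorm_seminorm : seminorm sumnorm.
Proof.
split=> [x y|a x].
  apply: le_trans (psi_triangle _ _ _); apply: (psi_mono psi_sm) => i.
  by rewrite seminorm_ge0//=; exact: (qs i).1.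
rewrite -[`|a|]normr_id -psi_hom; congr (psi _); apply/funext => i.
exact: (qs i).2.
Qed.

Lemma coord_sumnorm i v : q i v <= sumnorm v.
Proof. by apply: psi_coord => // j; exact: seminorm_ge0. Qed.

End SumSeminorm.

Section Unc.
Variables (R : realType).

(** Uniform noncreasiness without dual norms: unit functionals become functionals below [q], their
    distance is witnessed at one point [p], and the diameter is tested on [u] and [v]. The bounds
    [1 + d] leave room for almost isometries, and only finitely many vectors have to be moved from
    one space to another. *)
Definition unc (V : lmodType R) (q : V -> R) := forall e, 0 < e ->
  exists2 d, 0 < d & forall (f g : V -> R) (u v p : V), lin f -> lin g ->
    (forall x, f x <= q x) -> (forall x, g x <= q x) ->
    q u <= 1 + d -> q v <= 1 + d -> q p <= 1 + d ->
    1 - d <= f u -> 1 - d <= f v -> 1 - d <= g u -> 1 - d <= g v ->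
    e <= f p - g p -> q (u - v) <= e.

Section Nets.
Variables (M : Type) (U : set_system M).
Context {UU : UltraFilter U}.

Definition ule (f : M -> R) c := forall e, 0 < e -> U [set m | f m <= c + e].
Definition uge (f : M -> R) c := forall e, 0 < e -> U [set m | c - e <= f m].

Lemma ulimit_ule f c : ulimit U f c -> ule f c.
Proof.
move=> fc e e0; apply: filterS (fc e e0) => m /=.
by rewrite ltr_norml => /andP[? ?]; lra.
Qed.

Lemma ulimit_uge f c : ulimit U f c -> uge f c.
Proof.
move=> fc e e0; apply: filterS (fc e e0) => m /=.
by rewrite ltr_norml => /andP[? ?]; lra.
Qed.

Lemma ulimit_of_ule_uge f c : ule f c -> uge f c -> ulimit U f c.
Proof.
move=> fc cf e e0; have e20 : 0 < e / 2 by lra.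
apply: filterS (filterI (fc _ e20) (cf _ e20)) => m [/= ? ?].
by rewrite ltr_norml; apply/andP; split; lra.
Qed.

Lemma unc_net (V : lmodType R) (q : V -> R) (f g : M -> V -> R) (u v p : M -> V) c s :
  seminorm q -> unc q -> 0 < c -> 0 < s ->
  (forall m, lin (f m) /\ forall x, f m x <= q x) ->
  (forall m, lin (g m) /\ forall x, g m x <= q x) ->
  ule (fun m => q (u m)) c -> ule (fun m => q (v m)) c -> ule (fun m => q (p m)) c ->
  uge (fun m => f m (u m)) c -> uge (fun m => f m (v m)) c ->
  uge (fun m => g m (u m)) c -> uge (fun m => g m (v m)) c ->
  uge (fun m => f m (p m) - g m (p m)) s ->
  ulimit U (fun m => q (u m - v m)) 0.
Proof.
move=> qs uncq c0 s0 fl gl qu qv qp fu fv gu gv fgp.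
apply: ulimit_le0 => e e0.
(* One parameter serves twice: [e / c] bounds the diameter, and [s / 2 / c] stays below the gap of
   the functionals at the rescaled point. *)
pose e1 := Num.min (e / c) (s / 2 / c).
have e10 : 0 < e1 by rewrite lt_min !divr_gt0//.
have [d d0 hd] := uncq _ e10.
have cd0 : 0 < c * d by exact: mulr_gt0.
have s20 : 0 < s / 2 by lra.
apply: filterS (filterI (filterI (filterI (qu _ cd0) (qv _ cd0)) (qp _ cd0))
  (filterI (filterI (filterI (fu _ cd0) (fv _ cd0)) (filterI (gu _ cd0) (gv _ cd0)))
  (fgp _ s20))) => m /= [[[h1 h2] h3] [[[h4 h5] [h6 h7]] h8]].
rewrite ger0_norm; last exact: seminorm_ge0.
have ci : 0 < c^-1 by rewrite invr_gt0.
have qZ x : q (c^-1 *: x) = q x / c by rewrite qs.2 gtr0_norm// mulrC.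
have cE a : c * (1 + a) = c + c * a by ring.
have cE' a : c * (1 - a) = c - c * a by ring.
have fZ (h : V -> R) x : lin h -> h (c^-1 *: x) = h x / c by move=> hl; rewrite linZ// mulrC.
have le1 x : q x <= c + c * d -> q (c^-1 *: x) <= 1 + d.
  by move=> ?; rewrite qZ ler_pdivrMr// mulrC cE.
have ge1 (h : V -> R) x : lin h -> c - c * d <= h x -> 1 - d <= h (c^-1 *: x).
  by move=> hl ?; rewrite fZ// ler_pdivlMr// mulrC cE'.
have [[fm fmq] [gm gmq]] := (fl m, gl m).
have := hd (f m) (g m) (c^-1 *: u m) (c^-1 *: v m) (c^-1 *: p m) fm gm fmq gmq
  (le1 _ h1) (le1 _ h2) (le1 _ h3) (ge1 _ _ fm h4) (ge1 _ _ fm h5)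
  (ge1 _ _ gm h6) (ge1 _ _ gm h7).
rewrite !fZ// -mulrBl -scalerBr qZ => h; rewrite -(ler_pM2r ci).
apply: le_trans (h _) _; last by rewrite /e1 ge_min lexx.
apply: (@le_trans _ _ (s / 2 / c)); first by rewrite /e1 ge_min lexx orbT.
by rewrite ler_pM2r//; lra.
Qed.

End Nets.

Section Transfer.
Variables (V X : lmodType R) (p : X -> R) (q : V -> R).
Variables (M : Type) (U : set_system M) (T : M -> V -> X).
Context {UU : UltraFilter U}.
Hypotheses (ps : seminorm p) (qs : seminorm q).
Hypothesis Tq : forall v, ulimit U (fun m => p (T m v)) (q v).
Hypothesis Tlin : forall v1 v2 v3, U [set m | forall a b c,
  T m (a *: v1 + b *: v2 + c *: v3) = a *: T m v1 + b *: T m v2 + c *: T m v3].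

(** Where no such [F] exists, [mazur_orlicz] yields a convex combination of [v1], [v2], [v3] at
    which [p (T m _)] is at most [f _ - eta]. The coefficients lie in a compact simplex, and at
    their limit along [U] the inequality [f <= q] would fail. *)
Lemma pull_functional f v1 v2 v3 eta : lin f -> (forall x, f x <= q x) -> 0 < eta ->
  U [set m | exists F, [/\ lin F, forall x, F x <= p x, f v1 - eta <= F (T m v1),
    f v2 - eta <= F (T m v2) & f v3 - eta <= F (T m v3)]].
Proof.
pose good := [set m : M | exists F, [/\ lin F, forall x, F x <= p x, f v1 - eta <= F (T m v1),
    f v2 - eta <= F (T m v2) & f v3 - eta <= F (T m v3)]].
move=> fl fq eta0; apply: contrapT => /ultra_notin nF.
pose P m (abc : R * R * R) := let: (a, b, c) := abc in
  [/\ 0 <= a <= 1, 0 <= b <= 1, 0 <= c <= 1 & a + b + c = 1 /\ (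
  (~` good) m ->
   (forall a b c,
  T m (a *: v1 + b *: v2 + c *: v3) = a *: T m v1 + b *: T m v2 + c *: T m v3) ->
  p (T m (a *: v1 + b *: v2 + c *: v3)) <= f (a *: v1 + b *: v2 + c *: v3) - eta)].
have [abc Pabc] : {abc & forall m, P m (abc m)}.
  apply: choice => m.
  have [[nm lm]|nm] := pselect ((~` good) m /\ (forall a b c,
  T m (a *: v1 + b *: v2 + c *: v3) = a *: T m v1 + b *: T m v2 + c *: T m v3)); last first.
    (* At the remaining indices any point of the simplex will do. *)
    exists (1, 0, 0); split; [lra|lra|lra|split; first by lra].
    by move=> h1 h2; exfalso; apply: nm; split.
  apply: contrapT => /forallNP nP; apply: nm.
  pose Q : set (X * R) := [set u | exists a b c, [/\ 0 <= a, 0 <= b, 0 <= c, a + b + c = 1 &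
    u = (a *: T m v1 + b *: T m v2 + c *: T m v3,
         a * (f v1 - eta) + b * (f v2 - eta) + c * (f v3 - eta))]].
  have [||| F [Fl Fp FQ]] := @mazur_orlicz _ _ p Q.
  - exact: seminorm_sublinear.
  - move=> _ _ s t [a [b [c [a0 b0 c0 abc ->]]]] [a' [b' [c' [a0' b0' c0' abc' ->]]]] s0 t0 st.
    exists (s * a + t * a'), (s * b + t * b'), (s * c + t * c').
    split; rewrite ?addr_ge0 ?mulr_ge0//.
      by rewrite -st -[s in RHS]mulr1 -[t in RHS]mulr1 -{1}abc -{1}abc'; ring.
    congr (_, _) => /=; last by ring.
    rewrite !scalerDr !scalerDl !scalerA.
    by rewrite addrACA [X in X + _]addrACA.
  - move=> _ [a [b [c [a0 b0 c0 abc ->]]]] /=; rewrite leNgt; apply/negP => h.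
    apply: (nP (a, b, c)); split; [lra|lra|lra|split=> // _ _].
    rewrite lm !(linD _ _ fl) !(linZ _ _ fl).
    apply: le_trans (ltW h) _.
    have -> : c = 1 - a - b by lra.
    by rewrite le_eqVlt; apply/orP; left; apply/eqP; ring.
  exists F; split=> //.
  - have := FQ (T m v1, f v1 - eta); apply; exists 1, 0, 0; split=> //; first by rewrite !addr0.
    by rewrite !scale0r scale1r !addr0 mul1r !mul0r !addr0.
  - have := FQ (T m v2, f v2 - eta); apply; exists 0, 1, 0; split=> //; first by rewrite addr0 add0r.
    by rewrite !scale0r scale1r addr0 add0r mul1r !mul0r addr0 add0r.
  - have := FQ (T m v3, f v3 - eta); apply; exists 0, 0, 1; split=> //; first by rewrite !add0r.
    by rewrite !scale0r scale1r !add0r mul1r !mul0r !add0r.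
pose a m := (abc m).1.1; pose b m := (abc m).1.2; pose c m := (abc m).2.
have bnd m : [/\ `|a m| <= 1, `|b m| <= 1 & `|c m| <= 1].
  have := Pabc m; rewrite /P /a /b /c; case: (abc m) => [[a' b'] c'] /= [? ? ? _].
  by split; rewrite ler_norml; lra.
have [a0 al] := @ulimit_ex R _ U _ a 1 ltac:(by move=> m; case: (bnd m)).
have [b0 bl] := @ulimit_ex R _ U _ b 1 ltac:(by move=> m; case: (bnd m)).
have [c0 cl] := @ulimit_ex R _ U _ c 1 ltac:(by move=> m; case: (bnd m)).
pose es := a0 *: v1 + b0 *: v2 + c0 *: v3.
have fe : ulimit U (fun m => f (a m *: v1 + b m *: v2 + c m *: v3) - eta) (f es - eta).
  apply: ulimitB; last exact: ulimit_cst.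
  have E x y z : f (x *: v1 + y *: v2 + z *: v3) = f v1 * x + f v2 * y + f v3 * z.
    by rewrite !(linD _ _ fl) !(linZ _ _ fl); ring.
  rewrite /es E; apply: eq_ulimit (ulimitD (ulimitD
    (ulimitZ (f v1) al) (ulimitZ (f v2) bl)) (ulimitZ (f v3) cl)).
  by move=> m; rewrite E.
pose K := q v1 + q v2 + q v3 + 1.
have K1 : U [set m | p (T m v1) <= K /\ p (T m v2) <= K /\ p (T m v3) <= K].
  have Q1 := seminorm_ge0 v1 qs.
  have Q2 := seminorm_ge0 v2 qs.
  have Q3 := seminorm_ge0 v3 qs.
  have h1 := @ulimit_near _ _ _ _ _ _ K (Tq v1) ltac:(by rewrite /K; lra).
  have h2 := @ulimit_near _ _ _ _ _ _ K (Tq v2) ltac:(by rewrite /K; lra).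
  have h3 := @ulimit_near _ _ _ _ _ _ K (Tq v3) ltac:(by rewrite /K; lra).
  by apply: filterS (filterI h1 (filterI h2 h3)) => m [/= /ltW ? [/ltW ? /ltW ?]].
pose D m := K * `|a m - a0| + K * `|b m - b0| + K * `|c m - c0|.
have dist0 (h : M -> R) h0 : ulimit U h h0 -> ulimit U (fun m => `|h m - h0|) 0.
  by move=> hl e e0; apply: filterS (hl e e0) => m /=; rewrite subr0 normr_id.
have D0 : ulimit U D 0.
  have <- : K * 0 + K * 0 + K * 0 = 0 by rewrite !mulr0 !addr0.
  exact: (ulimitD (ulimitD (ulimitZ K (dist0 _ _ al)) (ulimitZ K (dist0 _ _ bl))) (ulimitZ K (dist0 _ _ cl))).
suff : q es - 0 <= f es - eta by have := fq es => ? ?; lra.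
apply: ulimit_le (ulimitB (Tq es) D0) fe _.
apply: filterS (ultraI (ultraI nF (Tlin v1 v2 v3)) K1) => m [[nm lm] [k1 [k2 k3]]] /=.
have := Pabc m; rewrite /P /D /a /b /c; case: (abc m) => [[a' b'] c'] /= [_ _ _ [_ /(_ nm lm)]].
apply: le_trans.
have := ps.1 ((a0 - a') *: T m v1 + (b0 - b') *: T m v2 + (c0 - c') *: T m v3)
             (a' *: T m v1 + b' *: T m v2 + c' *: T m v3).
rewrite lm -/es /es lm.
have -> : (a0 - a') *: T m v1 + (b0 - b') *: T m v2 + (c0 - c') *: T m v3 +
  (a' *: T m v1 + b' *: T m v2 + c' *: T m v3) = a0 *: T m v1 + b0 *: T m v2 + c0 *: T m v3.
  by rewrite addrACA (addrACA ((a0 - a') *: _)) -!scalerDl !subrK.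
have t1 := ps.1 ((a0 - a') *: T m v1 + (b0 - b') *: T m v2) ((c0 - c') *: T m v3).
have t2 := ps.1 ((a0 - a') *: T m v1) ((b0 - b') *: T m v2).
rewrite !ps.2 in t1 t2.
have u1 := ler_wpM2l (normr_ge0 (a0 - a')) k1.
have u2 := ler_wpM2l (normr_ge0 (b0 - b')) k2.
have u3 := ler_wpM2l (normr_ge0 (c0 - c')) k3.
rewrite (distrC a') (distrC b') (distrC c') => ?; rewrite !(mulrC K) in u1 u2 u3 *; lra.
Qed.

Lemma unc_transfer : unc p -> unc q.
Proof.
move=> uncp e e0; have [d d0 hd] := uncp (e / 2) ltac:(lra).
pose eta := Num.min (d / 2) (e / 4).
have eta0 : 0 < eta by rewrite lt_min; lra.
have [eta1 eta2] : eta <= d / 2 /\ eta <= e / 4 by rewrite !ge_min !lexx ?orbT.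
exists (d / 2); first by lra.
move=> f g u v w fl gl fq gq qu qv qw fu fv gu gv fg.
have Hf := pull_functional u v w fl fq eta0.
(* Only lower bounds are pulled back, so [- w] is used to bound [G] from above at [w]. The gap then
   loses at most [2 * eta], hence at most half of [e]. *)
have Hg := pull_functional u v (- w) gl gq eta0.
have L1 := Tlin u v w.
have [n1 n2 n3] : [/\ U [set m | p (T m u) < 1 + d], U [set m | p (T m v) < 1 + d] &
   U [set m | p (T m w) < 1 + d]].
  by split; apply: ulimit_near (Tq _) _; lra.
apply: (ulimit_le_cst (Tq (u - v))).
apply: filterS (filterI (filterI Hf Hg) (filterI L1 (filterI n1 (filterI n2 n3)))).
move=> m [[[F [Fl Fp F1 F2 F3]] [G [Gl Gp G1 G2 G3]]] [l1 [m1 [m2 m3]]]] /=.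
have lw : T m (- w) = - T m w.
  by have := l1 0 0 (-1); rewrite !scale0r !add0r !scaleN1r.
have -> : T m (u - v) = T m u - T m v.
  by have := l1 1 (-1) 0; rewrite !scale0r !addr0 !scale1r !scaleN1r.
rewrite lw (linN _ Gl) (linN _ gl) in G3.
have := hd F G (T m u) (T m v) (T m w) Fl Gl Fp Gp (ltW m1) (ltW m2) (ltW m3)
  ltac:(lra) ltac:(lra) ltac:(lra) ltac:(lra) ltac:(lra).
by move=> ?; lra.
Qed.

End Transfer.
End Unc.

(** * Splitting a functional among the coordinates *)

Section Decomposition.
Variables (R : realType) (r : nat) (psi : absnorm R r) (V : lmodType R).
Hypothesis psi_sm : strictly_monotone psi.
Variable q : 'I_r -> V -> R.
Hypothesis qs : forall i, seminorm (q i).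

(** [V] sits in the sum of [r] copies of itself as the diagonal. Extending [f] from the diagonal and
    restricting to each copy gives the coordinate functionals. *)
Lemma diagonal_extension (f : V -> R) : lin f -> (forall v, f v <= sumnorm psi q v) ->
  exists F : 'I_r -> V -> R, [/\ forall i, lin (F i), forall v, f v = \sum_i F i v &
    forall w : 'I_r -> V, \sum_i F i (w i) <= psi (fun i => q i (w i))].
Proof.
move=> fl fN.
pose p (w : 'I_r -> V) := psi (fun i => q i (w i)).
have ps : seminorm p.
  split=> [x y|a x].
    apply: le_trans (psi_triangle _ _ _); apply: (psi_mono psi_sm) => i.
    by rewrite seminorm_ge0//=; exact: (qs i).1.
  rewrite -[`|a|]normr_id -psi_hom; congr (psi _); apply/funext => i.
  exact: (qs i).2.
have [||G [Gl Gp GQ]] := @mazur_orlicz R _ p [set ((fun=> v), f v) | v in setT]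
    (seminorm_sublinear ps).
- move=> _ _ s t [v _ <-] [w _ <-] _ _ _ /=; exists (s *: v + t *: w) => //.
  by rewrite linD// (linZ s v fl) (linZ t w fl).
- by move=> _ [v _ <-] /=; exact: fN.
have Gd v : G (fun=> v) = f v.
  apply/eqP; rewrite eq_le; apply/andP; split; last by apply: (GQ ((fun=> v), f v)); exists v.
  have := GQ ((fun=> - v), f (- v)) (ex_intro2 _ _ (- v) I erefl).
  have -> : (fun=> - v) = - (fun=> v) :> ('I_r -> V) by [].
  by rewrite /= !linN// lerN2.
pose single i x : 'I_r -> V := fun j => if j == i then x else 0.
have Gsum w : \sum_i G (single i (w i)) = G w.
  rewrite -(big_morph G (fun x y => linD x y Gl) (lin0 Gl)); congr G.
  apply/funext => j; rewrite fct_sumE (bigD1 j)//= /single eqxx big1 ?addr0// => i.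
  by rewrite eq_sym => /negPf ->.
exists (fun i x => G (single i x)); split=> [i a x y|v|w].
- rewrite -Gl; congr G; apply/funext => j; rewrite /single.
  rewrite [RHS]/GRing.add /= [X in _ = X + _]/GRing.scale /=.
  by case: ifP => // _; rewrite scaler0 addr0.
- by rewrite -Gd -Gsum.
- by rewrite Gsum; exact: Gp.
Qed.

(** [phi i] is the norm of [F i] relative to [q i]; the last clause says that [phi] has norm at most
    1 in the dual of [psi]. *)
Lemma split_functional (f : V -> R) : lin f -> (forall v, f v <= sumnorm psi q v) ->
  exists (F : 'I_r -> V -> R) (phi : 'I_r -> R),
  [/\ forall i, lin (F i), forall i v, F i v <= phi i * q i v, forall i, 0 <= phi i <= 1,
    forall v, f v = \sum_i F i v &
    forall t : 'I_r -> R, (forall i, 0 <= t i) -> \sum_i phi i * t i <= psi t].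
Proof.
move=> fl fN; have [F [Fl fF Fpsi]] := diagonal_extension fl fN.
have Fq i v : F i v <= q i v.
  have := Fpsi (fun j => if j == i then v else 0).
  rewrite (bigD1 i)//= eqxx big1 ?addr0; last first.
    by move=> j /negPf ->; exact: lin0.
  move=> h; apply: (le_trans h); rewrite -[leRHS]mulr1 -[X in _ * X](psi_normalized psi i).
  rewrite -[X in X * _](ger0_norm (seminorm_ge0 _ (qs i))) -psi_hom; apply: (psi_mono psi_sm) => j.
  by case: eqVneq => [->|_]; rewrite ?mulr1 ?mulr0 ?seminorm0// ?lexx ?seminorm_ge0.
pose S i := [set F i v | v in [set v | q i v <= 1]].
have Sub i : ubound (S i) 1 by move=> _ [v /= v1 <-]; exact: le_trans (Fq i v) v1.
have S0 i : S i 0 by exists 0; [rewrite /= seminorm0//|exact: lin0].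
pose phi i := sup (S i).
have phi_ge i v : q i v <= 1 -> F i v <= phi i.
  by move=> v1; apply: ub_le_sup; [exists 1; exact: Sub|exists v].
have phi0 i : 0 <= phi i by rewrite -(lin0 (Fl i)) phi_ge// seminorm0.
have phi1 i : phi i <= 1 by apply: ge_sup => //; exists 0.
have phi_psi t : (forall i, 0 <= t i) -> \sum_i phi i * t i <= psi t.
  move=> t0; apply/ler_addgt0Pr => e e0.
  pose K := \sum_i t i + 1.
  have K0 : 0 < K by rewrite /K ltr_wpDl// sumr_ge0.
  have /choice[w hw] i : exists v, q i v <= 1 /\ phi i - e / K <= F i v.
    have [|_ [v v1 <-] hv] := @sup_adherent _ (S i) (e / K) (divr_gt0 e0 K0) _.
      by split; [exists 0|exists 1].
    by exists v; split=> //; exact: ltW.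
  apply: (@le_trans _ _ (\sum_i (F i (t i *: w i) + e / K * t i))).
    apply: ler_sum => i _; rewrite (linZ _ _ (Fl i)) mulrC (mulrC _ (t i)) -mulrDr.
    by rewrite ler_wpM2l//; have [_ ?] := hw i; lra.
  rewrite big_split/= -mulr_sumr lerD//.
    apply: (le_trans (Fpsi _)); apply: (psi_mono psi_sm) => i.
    rewrite seminorm_ge0//= (qs i).2 ger0_norm// -[leRHS]mulr1 ler_wpM2l//.
    by have [] := hw i.
  rewrite mulrAC ler_pdivrMr// ler_pM2l// /K; lra.
exists F, phi; split=> // [i v|i].
  have [q0|q0] := eqVneq (q i v) 0; first by rewrite q0 mulr0 -q0.
  have qp : 0 < q i v by rewrite lt_def q0 seminorm_ge0.
  rewrite -ler_pdivrMr// mulrC -linZ// phi_ge// (qs i).2 gtr0_norm ?invr_gt0//.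
  by rewrite mulVf.
by rewrite phi0 phi1.
Qed.

End Decomposition.

Section UncScaled.
Variables (R : realType) (V : lmodType R) (q : V -> R).
Hypothesis qs : seminorm q.

Lemma unc_scaled d e (F G : V -> R) (u v p : V) a b c :
  (forall (f g : V -> R) (u v p : V), lin f -> lin g ->
    (forall x, f x <= q x) -> (forall x, g x <= q x) ->
    q u <= 1 + d -> q v <= 1 + d -> q p <= 1 + d ->
    1 - d <= f u -> 1 - d <= f v -> 1 - d <= g u -> 1 - d <= g v ->
    e <= f p - g p -> q (u - v) <= e) ->
  0 < a -> 0 < b -> 0 < c -> lin F -> lin G ->
  (forall x, F x <= a * q x) -> (forall x, G x <= b * q x) ->
  q u <= c * (1 + d) -> q v <= c * (1 + d) -> q p <= c * (1 + d) ->
  a * c * (1 - d) <= F u -> a * c * (1 - d) <= F v -> a * c * (1 - d) <= F p ->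
  b * c * (1 - d) <= G u -> b * c * (1 - d) <= G v -> G p <= b * c * (1 - d - e) ->
  q (u - v) <= c * e.
Proof.
move=> H a0 b0 c0 Fl Gl Fa Gb qu qv qp Fu Fv Fp Gu Gv Gp.
have ci : 0 < c^-1 by rewrite invr_gt0.
have qZ x : q (c^-1 *: x) = q x / c by rewrite qs.2 gtr0_norm// mulrC.
have lq x : q x <= c * (1 + d) -> q (c^-1 *: x) <= 1 + d.
  by move=> ?; rewrite qZ ler_pdivrMr// mulrC.
have E k (h : V -> R) x : lin h -> k^-1 * h (c^-1 *: x) = h x / (k * c).
  by move=> hl; rewrite linZ// invfM; ring.
have lf k (h : V -> R) x : 0 < k -> lin h -> k * c * (1 - d) <= h x ->
    1 - d <= k^-1 * h (c^-1 *: x).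
  by move=> k0 hl hx; rewrite E// ler_pdivlMr ?mulr_gt0// mulrC.
have lef k (h : V -> R) : 0 < k -> (forall x, h x <= k * q x) -> forall x, k^-1 * h x <= q x.
  by move=> k0 hk x; rewrite mulrC ler_pdivrMr// mulrC.
have := H (fun x => a^-1 * F x) (fun x => b^-1 * G x) (c^-1 *: u) (c^-1 *: v) (c^-1 *: p)
  (linMl _ Fl) (linMl _ Gl) (lef _ _ a0 Fa) (lef _ _ b0 Gb) (lq _ qu) (lq _ qv) (lq _ qp)
  (lf _ _ _ a0 Fl Fu) (lf _ _ _ a0 Fl Fv) (lf _ _ _ b0 Gl Gu) (lf _ _ _ b0 Gl Gv).
rewrite -scalerBr qZ ler_pdivrMr// (mulrC e) => -> //.
have := lf _ _ _ a0 Fl Fp; suff : b^-1 * G (c^-1 *: p) <= 1 - d - e by lra.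
by rewrite E// ler_pdivrMr ?mulr_gt0// mulrC.
Qed.

End UncScaled.

Lemma exists_lower_bound (R : realType) (n : nat) (d : 'I_n -> R) k :
  (forall i, 0 < d i) -> 0 < k -> exists2 e, 0 < e <= k & forall i, e <= d i.
Proof.
move=> d0 k0.
have [e /andP[e0 ek] he] : exists2 e, 0 < e <= k & forall i, i \in enum 'I_n -> e <= d i.
  elim: (enum 'I_n) => [|i s [e /andP[e0 ek] he]]; first by exists k; rewrite ?k0 ?lexx.
  exists (Num.min e (d i)); first by rewrite lt_min e0 d0 ge_min ek.
  move=> j; rewrite inE => /predU1P[->|/he ej]; first by rewrite ge_min lexx orbT.
  by rewrite ge_min ej.
by exists e; [rewrite e0|move=> i; apply: he; rewrite mem_enum].
Qed.

Definition cvx (R : realType) (V : lmodType R) (A : set V) :=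
  forall x y s t, A x -> A y -> 0 <= s -> 0 <= t -> s + t = 1 -> A (s *: x + t *: y).

Definition directed_sets (T : Type) (C : set (set T)) :=
  forall A B, C A -> C B -> exists2 D, C D & D `<=` A `&` B.

(** [t] is the share of a positive radius falling to one of [n] coordinates, [e] the diameter
    allowed and [d] the slack in noncreasiness. A norming functional has size [p] between
    [2 / 5 * t] and about [n * t], so [e = 1 / (4 n)] limits its variation on such a diameter to
    about [t / 4], well below the drop [9 / 10 * t]; [eps] makes the other errors negligible. *)
Lemma norming_constants (R : realType) (n t e d eps : R) : 1 <= n -> 0 < t ->
  0 < d <= e -> e * n = 1 / 4 -> eps = d * t / 100 ->
  [/\ 3 * eps < n * t / 10, n * t + eps <= 101 / 100 * (n * t),
    forall a b, 9 / 10 * t <= a + b + eps -> a <= b + 2 * eps -> 2 / 5 * t <= b,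
    forall p, 2 / 5 * t <= p -> 3 * eps <= p * d /\ eps <= p * d &
    forall p, 0 < p -> p <= 101 / 100 * (n * t) ->
      p * e <= 101 / 400 * t /\ p * (d + e) <= 9 / 10 * t].
Proof.
move=> n1 t0 /andP[d0 de] en ->.
have n0 : 0 < n by exact: lt_le_trans n1.
have tn : t <= n * t by rewrite ler_peMl// ltW.
have dt0 : 0 < d * t by exact: mulr_gt0.
have e4 : e <= 1 / 4.
  have e0 := lt_le_trans d0 de.
  by have : e * 1 <= e * n by [rewrite ler_wpM2l// ltW]; rewrite mulr1 en.
have dt : d * t <= 1 / 4 * t by rewrite ler_wpM2r//; [exact: ltW|exact: le_trans e4].
split; [lra|lra|by move=> a b; lra| |].
  move=> p tp; have := ler_wpM2r (ltW d0) tp.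
  by split; lra.
move=> p p0 pn; have e0 := lt_le_trans d0 de.
have h : p * e <= 101 / 100 * (n * t) * e by rewrite ler_wpM2r// ltW.
have E : 101 / 100 * (n * t) * e = 101 / 100 * t * (e * n) by ring.
rewrite E en in h.
have : p * d <= p * e by rewrite ler_wpM2l// ltW.
by split; lra.
Qed.

(** * Weak limits *)

Section Centers.
Variables (R : realType) (r : nat) (psi : absnorm R r) (V : lmodType R).
Hypothesis psi_sm : strictly_monotone psi.
Variable q : 'I_r -> V -> R.
Hypothesis qs : forall i, seminorm (q i).
Hypothesis q_unc : forall i, unc (q i).
Local Notation N := (sumnorm psi q).

Variable C : set (set V).
Hypotheses (C0 : C !=set0) (Cdir : directed_sets C).
Hypothesis Ccvx : forall A, C A -> cvx A.

Definition meets rho x := forall A, C A -> exists2 a, A a & N (x - a) <= rho.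

Let Ns : seminorm N := sumnorm_seminorm psi_sm qs.

Lemma meets_ge0 rho x : meets rho x -> 0 <= rho.
Proof.
by case: C0 => A CA /(_ _ CA)[a _]; apply: le_trans; exact: seminorm_ge0.
Qed.

Section Contradiction.
Variables (theta : R) (th0 : 0 < theta).
Hypothesis th_le : forall rho x, meets rho x -> theta <= rho.
Hypothesis th_app : forall e, 0 < e -> exists o, meets (theta + e) o.

Let T := {A | C A}.

Lemma sets_ultra : exists U : set_system T, UltraFilter U /\
  forall A : T, U [set B | sval B `<=` sval A].
Proof.
case: C0 => A CA.
apply: (@directed_ultra T (fun A B => sval B `<=` sval A) (exist _ A CA)).
- by move=> t y.
- by move=> r' s t h1 h2; exact: subset_trans h2 h1.
- move=> s t; have [D CD] := Cdir (svalP s) (svalP t).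
  by rewrite subsetI => h; exists (exist _ D CD).
Qed.

(** If every set came closer than [theta - e] to some point of the segment from [o] to [x], a limit
    of these points would have radius below [theta]. So some [A] stays away from the whole segment,
    and separation gives one functional for both ends. *)
Lemma separate_segment e o x : 0 < e -> exists f : V -> R, [/\ lin f, forall v, f v <= N v &
  exists2 A, C A & forall a, A a -> theta - e <= f (a - o) /\ theta - e <= f (a - x)].
Proof.
move=> e0.
suff [A CA hA] : exists2 A, C A & forall a s, A a -> 0 <= s <= 1 ->
    theta - e <= N (a - (o + s *: (x - o))).
  have [||f [fl fN fQ]] := @mazur_orlicz R V N [set u | exists a s, [/\ A a, 0 <= s <= 1 &
      u = (a - (o + s *: (x - o)), theta - e)]] (seminorm_sublinear Ns).
  - move=> _ _ s t [a [k [Aa k01 ->]]] [b [l [Ab l01 ->]]] s0 t0 st /=.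
    exists (s *: a + t *: b), (s * k + t * l); split.
    + exact: Ccvx.
    + have : 0 <= s * k by apply: mulr_ge0 => //; lra.
      have : 0 <= t * l by apply: mulr_ge0 => //; lra.
      have : s * k <= s * 1 by apply: ler_wpM2l => //; lra.
      have : t * l <= t * 1 by apply: ler_wpM2l => //; lra.
      by lra.
    + congr (_, _) => /=; last by rewrite -mulrDl st mul1r.
      rewrite (scalerBr s) (scalerBr t) addrACA; congr (_ + _).
      rewrite -opprD; congr (- _).
      by rewrite !(scalerDr _ o) addrACA -scalerDl st scale1r !scalerA -scalerDl.
  - by move=> _ [a [s [Aa s01 ->]]]; exact: hA.
  exists f; split=> //; exists A => // a Aa; split.
    by apply: (fQ (a - o, theta - e)); exists a, 0; rewrite scale0r addr0 lexx ler01.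
  apply: (fQ (a - x, theta - e)); exists a, 1; rewrite scale1r lexx ler01; split=> //.
  by rewrite (addrC o) subrK.
apply: contrapT => h.
have [U [UU UT]] := sets_ultra.
have /choice[g hg] (A : T) : exists as_ : V * R, [/\ sval A as_.1, 0 <= as_.2 <= 1 &
    N (as_.1 - (o + as_.2 *: (x - o))) < theta - e].
  apply: contrapT => /forallNP nA; apply: h; exists (sval A); first exact: svalP.
  move=> a s Aa s01; rewrite leNgt; apply/negP => hlt; exact: (nA (a, s)).
have [s0 sl] : exists s0, ulimit U (fun A => (g A).2) s0.
  by apply: (@ulimit_ex R _ U _ _ 1) => A; have [_ ? _] := hg A; rewrite ler_norml; lra.
pose y := o + s0 *: (x - o).
suff : meets (theta - e / 2) y by move/th_le => ?; lra.
move=> A CA.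
have K0 : 0 < N (x - o) + 1 by rewrite ltr_wpDl// seminorm_ge0.
have e20 : 0 < e / ((N (x - o) + 1) * 2) by rewrite divr_gt0// mulr_gt0.
have [B [/= BA hB]] := ultra_ex (ultraI (UT (exist _ A CA)) (sl _ e20)).
have [gB _ lB] := hg B; exists (g B).1; first exact: BA.
rewrite (seminormB _ _ Ns).
have := seminormBD (g B).1 (o + (g B).2 *: (x - o)) y Ns.
rewrite {3}/y opprD addrACA subrr add0r -scalerBl Ns.2 => h1; apply: (le_trans h1).
have N0 := seminorm_ge0 (x - o) Ns.
have : `|(g B).2 - s0| * N (x - o) <= e / 2.
  apply: (@le_trans _ _ (`|(g B).2 - s0| * (N (x - o) + 1))).
    by rewrite ler_wpM2l// lerDl.
  rewrite -ler_pdivlMr//; apply: (le_trans (ltW hB)).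
  by rewrite invfM (mulrC (N _ + 1)^-1) mulrA.
by lra.
Qed.

Variable n : R.
Hypothesis nE : n = r.+1%:R.
Let n1 : 1 <= n. Proof. by rewrite nE ler1n. Qed.
Let n_gt0 : 0 < n. Proof. by rewrite nE ltr0n. Qed.

(** The functional of [separate_segment] is about [theta] on the net and at most [2 * eps] at
    [x - o]. Each of its coordinates almost norms the net, because the [phi i * c i] add up to at
    most [theta + eps]; by pigeonhole one coordinate sees a share of the drop at [x]. *)
Lemma almost_norming eps o c x : 0 < eps -> 3 * eps < theta / 10 ->
  meets (theta + eps) o ->
  forall (U : set_system T) (UU : UltraFilter U) (b : T -> V),
  (forall A : T, U [set B | sval B `<=` sval A]) ->
  (forall A, sval A (b A) /\ N (o - b A) <= theta + eps) ->
  (forall i, ulimit U (fun A => q i (b A - o)) (c i)) ->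
  exists i (F : V -> R) (phi : R), [/\ lin F, forall v, F v <= phi * q i v,
    0 <= phi <= 1, phi * c i <= theta + eps &
    U [set A | phi * c i - 3 * eps <= F (b A - o)] /\
    F (x - o) <= phi * c i - 9 / 10 * (theta / n)].
Proof.
move=> eps0 eps_small mo U UU b UT hb cl.
have [f [fl fN [A0 CA0 hA0]]] := separate_segment o x eps0.
have [F [phi [Fl Fphi phi01 fF phipsi]]] := split_functional psi_sm qs fl fN.
have c0 i : 0 <= c i.
  by apply: ulimit_ge_cst (cl i) _; apply: ultra_setT => A /=; exact: seminorm_ge0.
have bN A : N (b A - o) <= theta + eps by rewrite (seminormB _ _ Ns); case: (hb A).
have psic : psi c <= theta + eps.
  have pl : ulimit U (fun A => N (b A - o)) (psi c).
    by apply: (@ulimit_psi _ _ psi _ _ UU (fun i A => q i (b A - o)) c cl).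
  by apply: ulimit_le_cst pl _; apply: ultra_setT => A /=; exact: bN.
have sum_le : \sum_i phi i * c i <= theta + eps by exact: le_trans (phipsi c c0) psic.
have Fbd i A : `|F i (b A - o)| <= theta + eps.
  have p0 : 0 <= phi i <= 1 := phi01 i.
  have h1 : q i (b A - o) <= theta + eps by exact: le_trans (coord_sumnorm psi_sm qs i _) (bN A).
  have h2 : phi i * q i (b A - o) <= theta + eps.
    apply: le_trans h1; rewrite ler_piMl ?seminorm_ge0//; lra.
  have := Fphi i (b A - o); have := Fphi i (- (b A - o)).
  rewrite linN// seminormN// => ? ?.
  by rewrite ler_norml; lra.
have /choice[l hl] i : exists l, ulimit U (fun A => F i (b A - o)) l.
  exact: (@ulimit_ex R _ U _ _ (theta + eps)).
have lle i : l i <= phi i * c i.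
  apply: ulimit_le (hl i) (ulimitZ (phi i) (cl i)) _; apply: ultra_setT => A /=.
  exact: Fphi.
have suml : theta - eps <= \sum_i l i.
  apply: ulimit_ge_cst (ulimit_sum hl) _.
  apply: filterS (UT (exist _ A0 CA0)) => B /= BA0.
  by rewrite -fF; have [] := hA0 _ (BA0 _ (hb B).1).
have gap i : phi i * c i - 2 * eps <= l i.
  have : \sum_(j | j != i) l j <= \sum_(j | j != i) phi j * c j by apply: ler_sum => j _.
  have := suml; rewrite (bigD1 i)//=; have := sum_le; rewrite (bigD1 i)//= => ? ? ?; lra.
have fx : f (x - o) <= 2 * eps.
  have /ultra_ex[B /= BA0] := UT (exist _ A0 CA0).
  have [_] := hA0 _ (BA0 _ (hb B).1); have := le_trans (fN _) (bN B).
  have -> : x - o = (b B - o) - (b B - x) by rewrite opprB [RHS]addrC subrKA.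
  by rewrite (linB (b B - o) (b B - x) fl) => ? ?; lra.
have thn : 0 < theta / n by rewrite divr_gt0.
have [i hi] : exists i, 9 / 10 * (theta / n) <= l i - F i (x - o).
  apply: contrapT => /forallNP h.
  have : \sum_i (l i - F i (x - o)) <= \sum_(i < r) 9 / 10 * (theta / n).
    by apply: ler_sum => i _; have /negP := h i; rewrite -ltNge => /ltW.
  rewrite sumr_const card_ord -(mulr_natl (9 / 10 * (theta / n)) r) big_split/= sumrN -fF.
  have : r%:R * (9 / 10 * (theta / n)) <= 9 / 10 * theta.
    rewrite mulrCA ler_wpM2l ?divr_ge0// mulrA ler_pdivrMr//.
    by rewrite mulrC ler_wpM2l ?(ltW th0)// nE ler_nat.
  move=> h1 h2; have := le_trans h2 h1.
  by move: (\sum_i l i) (f (x - o)) suml fx => S y ? ? ?; lra.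
exists i, (F i), (phi i); split=> //.
- apply: le_trans sum_le; rewrite (bigD1 i)//= lerDl; apply: sumr_ge0 => j _.
  by rewrite mulr_ge0//; case/andP: (phi01 j).
- split; last by have := lle i; lra.
  have := gap i => hg; have lt : phi i * c i - 3 * eps < l i by lra.
  by apply: filterS (ulimit_near_gt (hl i) lt) => A /= /ltW.
Qed.

(** A James-type choice: each [F A] almost norms the net but drops at [b A], and every new index is
    taken where the earlier functionals are large. [F A1] and [F A2] norm both [b A3 - o] and
    [b A4 - o] and differ at [b A2 - o], so noncreasiness brings [b A3] and [b A4] together; yet
    [F A3] drops at the first and not at the second. *)
Lemma no_positive_radius : False.
Proof.
have n0 : n != 0 by rewrite gt_eqF ?n_gt0.
pose e1 := (4 * n)^-1.
have e10 : 0 < e1 by rewrite invr_gt0 mulr_gt0 ?n_gt0.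
have e1n : e1 * n = 1 / 4 by rewrite /e1 invfM -mulrA mulVf// mulr1 div1r.
have /choice[d hd] (i : 'I_r) : exists d, 0 < d /\ (forall (f g : V -> R) (u v p : V),
    lin f -> lin g -> (forall x, f x <= q i x) -> (forall x, g x <= q i x) ->
    q i u <= 1 + d -> q i v <= 1 + d -> q i p <= 1 + d ->
    1 - d <= f u -> 1 - d <= f v -> 1 - d <= g u -> 1 - d <= g v ->
    e1 <= f p - g p -> q i (u - v) <= e1).
  by have [d d0 hd] := q_unc i e10; exists d.
have [dl dl01 dld] := exists_lower_bound (fun i => (hd i).1) e10.
have /andP[dl0 dle1] := dl01.
pose t := theta / n.
have nt : n * t = theta by rewrite /t mulrC mulfVK.
have t0 : 0 < t by exact: divr_gt0.
have [eps epsE] : exists eps, eps = dl * t / 100 by exists (dl * t / 100).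
have eps0 : 0 < eps by rewrite epsE; apply: divr_gt0; [exact: mulr_gt0|rewrite ltr0n].
have [eps_small thn h25 dp ep] := norming_constants n1 t0 dl01 e1n epsE.
rewrite nt in eps_small thn.
have [ o mo] := th_app eps0.
have [U [UU UT]] := sets_ultra.
have /choice[b hb] (A : T) : exists a, sval A a /\ N (o - a) <= theta + eps.
  by have [a Aa ha] := mo _ (svalP A); exists a.
have /choice[c cl] i : exists c, ulimit U (fun A => q i (b A - o)) c.
  apply: (@ulimit_ex R _ U _ _ (theta + eps)) => A.
  rewrite ger0_norm; last exact: seminorm_ge0.
  by apply: le_trans (coord_sumnorm psi_sm qs i _) _; rewrite (seminormB _ _ Ns); case: (hb A).
have key x := almost_norming x eps0 eps_small mo UU UT hb cl.
have /choice[i hi] := fun A => key (b A).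
have /choice[F hF] := hi; have /choice[phi hphi] := hF.
(* The coordinate obtained depends on the index but takes finitely many values, so an ultrafilter
   fixes it. *)
have [j Uj] : exists j, U [set A | i A = j].
  by apply: ultra_exists_fin; apply: ultra_setT => A /=; exists (i A).
have Ug : U [set A | i A = j /\ q j (b A - o) < c j + eps].
  have cje : c j < c j + eps by rewrite ltrDl.
  exact: (ultraI Uj (ulimit_near (cl j) cje)).
have G A : i A = j /\ q j (b A - o) < c j + eps -> [/\ lin (F A),
    forall v, F A v <= phi A * q j v, 0 < phi A <= 1, 0 < c j &
    [/\ 2 / 5 * t <= phi A * c j, phi A * c j <= theta + eps,
    U [set B | phi A * c j - 3 * eps <= F A (b B - o)] &
    F A (b A - o) <= phi A * c j - 9 / 10 * t]].
  move=> [ij qA]; have := hphi A; rewrite ij => -[Fl Fq /andP[p0 p1] pc [HU Hle]].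
  have h1 : phi A * q j (b A - o) <= phi A * (c j + eps) by rewrite ler_wpM2l// ltW.
  have h2 : phi A * eps <= eps by rewrite ler_piMl// ltW.
  have h3 := Fq (- (b A - o)); rewrite (linN _ Fl) (seminormN _ (qs j)) in h3.
  rewrite mulrDr in h1.
  (* A functional that drops by [9 / 10 * t] without falling below [- phi A * (c j + eps)] cannot be
     small. *)
  have h4 : 2 / 5 * t <= phi A * c j.
    apply: (h25 (phi A * c j)); last by rewrite lerDl mulr_ge0// ltW.
    by move: Hle h1 h2 h3; rewrite -/t; lra.
  have pcp : 0 < phi A * c j by apply: lt_le_trans h4; rewrite mulr_gt0// divr_gt0.
  have pp : 0 < phi A.
    by rewrite lt_def p0 andbT; apply/eqP => pz; move: pcp; rewrite pz mul0r ltxx.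
  by split=> //; [rewrite pp|rewrite pmulr_rgt0 in pcp].
have [A1 g1] := ultra_ex Ug.
have [l1 F1 /andP[p1 p1'] c0 [pc1 pc1' U1 _]] := G _ g1.
have [A2 [g2 f12]] := ultra_ex (ultraI Ug U1).
have [l2 F2 /andP[p2 p2'] _ [pc2 pc2' U2 f22]] := G _ g2.
have [A3 [g3 [f13 f23]]] := ultra_ex (ultraI Ug (ultraI U1 U2)).
have [l3 F3 /andP[p3 p3'] _ [pc3 pc3' U3 f33]] := G _ g3.
have [A4 [g4 [f14 [f24 f34]]]] := ultra_ex (ultraI Ug (ultraI U1 (ultraI U2 U3))).
have cj : 2 / 5 * t <= c j by apply: le_trans pc1 _; rewrite ler_piMl// ltW.
have near_c A : i A = j /\ q j (b A - o) < c j + eps -> q j (b A - o) <= c j * (1 + dl).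
  case=> _ /ltW h; apply: (le_trans h); rewrite mulrDr mulr1 lerD2l.
  by have [] := dp _ cj.
have large p x : 2 / 5 * t <= p -> p - 3 * eps <= x -> p * (1 - dl) <= x.
  move=> h hx; apply: le_trans hx; rewrite mulrBr mulr1 lerD2l lerN2.
  by have [] := dp _ h.
have ep' A : 0 < phi A -> phi A * c j <= theta + eps ->
    phi A * c j * e1 <= 101 / 400 * t /\ phi A * c j * (dl + e1) <= 9 / 10 * t.
  move=> pA pcA; apply: ep; first exact: mulr_gt0.
  by rewrite nt; exact: le_trans thn.
have small : F A2 (b A2 - o) <= phi A2 * c j * (1 - dl - e1).
  apply: (le_trans f22); rewrite -addrA -opprD mulrBr mulr1 lerD2l lerN2.
  by have [] := ep' _ p2 pc2'.
have hdl : forall (f g : V -> R) (u v p : V),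
    lin f -> lin g -> (forall x, f x <= q j x) -> (forall x, g x <= q j x) ->
    q j u <= 1 + dl -> q j v <= 1 + dl -> q j p <= 1 + dl ->
    1 - dl <= f u -> 1 - dl <= f v -> 1 - dl <= g u -> 1 - dl <= g v ->
    e1 <= f p - g p -> q j (u - v) <= e1.
  have up x : x <= 1 + dl -> x <= 1 + d j by move/le_trans; apply; rewrite lerD2l.
  have dn x : 1 - dl <= x -> 1 - d j <= x by apply: le_trans; rewrite lerD2l lerN2.
  move=> f g u v p fl gl fq gq /up qu /up qv /up qp /dn fu /dn fv /dn gu /dn gv.
  exact: (hd j).2.
have := unc_scaled (qs j) hdl p1 p2 c0 l1 l2 F1 F2 (near_c _ g4) (near_c _ g3) (near_c _ g2)
  (large _ _ pc1 f14) (large _ _ pc1 f13) (large _ _ pc1 f12)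
  (large _ _ pc2 f24) (large _ _ pc2 f23) small.
set x := _ - _ => qx; have := F3 x; rewrite /x (linB _ _ l3) -/x => Fx.
have : phi A3 * q j x <= phi A3 * (c j * e1) by rewrite ler_wpM2l// ltW.
have [+ _] := ep' _ p3 pc3'; have [+ _] := dp _ pc3.
have pd : phi A3 * c j * dl <= phi A3 * c j * e1 by rewrite ler_wpM2l// mulr_ge0// ltW.
by rewrite mulrA; rewrite /= in f34; lra.
Qed.

End Contradiction.

Lemma small_center e : (exists rho x, meets rho x) -> 0 < e -> exists x, meets e x.
Proof.
move=> [rho0 [x0 m0]] e0; apply: contrapT => /forallNP h.
pose S := [set rho | exists x, meets rho x].
have Slb : lbound S 0 by move=> rho [x /meets_ge0].
have Si : has_inf S by split; [exists rho0, x0|exists 0].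
have Sge rho x : meets rho x -> inf S <= rho.
  by move=> m; apply: ge_inf; [exists 0|exists x].
have app d : 0 < d -> exists o, meets (inf S + d) o.
  move=> d0; have [rho [ o mo] hr] := inf_adherent d0 Si.
  exists o => A /mo[a Aa ha]; exists a => //; exact: le_trans ha (ltW hr).
apply: (@no_positive_radius (inf S) _ Sge app r.+1%:R erefl).
rewrite (lt_le_trans e0)// leNgt; apply/negP => lt.
have [ o mo] := app (e - inf S) ltac:(by rewrite subr_gt0).
by apply: (h o); rewrite addrC subrK in mo.
Qed.

End Centers.

Section Reflexivity.
Variables (R : realType) (r : nat) (psi : absnorm R r) (V : lmodType R).
Hypothesis psi_sm : strictly_monotone psi.
Variable q : 'I_r -> V -> R.
Hypothesis qs : forall i, seminorm (q i).
Hypothesis q_unc : forall i, unc (q i).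

(** Such a set also contains every point at distance zero from one of its points. *)
Definition sclosed (N : V -> R) (A : set V) :=
  forall v, (forall e, 0 < e -> exists2 a, A a & N (v - a) <= e) -> A v.

(** The rate is fixed; other constants are absorbed by shifting the sequence. *)
Definition scomplete (N : V -> R) := forall x : nat -> V,
  (forall k, N (x k.+1 - x k) <= (1 / 2) ^+ k) ->
  exists p, forall e, 0 < e -> exists K, forall k, (K <= k)%N -> N (p - x k) <= e.

Local Notation N := (sumnorm psi q).
Let Ns : seminorm N := sumnorm_seminorm psi_sm qs.
Hypothesis Ncomplete : scomplete N.

Lemma half_pow_small (e : R) : 0 < e -> exists k, (1 / 2) ^+ k <= e.
Proof.
move=> e0; have [k hk] : exists k : nat, e^-1 <= k%:R.
  by exists (Num.Def.archi_bound e^-1); apply/ltW/archi_boundP; rewrite invr_ge0 ltW.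
exists k; rewrite div1r exprVn invf_ple ?posrE ?exprn_gt0//.
by apply: (le_trans hk); rewrite -natrX ler_nat; apply/ltnW/ltn_expl.
Qed.

(** Cutting the sets down to a ball about the previous centre yields a centre of smaller radius
    nearby. Centres with radii tending to zero form a Cauchy sequence, whose limit lies in every
    closed set. *)
Lemma directed_intersection (C : set (set V)) : C !=set0 -> directed_sets C ->
  (forall A, C A -> [/\ A !=set0, cvx A & sclosed N A]) ->
  (exists rho x, meets psi q C rho x) -> exists p, forall A, C A -> A p.
Proof.
move=> C0 Cdir CP mC.
have refine rho rho' x : meets psi q C rho x -> 0 < rho' -> exists y,
    meets psi q C rho' y /\ N (y - x) <= rho + rho'.
  move=> mx r0; pose C' := [set A `&` [set a | N (x - a) <= rho] | A in C].
  have [y my] : exists y, meets psi q C' rho' y.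
    apply: (@small_center R r psi V psi_sm q qs q_unc C') => //.
    - by case: C0 => A CA; exists (A `&` [set a | N (x - a) <= rho]); exists A.
    - move=> _ _ [A CA <-] [B CB <-]; have [D CD DAB] := Cdir _ _ CA CB.
    exists (D `&` [set a | N (x - a) <= rho]); first by exists D.
    by move=> z [/DAB[? ?] ?].
    - move=> _ [A CA <-] u v s t [Au hu] [Av hv] s0 t0 st; split.
      by have [_ cA _] := CP _ CA; exact: cA.
    rewrite /=; have -> : x - (s *: u + t *: v) = s *: (x - u) + t *: (x - v).
      by rewrite !scalerBr addrACA -scalerDl st scale1r opprD.
    apply: (le_trans (Ns.1 _ _)); rewrite !Ns.2 !ger0_norm//.
    have -> : rho = s * rho + t * rho by rewrite -mulrDl st mul1r.
    by rewrite lerD// ler_wpM2l.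
    - exists rho, x => _ [A CA <-]; have [a Aa ha] := mx _ CA.
    by exists a.
  exists y; split.
    by move=> A CA; have [a [Aa _] ha] := my _ (ex_intro2 _ _ A CA erefl); exists a.
  case: C0 => A CA; have [a [Aa xa] ya] := my _ (ex_intro2 _ _ A CA erefl).
  apply: le_trans (seminormBD _ a _ Ns) _.
  by rewrite (seminormB a x Ns) addrC lerD.
(* The exponent [k + 2] keeps the consecutive distances [rho k + rho k.+1] below [(1 / 2) ^+ k], the
   rate of [scomplete]. *)
pose rho k : R := (1 / 2) ^+ (k + 2).
have rho0 k : 0 < rho k by rewrite exprn_gt0//; lra.
have [x0 m0] : exists x, meets psi q C (rho 0%N) x.
  apply: small_center => // A CA; by have [] := CP _ CA.
have /choice[f hf] (kx : nat * V) : exists y, meets psi q C (rho kx.1) kx.2 ->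
    meets psi q C (rho kx.1.+1) y /\ N (y - kx.2) <= rho kx.1 + rho kx.1.+1.
  have [m|nm] := pselect (meets psi q C (rho kx.1) kx.2); last by exists 0 => /nm.
  by have [y hy] := refine _ _ _ m (rho0 kx.1.+1); exists y.
pose x := fix x k := if k is k'.+1 then f (k', x k') else x0.
have mx k : meets psi q C (rho k) (x k).
  by elim: k => [|k IH] //=; have [] := hf (k, x k) IH.
have [p hp] : exists p, forall e, 0 < e -> exists K, forall k, (K <= k)%N -> N (p - x k) <= e.
  apply: Ncomplete => k /=; have [_ /=] := hf (k, x k) (mx k) => h; apply: (le_trans h).
  rewrite /rho addSn exprS !exprD; set h2 := (1 / 2) ^+ k.
  have : 0 < h2 by rewrite exprn_gt0//; lra.
  by rewrite expr2; lra.
exists p => A CA; have [_ _ clA] := CP _ CA; apply: clA => e e0.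
have e20 : 0 < e / 2 by lra.
have [K hK] := hp _ e20; have [K' hK'] := half_pow_small e20.
pose k := maxn K K'; have [a Aa ha] := mx k A CA; exists a => //.
apply: le_trans (seminormBD _ (x k) _ Ns) _.
have h1 := hK k (leq_maxl _ _).
suff : rho k <= e / 2 by lra.
apply: le_trans hK'; rewrite /rho; apply: ler_wiXn2l; [lra|lra|].
by rewrite (leq_trans (leq_maxr K K'))// leq_addr.
Qed.

Lemma sclosedI A B : sclosed N A -> sclosed N B -> sclosed N (A `&` B).
Proof.
by move=> cA cB v h; split; [apply: cA|apply: cB] => e /h[a [Aa Ba] ha]; exists a.
Qed.

Lemma cvxI (A B : set V) : cvx A -> cvx B -> cvx (A `&` B).
Proof.
by move=> cA cB x y s t [Ax Bx] [Ay By_] s0 t0 st; split; [exact: cA|exact: cB].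
Qed.

Lemma half_space_closed (f : V -> R) K c : lin f -> (forall x, f x <= K * N x) ->
  sclosed N [set x | f x <= c].
Proof.
move=> fl fK v h /=; apply/ler_addgt0Pr => e e0.
have K0 : 0 < `|K| + 1 by rewrite ltr_wpDl.
have [a /= fa va] := h (e / (`|K| + 1)) (divr_gt0 e0 K0).
have := fK (v - a); rewrite linB// => h1.
have h2 : K * N (v - a) <= (`|K| + 1) * N (v - a).
  by rewrite ler_wpM2r ?seminorm_ge0//; have := ler_norm K; lra.
have : (`|K| + 1) * N (v - a) <= e by rewrite mulrC -ler_pdivlMr.
by lra.
Qed.

Lemma half_space_cvx (f : V -> R) c : lin f -> cvx [set x | f x <= c].
Proof.
move=> fl x y s t /= fx fy s0 t0 st; rewrite linD// (linZ s x fl) (linZ t y fl).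
have -> : c = s * c + t * c by rewrite -mulrDl st mul1r.
by rewrite lerD// ler_wpM2l.
Qed.

Definition wlimit M (U : set_system M) (a : M -> V) (p : V) :=
  forall f : V -> R, lin f -> (exists K, forall x, f x <= K * N x) ->
    ulimit U (fun m => f (a m)) (f p).

(** The closed convex sets containing the net on a set of [U] are directed. A common point of them
    lies in all such half-spaces, and opposite half-spaces determine the value of each functional
    there. *)
Lemma exists_wlimit M (U : set_system M) {UU : UltraFilter U} (a : M -> V) (D : set V) B :
  sclosed N D -> cvx D -> (forall x y, D x -> D y -> N (x - y) <= B) ->
  (forall m, D (a m)) -> exists2 p, D p & wlimit U a p.
Proof.
move=> Dcl Dcvx DB Da.
pose C := [set A : set V | [/\ sclosed N A, cvx A & U [set m | A (a m)]]].
have CD : C D by split=> //; exact: ultra_setT.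
have [m0 _] := ultra_ex (@filterT _ U _).
have [p hp] : exists p, forall A, C A -> A p.
  apply: directed_intersection.
  - by exists D.
  - move=> A1 A2 [c1 v1 u1] [c2 v2 u2]; exists (A1 `&` A2) => //; split.
    + exact: sclosedI.
    + exact: cvxI.
    + exact: (ultraI u1 u2).
  - by move=> A [cA vA /ultra_ex[m Am]]; split=> //; exists (a m).
  - exists B, (a m0) => A [_ _ /ultra_ex[m /= Am]]; exists (a m) => //; exact: DB.
exists p; first exact: hp.
move=> f fl [K fK].
have fN x : `|f x| <= `|K| * N x.
  have N0 := seminorm_ge0 x Ns.
  have KN : K * N x <= `|K| * N x by rewrite ler_wpM2r// ler_norm.
  have := fK x; have := fK (- x); rewrite linN// (seminormN _ Ns) => ? ?.
  by rewrite ler_norml; lra.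
have [l hl] : exists l, ulimit U (fun m => f (a m)) l.
  apply: (@ulimit_ex R _ U _ _ (`|f (a m0)| + `|K| * B)) => m.
  have -> : f (a m) = f (a m0) + f (a m - a m0) by rewrite linB//; ring.
  apply: le_trans (ler_normD _ _) _; rewrite lerD2l.
  by apply: le_trans (fN _) _; rewrite ler_wpM2l// DB.
suff -> : f p = l by [].
apply/eqP; rewrite eq_le; apply/andP; split; apply/ler_addgt0Pr => e e0.
  apply: (hp [set x | f x <= l + e]); split.
  - exact: half_space_closed fK.
  - exact: half_space_cvx.
  - have lt : l < l + e by rewrite ltrDl.
    by apply: filterS (ulimit_near hl lt) => m /= /ltW.
have : [set x | -1 * f x <= - l + e] p.
  apply: (hp [set x | -1 * f x <= - l + e]); split.
  - apply: (@half_space_closed _ `|K|); first exact: linMl.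
    by move=> x; have := fN x; rewrite ler_norml => ?; lra.
  - by apply: half_space_cvx; exact: linMl.
  - have lt : l - e < l by rewrite ltrBlDr ltrDl.
    by apply: filterS (ulimit_near_gt hl lt) => m /= ?; lra.
by move=> /= ?; lra.
Qed.

End Reflexivity.

Section UleCalculus.
Variables (R : realType) (M : Type) (U : set_system M).
Context {UU : UltraFilter U}.
Implicit Types (f g : M -> R).

Lemma ule_mono f g c : (forall m, f m <= g m) -> ule U g c -> ule U f c.
Proof. by move=> fg gc e /gc; apply: filterS => m /=; exact: le_trans. Qed.

Lemma uge_mono f g c : (forall m, g m <= f m) -> uge U g c -> uge U f c.
Proof. by move=> fg gc e /gc; apply: filterS => m /= ?; exact: le_trans (fg m). Qed.

Lemma uleD f g a b : ule U f a -> ule U g b -> ule U (fun m => f m + g m) (a + b).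
Proof.
move=> fa gb e e0; have e20 : 0 < e / 2 by lra.
by apply: filterS (ultraI (fa _ e20) (gb _ e20)) => m [/= ? ?]; lra.
Qed.

Lemma uleN f a : uge U f a -> ule U (fun m => - f m) (- a).
Proof. by move=> fa e /fa; apply: filterS => m /= ?; lra. Qed.

Lemma ugeN f a : ule U f a -> uge U (fun m => - f m) (- a).
Proof. by move=> fa e /fa; apply: filterS => m /= ?; lra. Qed.

Lemma ugeD f g a b : uge U f a -> uge U g b -> uge U (fun m => f m + g m) (a + b).
Proof.
move=> fa gb e e0; have e20 : 0 < e / 2 by lra.
by apply: filterS (ultraI (fa _ e20) (gb _ e20)) => m [/= ? ?]; lra.
Qed.

Lemma ugeB f g a b : uge U f a -> ule U g b -> uge U (fun m => f m - g m) (a - b).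
Proof. by move=> fa gb; apply: ugeD => //; exact: ugeN. Qed.

Lemma uleZ k f a : 0 <= k -> ule U f a -> ule U (fun m => k * f m) (k * a).
Proof.
move=> k0 fa e e0; have k1 : 0 < k + 1 by rewrite ltr_wpDl.
apply: filterS (fa _ (divr_gt0 e0 k1)) => m /= h.
apply: le_trans (ler_wpM2l k0 h) _; rewrite mulrDr lerD2l mulrA ler_pdivrMr// mulrC.
by rewrite ler_wpM2l ?(ltW e0)//; lra.
Qed.

Lemma ugeZ k f a : 0 <= k -> uge U f a -> uge U (fun m => k * f m) (k * a).
Proof.
move=> k0 /uleN /(uleZ k0) h e /h; apply: filterS => m /=.
by rewrite !mulrN => ?; lra.
Qed.

Lemma ule_ulimit f c l : ulimit U f l -> ule U f c -> l <= c.
Proof.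
by move=> fl fc; apply/ler_addgt0Pr => e e0; apply: ulimit_le_cst fl _; exact: fc.
Qed.

Lemma uge_ulimit f c l : ulimit U f l -> uge U f c -> c <= l.
Proof.
move=> fl fc; apply/ler_addgt0Pr => e e0; rewrite -lerBlDr.
by apply: ulimit_ge_cst fl _; exact: fc.
Qed.

Lemma ule_uprod (N : Type) (W : set_system N) {WW : UltraFilter W} (F : M * N -> R) c :
  (forall m, ule W (fun n => F (m, n)) c) -> ule (uprod U W) F c.
Proof. by move=> h e e0; rewrite /uprod /=; apply: ultra_setT => m; exact: h. Qed.

End UleCalculus.

(** * Minimal invariant sets *)

Section Nonexpansive.
Variables (R : realType) (V : lmodType R) (N : V -> R).

Definition bounded_by (D : set V) B := forall x y, D x -> D y -> N (x - y) <= B.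

Definition stable (D : set V) (S : V -> V) := forall x, D x -> D (S x).

Definition nonexpansive (D : set V) (S : V -> V) :=
  forall x y, D x -> D y -> N (S x - S y) <= N (x - y).

Definition fixed_net M (U : set_system M) (S : V -> V) (w : M -> V) :=
  ulimit U (fun m => N (S (w m) - w m)) 0.

Variables (J : Type) (S : J -> V -> V).

(* [ule _ f c] says that the limit superior of [f] along the ultrafilter is at
   most [c]: this is approximate fixed points in closed convex subsets of the
   ultrapower of [K], phrased without forming the ultrapower. *)
Definition approx_fixed (K : set V) := forall M (U : set_system M), UltraFilter U ->
  forall W : set (M -> V), W !=set0 -> (forall w, W w -> forall m, K (w m)) -> cvx W ->
  (forall v, (forall m, K (v m)) ->
    (forall e, 0 < e -> exists2 w, W w & ule U (fun m => N (v m - w m)) e) -> W v) ->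
  (forall j w, W w -> W (fun m => S j (w m))) ->
  forall (F : seq J) e, 0 < e -> exists2 w, W w &
    forall j, List.In j F -> ule U (fun m => N (S j (w m) - w m)) e.

End Nonexpansive.

Section Minimal.
Variables (R : realType) (V : lmodType R) (N : V -> R).
Hypothesis Ns : seminorm N.
Variables (J : Type) (S : J -> V -> V) (K : set V) (B : R).
Hypotheses (Kcl : sclosed N K) (Kcvx : cvx K) (KB : bounded_by N K B).
Hypotheses (KS : forall j, stable K (S j)) (KN : forall j, nonexpansive N K (S j)).
Hypothesis Kmin : forall A, A `<=` K -> A !=set0 -> sclosed N A -> cvx A ->
  (forall j, stable A (S j)) -> K `<=` A.

Lemma dist_ulimit_ex M (U : set_system M) {UU : UltraFilter U} (w v : M -> V) :
  (forall m, K (w m)) -> (forall m, K (v m)) ->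
  exists l, ulimit U (fun m => N (w m - v m)) l.
Proof.
move=> Kw Kv; apply: (@ulimit_ex R _ U _ _ B) => m.
by rewrite ger0_norm ?seminorm_ge0//; exact: KB.
Qed.

(** The Goebel-Karlovitz argument: the points of [K] at limit distance at most [s] from an
    approximate fixed net form a closed convex invariant set, which by minimality is all of [K]. *)
Lemma const_dist M (U : set_system M) {UU : UltraFilter U} (w : M -> V) p p' t :
  (forall m, K (w m)) -> (forall j, fixed_net N U (S j) w) -> K p -> K p' ->
  ulimit U (fun m => N (w m - p)) t -> ulimit U (fun m => N (w m - p')) t.
Proof.
move=> Kw fw.
have aux x y s l : K x -> K y -> ulimit U (fun m => N (w m - x)) s ->
    ulimit U (fun m => N (w m - y)) l -> l <= s.
  move=> Kx Ky ls ll; pose A := K `&` [set z | ule U (fun m => N (w m - z)) s].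
  suff /(_ y Ky)[_ /= /(ule_ulimit ll)] : K `<=` A by [].
  apply: Kmin.
  - by move=> z [].
  - by exists x; split=> //; exact: ulimit_ule.
  - move=> z h; split; first by apply: Kcl => e /h[a [Ka _] za]; exists a.
    move=> e e0; have e20 : 0 < e / 2 by lra.
    have [a [Ka /= sa] za] := h _ e20.
    apply: filterS (sa _ e20) => m /= ?.
    by have := seminormBD (w m) a z Ns; rewrite (seminormB a z Ns) => ?; lra.
  - move=> a b u v [Ka /= sa] [Kb /= sb] u0 v0 uv; split; first exact: Kcvx.
    have -> : s = u * s + v * s by rewrite -mulrDl uv mul1r.
    apply: ule_mono (uleD (uleZ u0 sa) (uleZ v0 sb)) => m.
    have -> : w m - (u *: a + v *: b) = u *: (w m - a) + v *: (w m - b).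
      by rewrite !scalerBr addrACA -scalerDl uv scale1r opprD.
    by apply: (le_trans (Ns.1 _ _)); rewrite !Ns.2 !ger0_norm.
  - move=> j z [Kz /= sz]; split; first exact: KS.
    rewrite -[s]addr0; apply: ule_mono (uleD sz (ulimit_ule (fw j))) => m.
    have := seminormBD (w m) (S j (w m)) (S j z) Ns.
    rewrite (seminormB (w m) (S j (w m)) Ns).
    by have := KN j (Kw m) Kz => ? ?; lra.
move=> Kp Kp' lt.
have [l ll] := @dist_ulimit_ex _ U UU w (fun=> p') Kw (fun=> Kp').
suff -> : t = l by [].
by apply/eqP; rewrite eq_le (aux _ _ _ _ Kp' Kp ll lt) (aux _ _ _ _ Kp Kp' lt ll).
Qed.

Definition family_index := (seq J * nat)%type.

Lemma family_ultra : exists U : set_system family_index, UltraFilter U /\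
  ((forall j, U [set l | List.In j l.1]) /\
   ulimit U (fun l => l.2.+1%:R^-1 : R) 0).
Proof.
have [|||U [UU UP]] := @directed_ultra family_index
  (fun l l' => (forall j, List.In j l.1 -> List.In j l'.1) /\ (l.2 <= l'.2)%N) ([::], 0%N).
- by move=> l; split.
- by move=> a b c [h1 h2] [h3 h4]; split; [move=> j /h1/h3|exact: leq_trans h4].
- move=> a b; exists (a.1 ++ b.1, maxn a.2 b.2); rewrite leq_maxl leq_maxr.
  by split; split=> // j h; apply/List.in_or_app; [left|right].
exists U; split=> //; split=> [j|].
  by apply: filterS (UP ([:: j], 0%N)) => l [/(_ j) h _]; apply: h; left.
apply: ulimit_le0 => e e0; have [k hk] : exists k : nat, e^-1 <= k%:R.
  by exists (Num.Def.archi_bound e^-1); apply/ltW/archi_boundP; rewrite invr_ge0 ltW.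
apply: filterS (UP ([::], k)) => l [_ /= kl].
rewrite ger0_norm ?invr_ge0// invf_ple ?posrE//.
by apply: (le_trans hk); rewrite ler_nat; exact: leqW.
Qed.

Hypothesis K0 : K !=set0.
Hypothesis Kafp : approx_fixed N S K.

Lemma approx_fixed_points (F : seq J) e : 0 < e ->
  exists2 x, K x & forall j, List.In j F -> N (S j x - x) <= e.
Proof.
move=> e0; have e20 : 0 < e / 2 by lra.
(* Over a one-point index set the ultrapower is [K] itself. *)
have [w Kw hw] : exists2 w : unit -> V, K (w tt) &
    forall j, List.In j F -> ule (principal_filter tt) (fun m => N (S j (w m) - w m)) (e / 2).
  apply: (Kafp (principal_filter_ultra tt) (W := [set w : unit -> V | K (w tt)])) => //.
  - by case: K0 => x Kx; exists (fun=> x).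
  - by move=> w Kw [].
  - by move=> v w s t Kv Kw s0 t0 st /=; exact: Kcvx.
  - by move=> v Kv _; exact: Kv.
  - by move=> j w Kw; exact: KS.
exists (w tt) => // j Fj; have := hw j Fj _ e20 => /principal_filterP /=.
by move=> ?; lra.
Qed.

(** [x l] almost minimizes the distance to [p0] among the points fixed up to the accuracy of [l].
    Every approximate fixed net enters these sets, so its limit distance is no smaller. *)
Lemma minimal_fixed_net : exists p0 (L : set_system family_index) (x : family_index -> V) t0,
  [/\ UltraFilter L, K p0,
   (forall j, L [set l | List.In j l.1]) /\ ulimit L (fun l => l.2.+1%:R^-1 : R) 0,
   (forall l, K (x l)) /\ (forall j, fixed_net N L (S j) x) &
   ulimit L (fun l => N (x l - p0)) t0 /\
   forall M (U : set_system M), UltraFilter U -> forall (w : M -> V) t, (forall m, K (w m)) ->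
     (forall j, fixed_net N U (S j) w) -> ulimit U (fun m => N (w m - p0)) t -> t0 <= t].
Proof.
have [L [LL [Lin L0]]] := family_ultra.
case: K0 => p0 Kp0.
pose P (l : family_index) x := K x /\ forall j, List.In j l.1 -> N (S j x - x) <= l.2.+1%:R^-1.
pose E l := [set N (x - p0) | x in P l].
have El l : has_inf (E l).
  split; last by exists 0 => _ [x _ <-]; exact: seminorm_ge0.
  have li : (0 : R) < l.2.+1%:R^-1 by rewrite invr_gt0.
  by have [x Kx hx] := approx_fixed_points l.1 li; exists (N (x - p0)), x.
have /choice[x hx] l : exists x, P l x /\ N (x - p0) <= inf (E l) + l.2.+1%:R^-1.
  have li : (0 : R) < l.2.+1%:R^-1 by rewrite invr_gt0.
  by have [_ [x Px <-] h] := inf_adherent li (El l); exists x; split=> //; exact: ltW.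
have Kx l : K (x l) by case: (hx l) => -[].
have fx j : fixed_net N L (S j) x.
  apply: ulimit_squeeze0 L0; apply: filterS (Lin j) => l /= jl.
  by rewrite ger0_norm ?seminorm_ge0//; case: (hx l) => -[_ ->].
have [t0 lt0] := @dist_ulimit_ex _ L LL x (fun=> p0) Kx (fun=> Kp0).
exists p0, L, x, t0; split=> //; split=> // M U UU w t Kw fw lt.
have inf_le l : inf (E l) <= t.
  have h : U [set m | P l (w m)].
    have : U [set m | forall j, List.In j l.1 -> N (S j (w m) - w m) <= l.2.+1%:R^-1].
      elim: l.1 => [|j s IH]; first by apply: ultra_setT => m j [].
      have li : (0 : R) < l.2.+1%:R^-1 by rewrite invr_gt0.
      apply: filterS (ultraI (ulimit_near (fw j) li) IH) => m [/= h1 h2] k [<-|/h2//].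
      exact: ltW.
    by apply: filterS => m h; split.
  apply: ulimit_ge_cst lt _; apply: filterS h => m Pm /=.
  by apply: ge_inf; [exact: (El l).2|exists (w m)].
rewrite -[t]addr0; apply: ulimit_le lt0 (ulimitD (ulimit_cst t) L0) _.
by apply: ultra_setT => l /=; have [_ h] := hx l; apply: (le_trans h); rewrite lerD2r.
Qed.

End Minimal.

(** * Nets between two extremal nets *)

Section CoordinateStep.
Variables (R : realType) (V : lmodType R) (q : V -> R).
Hypotheses (qs : seminorm q) (q_unc : unc q).
Variables (M : Type) (U : set_system M).
Context {UU : UltraFilter U}.
Variable o : V.

Definition dominated (h : M -> V -> R) :=
  forall m, lin (h m) /\ forall x, h m x <= q x.

Lemma dominatedN h : dominated h -> dominated (fun m x => -1 * h m x).
Proof.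
move=> hd m; have [hl hq] := hd m; split; first exact: linMl.
by move=> x; rewrite mulN1r -linN// -(seminormN x qs).
Qed.

Lemma ule_dominated h u c : dominated h -> ule U (fun m => q (u m)) c ->
  ule U (fun m => h m (u m)) c.
Proof. by move=> hd; apply: ule_mono => m; exact: (hd m).2. Qed.

(* Both [f] and [-g] norm the segment from [x] to [y], so noncreasiness leaves no
   room for [w] other than the point of that segment dividing it in the ratio [a : b]. *)
Lemma between_on_segment (f g : M -> V -> R) (x y w : M -> V) a b c :
  dominated f -> dominated g -> 0 <= a -> 0 <= b -> 0 < c -> a + b = c ->
  ule U (fun m => q (x m - w m)) a -> ule U (fun m => q (w m - y m)) b ->
  ule U (fun m => q (x m - o)) c ->
  uge U (fun m => f m (x m - o)) c -> ulimit U (fun m => f m (y m - o)) 0 ->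
  uge U (fun m => g m (y m - o)) c -> ulimit U (fun m => g m (x m - o)) 0 ->
  ulimit U (fun m => q (w m - ((b / c) *: x m + (1 - b / c) *: y m))) 0.
Proof.
move=> fd gd a0 b0 c0 abc xw wy xo fx fy gy gx.
have bc1 : 1 - b / c = a / c by rewrite -abc -[1](@divff _ (a + b)) -?mulrBl ?addrK ?abc ?gt_eqF.
rewrite bc1.
have q0 (z : M -> V) : ule U (fun m => q (z m)) 0 -> ulimit U (fun m => q (z m)) 0.
  move=> z0; apply: ulimit_of_ule_uge => // e e0; apply: ultra_setT => m /=.
  by apply: le_trans (seminorm_ge0 _ qs); lra.
have [az|az] := eqVneq a 0.
  have bc : b = c by rewrite -abc az add0r.
  rewrite az mul0r bc divff ?gt_eqF//; apply: q0; rewrite az in xw; apply: ule_mono xw => m.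
  by rewrite scale0r addr0 scale1r seminormB.
have [bz|bz] := eqVneq b 0.
  have ac : a = c by rewrite -abc bz addr0.
  rewrite bz mul0r ac divff ?gt_eqF//; apply: q0; rewrite bz in wy; apply: ule_mono wy => m.
  by rewrite scale0r add0r scale1r.
have ap : 0 < a by rewrite lt_def az.
have bp : 0 < b by rewrite lt_def bz.
pose u m := (c / a) *: (x m - w m); pose v m := (c / b) *: (w m - y m).
have qu : ule U (fun m => q (u m)) c.
  have -> : c = c / a * a by rewrite mulfVK.
  apply: ule_mono (uleZ _ xw) => [m|]; last by rewrite divr_ge0// ltW.
  by rewrite /u qs.2 ger0_norm// ?divr_ge0// ?ltW//; rewrite mulfVK.
have qv : ule U (fun m => q (v m)) c.
  have -> : c = c / b * b by rewrite mulfVK.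
  apply: ule_mono (uleZ _ wy) => [m|]; last by rewrite divr_ge0// ltW.
  by rewrite /v qs.2 ger0_norm// ?divr_ge0// ?ltW//; rewrite mulfVK.
have norms h : dominated h -> uge U (fun m => h m (x m - y m)) c ->
    uge U (fun m => h m (u m)) c /\ uge U (fun m => h m (v m)) c.
  move=> hd hxy; split.
    have -> : c = c / a * (c - b) by rewrite -abc addrK mulfVK// abc.
    apply: uge_mono (ugeZ _ (ugeB hxy (ule_dominated hd wy))) => [m|]; last by rewrite divr_ge0// ltW.
    rewrite /u linZ; last exact: (hd m).1.
    rewrite -linB; last exact: (hd m).1.
    by rewrite opprB subrKA.
  have cab : c - a = b by rewrite -abc addrAC subrr add0r.
  have -> : c = c / b * (c - a) by rewrite cab mulfVK.
  apply: uge_mono (ugeZ _ (ugeB hxy (ule_dominated hd xw))) => [m|]; last by rewrite divr_ge0// ltW.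
  rewrite /v linZ; last exact: (hd m).1.
  rewrite -linB; last exact: (hd m).1.
  by rewrite opprB [X in h m X]addrC subrKA.
have [fu fv] : uge U (fun m => f m (u m)) c /\ uge U (fun m => f m (v m)) c.
  apply: norms => //; rewrite -[c]subr0.
  apply: uge_mono (ugeB fx (ulimit_ule fy)) => m.
  by rewrite -(linB _ _ (fd m).1) opprB subrKA.
have gd' := dominatedN gd.
have [gu gv] : uge U (fun m => -1 * g m (u m)) c /\ uge U (fun m => -1 * g m (v m)) c.
  apply: (norms (fun m x => -1 * g m x)) => //; rewrite -[c]subr0.
  apply: uge_mono (ugeB gy (ulimit_ule gx)) => m.
  by rewrite -(linB _ _ (gd m).1) opprB subrKA mulN1r -(linN _ (gd m).1) opprB.
(* The test point is [x - o], where [f] reaches [c] and [-1 * g] tends to zero. *)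
have fg : uge U (fun m => f m (x m - o) - -1 * g m (x m - o)) c.
  rewrite -[c]addr0; apply: uge_mono (ugeD fx (ulimit_uge gx)) => m.
  by rewrite mulN1r opprK.
have uv : ulimit U (fun m => q (u m - v m)) 0.
  exact: (unc_net qs q_unc c0 c0 fd gd' qu qv xo fu fv gu gv fg).
rewrite -(mulr0 (a * b / (c * c))); apply: eq_ulimit (ulimitZ _ uv) => m.
have k0 : 0 <= a * b / (c * c) by rewrite divr_ge0// mulr_ge0// ltW.
rewrite -[X in X * _](ger0_norm k0) -qs.2 -(seminormN (_ *: _) qs); congr q.
have ca : a * b / (c * c) * (c / a) = b / c by field; rewrite az gt_eqF.
have cb : a * b / (c * c) * (c / b) = a / c by field; rewrite bz gt_eqF.
rewrite scalerBr /u /v !scalerA ca cb !scalerBr !opprD !opprK.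
have e1 : w m = (b / c) *: w m + (a / c) *: w m.
  by rewrite -scalerDl -mulrDl addrC abc divff ?gt_eqF// scale1r.
by rewrite [in RHS]e1 [RHS]addrACA; congr (_ + _); exact: addrC.
Qed.

End CoordinateStep.

Section Mixtures.
Variables (R : realType) (V : lmodType R) (q : V -> R).
Hypotheses (qs : seminorm q) (q_unc : unc q).
Variables (M : Type) (U : set_system M).
Context {UU : UltraFilter U}.

Lemma ule_comb (z z1 z2 z3 : M -> V) k l a b : 0 <= k -> 0 <= l ->
  (forall m, z m = z1 m + (k *: z2 m + l *: z3 m)) ->
  ulimit U (fun m => q (z1 m)) 0 -> ule U (fun m => q (z2 m)) a ->
  ule U (fun m => q (z3 m)) b -> ule U (fun m => q (z m)) (k * a + l * b).
Proof.
move=> k0 l0 zE z10 z2a z3b; rewrite -[k * a + l * b]add0r.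
apply: ule_mono (uleD (ulimit_ule z10) (uleD (uleZ k0 z2a) (uleZ l0 z3b))) => m.
have := qs.1 (z1 m) (k *: z2 m + l *: z3 m); have := qs.1 (k *: z2 m) (l *: z3 m).
by rewrite -zE !qs.2 !ger0_norm// => ? ?; lra.
Qed.

Lemma uge_part (h : M -> V -> R) (z z1 z2 z3 : M -> V) k l b c : dominated q h ->
  0 < k -> 0 <= l -> (forall m, z m = z1 m + (k *: z2 m + l *: z3 m)) ->
  ulimit U (fun m => q (z1 m)) 0 -> ule U (fun m => q (z3 m)) b ->
  uge U (fun m => h m (z m)) c -> uge U (fun m => h m (z2 m)) ((c - l * b) / k).
Proof.
move=> hd k0 l0 zE z10 z3b hz.
have ki : 0 <= k^-1 by rewrite invr_ge0 ltW.
rewrite mulrC -[l * b]add0r.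
apply: uge_mono (ugeZ ki (ugeB hz (uleD (ulimit_ule z10) (uleZ l0 z3b)))) => m.
have [hl hq] := hd m; rewrite mulrC ler_pdivrMr// zE !(linD _ _ hl) !(linZ _ _ hl).
have := hq (z1 m); have := ler_wpM2l l0 (hq (z3 m)).
by rewrite (mulrC _ k) => ? ?; lra.
Qed.

Variable o : V.

(* Up to an error invisible at norm [c], [w - o] is a convex combination giving
   weight [s] to both [u - o] and [v - o]: every functional norming [w - o] also
   norms [u - o] and [v - o]. *)
Definition split_pair (w : M -> V) c := exists (u v : M -> V) s d,
  [/\ 0 < s, 0 < d, ule U (fun m => q (u m - o)) c /\ ule U (fun m => q (v m - o)) c,
    uge U (fun m => q (u m - v m)) d &
    ule U (fun m => q (w m - o - (s *: (u m - o) + s *: (v m - o)))) ((1 - 2 * s) * c)].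

(** Everything but [u - o] contributes at most [(1 - s) * c] to [h (w - o)], so [s * h (u - o)] must
    supply the remaining [s * c]. *)
Lemma norming_split_pair h (w u v : M -> V) s c : dominated q h -> 0 < s ->
  ule U (fun m => q (v m - o)) c ->
  ule U (fun m => q (w m - o - (s *: (u m - o) + s *: (v m - o)))) ((1 - 2 * s) * c) ->
  uge U (fun m => h m (w m - o)) c -> uge U (fun m => h m (u m - o)) c.
Proof.
move=> hd s0 vc rc hw.
pose z m := w m - o - s *: (u m - o).
have zc : ule U (fun m => q (z m)) (s * c + 1 * ((1 - 2 * s) * c)).
  apply: (@ule_comb z (fun=> 0) (fun m => v m - o)
    (fun m => w m - o - (s *: (u m - o) + s *: (v m - o)))) => //; first exact: ltW.
    by move=> m; rewrite add0r scale1r addrC opprD addrA subrK.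
  by apply: eq_ulimit (ulimit_cst 0) => m; rewrite seminorm0.
have := @uge_part h (fun m => w m - o) (fun=> 0) (fun m => u m - o) z s 1 _ c hd s0 ler01 _ _ zc hw.
have -> : (c - 1 * (s * c + 1 * ((1 - 2 * s) * c))) / s = c by field; rewrite gt_eqF.
apply; first by move=> m; rewrite add0r scale1r /z [RHS]addrC subrK.
by apply: eq_ulimit (ulimit_cst 0) => m; rewrite seminorm0.
Qed.

Lemma split_pairC (w u v : M -> V) s c :
  ule U (fun m => q (w m - o - (s *: (u m - o) + s *: (v m - o)))) c ->
  ule U (fun m => q (w m - o - (s *: (v m - o) + s *: (u m - o)))) c.
Proof. by apply: ule_mono => m; rewrite (addrC (s *: (v m - o))). Qed.

Variables (x y w : M -> V) (mu c : R).
Hypothesis mixE : ulimit U (fun m => q (w m - (mu *: x m + (1 - mu) *: y m))) 0.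
Hypotheses (xc : ule U (fun m => q (x m - o)) c) (yc : ule U (fun m => q (y m - o)) c).

Let mix_sub m : w m - o = (w m - (mu *: x m + (1 - mu) *: y m)) +
  (mu *: (x m - o) + (1 - mu) *: (y m - o)).
Proof.
have -> : mu *: (x m - o) + (1 - mu) *: (y m - o) = mu *: x m + (1 - mu) *: y m - o.
  by rewrite !scalerBr addrACA -opprD -scalerDl (addrC mu) subrK scale1r.
by rewrite subrKA.
Qed.

Lemma mixture_ule : 0 <= mu <= 1 -> ule U (fun m => q (w m - o)) c.
Proof.
move=> /andP[mu0 mu1]; have -> : c = mu * c + (1 - mu) * c by ring.
by apply: ule_comb mix_sub mixE xc yc; rewrite // subr_ge0.
Qed.

Lemma mixture_norming h : dominated q h -> 0 < mu < 1 ->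
  uge U (fun m => h m (w m - o)) c ->
  uge U (fun m => h m (x m - o)) c /\ uge U (fun m => h m (y m - o)) c.
Proof.
move=> hd /andP[mu0 mu1] hw; have mu1' : 0 < 1 - mu by rewrite subr_gt0.
split.
  have := uge_part hd mu0 (ltW mu1') mix_sub mixE yc hw.
  by have -> : (c - (1 - mu) * c) / mu = c by field; rewrite gt_eqF.
have mix_sub' m : w m - o = (w m - (mu *: x m + (1 - mu) *: y m)) +
  ((1 - mu) *: (y m - o) + mu *: (x m - o)) by rewrite mix_sub (addrC ((1 - mu) *: (y m - o))).
have := uge_part hd mu1' (ltW mu0) mix_sub' mixE xc hw.
by have -> : (c - mu * c) / (1 - mu) = c by field; rewrite gt_eqF.
Qed.

(** The pair survives with its weight multiplied by [mu], while the other endpoint goes into the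
    remainder; hence the care taken to keep all weights positive. *)
Lemma split_pair_keep : 0 < mu <= 1 -> split_pair x c -> split_pair w c.
Proof.
move=> /andP[mu0 mu1] [u [v [s [d [s0 d0 uvc uvd rest]]]]].
exists u, v, (mu * s), d; split=> //; first exact: mulr_gt0.
have -> : (1 - 2 * (mu * s)) * c = mu * ((1 - 2 * s) * c) + (1 - mu) * c by ring.
apply: ule_comb mixE rest yc; rewrite ?subr_ge0 ?(ltW mu0)// => m.
rewrite mix_sub -!scalerA -scalerDr -addrA; congr (_ + _).
by rewrite [in RHS]scalerBr [RHS]addrAC.
Qed.

Lemma split_pair_new d : 0 < mu < 1 -> 0 < d -> uge U (fun m => q (x m - y m)) d ->
  split_pair w c.
Proof.
move=> /andP[mu0 mu1] d0 xyd; pose s := Num.min mu (1 - mu).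
have s0 : 0 < s by rewrite lt_min mu0 subr_gt0.
have [s1 s2] : s <= mu /\ s <= 1 - mu by rewrite !ge_min !lexx orbT.
exists x, y, s, d; split=> //.
have -> : (1 - 2 * s) * c = (mu - s) * c + (1 - mu - s) * c by ring.
apply: ule_comb mixE xc yc; rewrite ?subr_ge0// => m.
rewrite mix_sub -addrA; congr (_ + _).
by rewrite opprD addrACA -!scalerBl.
Qed.

(** A functional [h] norming [w - o] norms both endpoints of the strict mixture, hence [u - o],
    [v - o] and also [y - o]. As [f] norms the same pair but not [y - o], the pair would span a
    crease. *)
Lemma split_pair_contradiction f : 0 < mu < 1 -> 0 < c -> split_pair x c ->
  uge U (fun m => q (w m - o)) c -> dominated q f ->
  uge U (fun m => f m (x m - o)) c -> ule U (fun m => f m (y m - o)) 0 -> False.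
Proof.
move=> mu01 c0 [u [v [s [d [s0 d0 [uc vc] uvd rest]]]]] wc fd fx fy.
have /choice[h hh] m : exists h, [/\ lin h, forall z, h z <= q z & h (w m - o) = q (w m - o)].
  exact: norming.
have hd : dominated q h by move=> m; have [] := hh m.
have hw : uge U (fun m => h m (w m - o)) c.
  by apply: uge_mono wc => m; have [_ _ ->] := hh m.
have [hx hy] := mixture_norming hd mu01 hw.
have fu := norming_split_pair fd s0 vc rest fx.
have fv := norming_split_pair fd s0 uc (split_pairC rest) fx.
have hu := norming_split_pair hd s0 vc rest hx.
have hv := norming_split_pair hd s0 uc (split_pairC rest) hx.
have hf : uge U (fun m => h m (y m - o) - f m (y m - o)) c.
  by rewrite -[c]subr0; exact: ugeB.
have uv0 : ulimit U (fun m => q (u m - o - (v m - o))) 0.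
  exact: (unc_net qs q_unc c0 c0 hd fd uc vc yc hu hv fu fv hf).
have : d <= 0.
  apply: (@uge_ulimit R _ U _ _ _ _ uv0); apply: uge_mono uvd => m.
  by rewrite opprB addrA subrK.
by rewrite leNgt d0.
Qed.

End Mixtures.

Lemma split_pair_fst (R : realType) (V : lmodType R) (q : V -> R) M L (U : set_system M)
  (W : set_system L) {UU : UltraFilter U} {WW : UltraFilter W} o w c :
  split_pair q U o w c -> split_pair q (uprod U W) o (fun ml => w ml.1) c.
Proof.
move=> [u [v [s [d [s0 d0 [uc vc] uvd rest]]]]].
have pull (A : set M) : U A -> uprod U W [set ml | A ml.1].
  by apply: (filterS (F := U)) => m Am /=; exact: (@ultra_setT _ W WW).
exists (fun ml => u ml.1), (fun ml => v ml.1), s, d.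
by split=> //; [split|..] => e e0;
  [exact: (pull _ (uc _ e0))|exact: (pull _ (vc _ e0))|exact: (pull _ (uvd _ e0))
  |exact: (pull _ (rest _ e0))].
Qed.

Lemma split_pair_snd (R : realType) (V : lmodType R) (q : V -> R) M L (U : set_system M)
  (W : set_system L) {UU : UltraFilter U} {WW : UltraFilter W} o w c :
  split_pair q U o w c -> split_pair q (uprod W U) o (fun ml => w ml.2) c.
Proof.
move=> [u [v [s [d [s0 d0 [uc vc] uvd rest]]]]].
have pull (A : set M) : U A -> uprod W U [set ml | A ml.2].
  by move=> UA; rewrite /uprod /=; exact: (@ultra_setT _ W WW).
exists (fun ml => u ml.2), (fun ml => v ml.2), s, d.
by split=> //; [split|..] => e e0;
  [exact: (pull _ (uc _ e0))|exact: (pull _ (vc _ e0))|exact: (pull _ (uvd _ e0))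
  |exact: (pull _ (rest _ e0))].
Qed.

Section MinimalSets.
Variables (R : realType) (r : nat) (psi : absnorm R r) (V : lmodType R).
Hypothesis psi_sm : strictly_monotone psi.
Variable q : 'I_r -> V -> R.
Hypothesis qs : forall i, seminorm (q i).
Hypothesis q_unc : forall i, unc (q i).
Hypothesis Ncomplete : scomplete (sumnorm psi q).
Local Notation N := (sumnorm psi q).
Let Ns : seminorm N := sumnorm_seminorm psi_sm qs.

Variables (J : Type) (S : J -> V -> V) (K : set V) (B : R).
Hypotheses (Kcl : sclosed N K) (Kcvx : cvx K) (KB : bounded_by N K B) (K0 : K !=set0).
Hypotheses (KS : forall j, stable K (S j)) (KN : forall j, nonexpansive N K (S j)).
Hypothesis Kmin : forall A, A `<=` K -> A !=set0 -> sclosed N A -> cvx A ->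
  (forall j, stable A (S j)) -> K `<=` A.
Hypothesis Kafp : approx_fixed N S K.

Lemma ulimit_sumnorm M (U : set_system M) {UU : UltraFilter U} (w : M -> V) (l : 'I_r -> R) :
  (forall i, ulimit U (fun m => q i (w m)) (l i)) -> ulimit U (fun m => N (w m)) (psi l).
Proof. by move=> h; apply: (@ulimit_psi _ _ psi _ U UU (fun i m => q i (w m))). Qed.

Lemma coord_ulimit_ex M (U : set_system M) {UU : UltraFilter U} (w v : M -> V) :
  (forall m, K (w m)) -> (forall m, K (v m)) ->
  exists l : 'I_r -> R, (forall i, 0 <= l i) /\
    forall i, ulimit U (fun m => q i (w m - v m)) (l i).
Proof.
move=> Kw Kv.
have /choice[l hl] i : exists l, ulimit U (fun m => q i (w m - v m)) l.
  apply: (@ulimit_ex R _ U _ _ B) => m; rewrite ger0_norm ?seminorm_ge0//.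
  exact: le_trans (coord_sumnorm psi_sm qs i _) (KB (Kw m) (Kv m)).
exists l; split=> // i; apply: ulimit_ge_cst (hl i) _.
by apply: ultra_setT => m /=; exact: seminorm_ge0.
Qed.

Lemma norming_family M (w : M -> V) i : exists h : M -> V -> R, dominated (q i) h /\
  forall m, h m (w m) = q i (w m).
Proof.
have /choice[h hh] m : exists h, [/\ lin h, forall z, h z <= q i z & h (w m) = q i (w m)].
  exact: norming.
by exists h; split=> m; have [] := hh m.
Qed.

Section PositiveDistance.
Variables (L : set_system (family_index J)) (x : family_index J -> V) (t0 : R) (o : V).
Context {LL : UltraFilter L}.
Hypotheses (Lin : forall j, L [set l | List.In j l.1])
  (L0 : ulimit L (fun l => l.2.+1%:R^-1 : R) 0).
Hypotheses (Kx : forall l, K (x l)) (fx : forall j, fixed_net N L (S j) x) (Ko : K o).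
Hypothesis xp : forall p, K p -> ulimit L (fun l => N (x l - p)) t0.
Hypothesis far : forall M (U : set_system M), UltraFilter U -> forall (w : M -> V) p t,
  K p -> (forall m, K (w m)) -> (forall j, fixed_net N U (S j) w) ->
  ulimit U (fun m => N (w m - p)) t -> t0 <= t.
Hypothesis xo : wlimit psi q L x o.
Hypothesis t0p : 0 < t0.

Variable c : 'I_r -> R.
Hypotheses (c0 : forall i, 0 <= c i) (xc : forall i, ulimit L (fun l => q i (x l - o)) (c i)).
Variable g : 'I_r -> family_index J -> V -> R.
Hypotheses (gd : forall i, dominated (q i) (g i))
  (gx : forall i l, g i l (x l - o) = q i (x l - o)).
Variable ginf : 'I_r -> V -> R.
Hypothesis ginfE : forall i v, ulimit L (fun l => g i l v) (ginf i v).

Lemma psi_c : psi c = t0.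
Proof. exact: (ulimit_uniq (ulimit_sumnorm xc) (xp Ko)). Qed.

Lemma ginf_lin i : lin (ginf i).
Proof.
move=> a u v; apply: ulimit_uniq (ginfE i _) _.
apply: eq_ulimit (ulimitD (ulimitZ a (ginfE i u)) (ginfE i v)) => l.
by rewrite (gd i l).1.
Qed.

Lemma ginf_le i v : ginf i v <= q i v.
Proof.
apply: ulimit_le_cst (ginfE i v) _; apply: ultra_setT => l /=.
exact: (gd i l).2.
Qed.

Lemma weak_null (f : V -> R) i : lin f -> (forall v, f v <= q i v) ->
  ulimit L (fun l => f (x l - o)) 0.
Proof.
move=> fl fq; rewrite -(subrr (f o)).
apply: eq_ulimit (ulimitB (xo fl _) (ulimit_cst (f o))) => [l|].
  by rewrite linB.
by exists 1 => v; rewrite mul1r; exact: le_trans (fq v) (coord_sumnorm psi_sm qs i v).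
Qed.

(** What one step hands to the next: [A] lists the coordinates already split. Vanishing of [ginf i]
    makes the functionals norming a fresh copy of [x - o] null on [w - o], as the next joining
    requires. *)
Definition state (A : {set 'I_r}) := exists M (U : set_system M) (w : M -> V),
  [/\ UltraFilter U, (forall m, K (w m)), (forall j, fixed_net N U (S j) w),
    (forall i, ulimit U (fun m => q i (w m - o)) (c i)) /\
    (forall i, ulimit U (fun m => ginf i (w m - o)) 0) &
    forall i, i \in A -> split_pair (q i) U o w (c i)].

Lemma state0 : state finset.set0.
Proof.
exists (family_index J), L, x; split=> // [|i]; last by rewrite inE.
by split=> // i; apply: weak_null; [exact: ginf_lin|exact: ginf_le].
Qed.

(** [w] is joined to a fresh copy of [x], which lies at distance [t0] from it because distances to
    points of [K] are constant. Nets within [tau] of one and [t0 - tau] of the other form an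
    invariant set, to which [approx_fixed] applies. *)
Lemma between_fixed_net M (U : set_system M) {UU : UltraFilter U} (w : M -> V) tau :
  (forall m, K (w m)) -> (forall j, fixed_net N U (S j) w) -> 0 <= tau <= t0 ->
  exists z : family_index J * (M * family_index J) -> V,
  [/\ forall m, K (z m), forall j, fixed_net N (uprod L (uprod U L)) (S j) z,
    ulimit (uprod L (uprod U L)) (fun m => N (w m.2.1 - x m.2.2)) t0,
    ule (uprod L (uprod U L)) (fun m => N (z m - w m.2.1)) tau &
    ule (uprod L (uprod U L)) (fun m => N (z m - x m.2.2)) (t0 - tau)].
Proof.
move=> Kw fw /andP[tau0 taut].
pose U1 := uprod U L; have UU1 : UltraFilter U1 := @uprod_ultra _ _ U L UU LL.
pose w1 (m : M * family_index J) := w m.1; pose y (m : M * family_index J) := x m.2.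
have fw1 j : fixed_net N U1 (S j) w1.
  exact: (@ulimit_fst _ _ _ U L UU LL (fun m => N (S j (w m) - w m)) 0 (fw j)).
have fy j : fixed_net N U1 (S j) y.
  exact: (@ulimit_snd _ _ _ U L UU LL (fun m => N (S j (x m) - x m)) 0 (fx j)).
have wy : ulimit U1 (fun m => N (w1 m - y m)) t0.
  apply: (@ulimit_uprod _ _ _ U L UU LL _ (fun=> t0)); last exact: ulimit_cst.
  by move=> m; apply: eq_ulimit (xp (Kw m)) => l; rewrite (seminormB _ _ Ns).
pose W := [set z : M * family_index J -> V | (forall m, K (z m)) /\
  (ule U1 (fun m => N (z m - w1 m)) tau /\ ule U1 (fun m => N (z m - y m)) (t0 - tau))].
have approach (v u : M * family_index J -> V) s :
    (forall e, 0 < e -> exists2 z, W z & ule U1 (fun m => N (v m - z m)) e) ->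
    (forall z, W z -> ule U1 (fun m => N (z m - u m)) s) -> ule U1 (fun m => N (v m - u m)) s.
  move=> h hu e e0; have e40 : 0 < e / 4 by lra.
  have [z Wz vz] := h _ e40.
  apply: filterS (ultraI (vz _ e40) (hu z Wz _ e40)) => m [/= h1 h2].
  by have := seminormBD (v m) (z m) (u m) Ns => ?; lra.
have push (z u : M * family_index J -> V) s j : (forall m, K (z m)) -> (forall m, K (u m)) ->
    fixed_net N U1 (S j) u -> ule U1 (fun m => N (z m - u m)) s ->
    ule U1 (fun m => N (S j (z m) - u m)) s.
  move=> Kz Ku fu zu; rewrite -[s]addr0.
  apply: ule_mono (uleD zu (ulimit_ule fu)) => m.
  have := seminormBD (S j (z m)) (S j (u m)) (u m) Ns.
  by have := KN j (Kz m) (Ku m) => ? ?; lra.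
have cvxW (z z' u : M * family_index J -> V) s a b : 0 <= a -> 0 <= b -> a + b = 1 ->
    ule U1 (fun m => N (z m - u m)) s -> ule U1 (fun m => N (z' m - u m)) s ->
    ule U1 (fun m => N ((a *: z + b *: z') m - u m)) s.
  move=> a0 b0 ab zu zu'; have -> : s = a * s + b * s by rewrite -mulrDl ab mul1r.
  apply: (ule_comb Ns a0 b0 _ _ zu zu' (z1 := fun=> 0)).
    move=> m; rewrite add0r !scalerBr addrACA -opprD -scalerDl ab scale1r.
    by [].
  by apply: eq_ulimit (ulimit_cst 0) => m; rewrite (seminorm0 Ns).
have Wafp F e : 0 < e -> exists2 z, W z &
    forall j, List.In j F -> ule U1 (fun m => N (S j (z m) - z m)) e.
  apply: Kafp.
  (* The point of the straight segment at ratio [tau / t0] shows that this set of nets is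
     nonempty. *)
  - pose k := tau / t0.
    have k0 : 0 <= k by rewrite divr_ge0// ltW.
    have k1 : k <= 1 by rewrite ler_pdivrMr// mul1r.
    have kt : k * t0 = tau by rewrite /k mulfVK ?gt_eqF.
    exists (fun m => (1 - k) *: w1 m + k *: y m); split.
      by move=> m; apply: Kcvx => //; [exact: Kw|exact: Kx|rewrite subr_ge0|rewrite subrK].
    split.
      rewrite -kt; apply: ule_mono (uleZ k0 (ulimit_ule wy)) => m.
      have -> : (1 - k) *: w1 m + k *: y m - w1 m = k *: (y m - w1 m).
        by rewrite scalerBl scale1r addrAC (addrAC (w1 m)) subrr add0r addrC -scalerBr.
      by rewrite Ns.2 ger0_norm// (seminormB _ _ Ns).
    have -> : t0 - tau = (1 - k) * t0 by rewrite mulrBl mul1r kt.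
    have k1' : 0 <= 1 - k by rewrite subr_ge0.
    apply: ule_mono (uleZ k1' (ulimit_ule wy)) => m.
    have -> : (1 - k) *: w1 m + k *: y m - y m = (1 - k) *: (w1 m - y m).
      rewrite scalerBr -addrA; congr (_ + _).
      by rewrite -[X in _ - X]scale1r -scalerBl -scaleNr opprB.
    by rewrite Ns.2 ger0_norm.
  - by move=> z [].
  - move=> z z' a b [Kz [zw zy]] [Kz' [zw' zy']] a0 b0 ab; split.
      by move=> m; apply: Kcvx.
    by split; apply: cvxW.
  - move=> v Kv h; split=> //; split; apply: approach => //.
      by move=> z [_ []].
    by move=> z [_ []].
  - move=> j z [Kz [zw zy]]; split; first by move=> m; exact: KS.
    by split; apply: push => // m; [exact: Kw|exact: Kx].
(* The nets obtained for each finite family and accuracy are assembled into one by a further product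
   of ultrafilters. *)
have /choice[z hz] l : exists z, W z /\
    forall j, List.In j l.1 -> ule U1 (fun m => N (S j (z m) - z m)) l.2.+1%:R^-1.
  have li : (0 : R) < l.2.+1%:R^-1 by rewrite invr_gt0.
  by have [z Wz hz] := Wafp l.1 _ li; exists z.
have UU2 : UltraFilter (uprod L U1) := @uprod_ultra _ _ L U1 LL UU1.
exists (fun m => z m.1 m.2); split.
- by move=> [l m]; have [[]] := hz l.
- move=> j; apply: ulimit_of_ule_uge => e e0; last first.
    by apply: ultra_setT => m /=; apply: le_trans (seminorm_ge0 _ Ns); lra.
  have e20 : 0 < e / 2 by lra.
  change (L [set l | U1 [set m | N (S j (z l m) - z l m) <= 0 + e]]).
  apply: filterS (ultraI (Lin j) (ulimit_near L0 e20)) => l [/= jl le].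
  have [_ /(_ j jl _ e20) h] := hz l.
  apply: (filterS (F := U1) _ h) => m /= hm.
  by rewrite add0r; apply: (le_trans hm); rewrite [leRHS](splitr e) lerD2r; exact: ltW.
- exact: (@ulimit_snd _ _ _ L U1 LL UU1 (fun m => N (w m.1 - x m.2)) t0 wy).
- by apply: (@ule_uprod _ _ L LL _ U1 UU1) => l; have [[_ []]] := hz l.
- by apply: (@ule_uprod _ _ L LL _ U1 UU1) => l; have [[_ []]] := hz l.
Qed.

Lemma coordinate_mixture M (U : set_system M) {UU : UltraFilter U} (w y z : M -> V) a b i :
  0 <= a -> 0 <= b -> a + b = c i ->
  ulimit U (fun m => q i (z m - w m)) a -> ulimit U (fun m => q i (z m - y m)) b ->
  ulimit U (fun m => q i (w m - o)) (c i) ->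
  (exists f h, [/\ dominated (q i) f, dominated (q i) h,
    uge U (fun m => f m (w m - o)) (c i) /\ ulimit U (fun m => f m (y m - o)) 0 &
    uge U (fun m => h m (y m - o)) (c i) /\ ulimit U (fun m => h m (w m - o)) 0]) ->
  exists mu, [/\ 0 <= mu <= 1, (a < c i \/ c i = 0 -> 0 < mu), 0 < a -> mu < 1 &
    ulimit U (fun m => q i (z m - (mu *: w m + (1 - mu) *: y m))) 0].
Proof.
move=> a0 b0 abc za zb wc [f [h [fd hd [fw fy] [hy hw]]]].
have [cz|cz] := eqVneq (c i) 0.
  have az : a = 0 by rewrite cz in abc; lra.
  (* Where the distances vanish any weight works; 1 keeps [mu] positive. *)
  exists 1; split; [by rewrite ler01 lexx|by move=> _; exact: ltr01|by rewrite az ltxx|].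
  by rewrite az in za; rewrite subrr; apply: eq_ulimit za => m; rewrite scale1r scale0r addr0.
have cp : 0 < c i by rewrite lt_def cz c0.
exists (b / c i); split.
- by rewrite divr_ge0//= ler_pdivrMr// mul1r -abc lerDr.
- by case=> [ac|/eqP]; [rewrite divr_gt0//; lra|rewrite (negPf cz)].
- by move=> ap; rewrite ltr_pdivrMr// mul1r; lra.
- have za' : ulimit U (fun m => q i (w m - z m)) a.
    by apply: eq_ulimit za => m; rewrite (seminormB _ _ (qs i)).
  apply: (@between_on_segment R V (q i) (qs i) (q_unc i) M U UU o f h w y z a b (c i)) => //.
  + exact: ulimit_ule.
  + exact: ulimit_ule.
  + exact: ulimit_ule.
Qed.

(** Betweenness in norm becomes betweenness in each coordinate by [psi_le_eq]. A coordinate that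
    moves, [a i > 0], gets a strict mixture: inside [A] this is a crease, outside it creates a new
    pair. *)
Lemma state_step A : state A -> exists2 i, i \notin A & state (i |: A)%SET.
Proof.
move=> [M [U [w0 [UU Kw0 fw0 [w0c w0g] w0A]]]].
(* With [tau] below every positive [c i], no nontrivial coordinate of the new net reaches [y], so
   all weights on [w] are positive. *)
have [tau [tau0 taut tauc]] : exists tau, [/\ 0 < tau, tau <= t0 & forall i, 0 < c i -> tau < c i].
  have cif i : 0 < (if 0 < c i then c i else 1) by case: ifP.
  have [e /andP[e0 et] he] := exists_lower_bound cif t0p.
  exists (e / 2); split=> [||i ci]; [lra|lra|].
  by have := he i; rewrite ci => ?; lra.
have tau01 : 0 <= tau <= t0 by rewrite ltW.
have [z [Kz fz wy zw zy]] := between_fixed_net Kw0 fw0 tau01.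
pose U1 := uprod U L; have UU1 : UltraFilter U1 := @uprod_ultra _ _ U L UU LL.
pose U2 := uprod L U1; have UU2 : UltraFilter U2 := @uprod_ultra _ _ L U1 LL UU1.
pose M2 := (family_index J * (M * family_index J))%type.
pose w (m : M2) := w0 m.2.1; pose y (m : M2) := x m.2.2.
have pullw (F : M -> R) l : ulimit U F l -> ulimit U2 (fun m => F m.2.1) l.
  move=> Fl; apply: (@ulimit_snd _ _ _ L U1 LL UU1 (fun m => F m.1)).
  exact: (@ulimit_fst _ _ _ U L UU LL F l Fl).
have pully (F : family_index J -> R) l : ulimit L F l -> ulimit U2 (fun m => F m.2.2) l.
  move=> Fl; apply: (@ulimit_snd _ _ _ L U1 LL UU1 (fun m => F m.2)).
  exact: (@ulimit_snd _ _ _ U L UU LL F l Fl).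
have pull2 (F : M * family_index J -> R) (G : M -> R) l :
    (forall m, ulimit L (fun k => F (m, k)) (G m)) -> ulimit U G l ->
    ulimit U2 (fun m => F m.2) l.
  move=> FG Gl; apply: (@ulimit_snd _ _ _ L U1 LL UU1 F).
  exact: (@ulimit_uprod _ _ _ U L UU LL F G l FG Gl).
have Kw (m : M2) : K (w m) by exact: Kw0.
have Ky (m : M2) : K (y m) by exact: Kx.
have wc i : ulimit U2 (fun m => q i (w m - o)) (c i) by exact: (pullw _ _ (w0c i)).
have yc i : ulimit U2 (fun m => q i (y m - o)) (c i) by exact: (pully _ _ (xc i)).
(* A functional chosen for [w] is fixed while the index of [y] runs, so it is null on the weakly
   null [y - o]; the [g i] vary with [y], and on [w - o] they tend to [ginf i], which vanishes along
   the state. *)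
have funs i : exists f h, [/\ dominated (q i) f, dominated (q i) h,
    uge U2 (fun m => f m (w m - o)) (c i) /\ ulimit U2 (fun m => f m (y m - o)) 0 &
    uge U2 (fun m => h m (y m - o)) (c i) /\ ulimit U2 (fun m => h m (w m - o)) 0].
  have [f [fd fE]] := norming_family (fun m => w0 m - o) i.
  exists (fun m => f m.2.1), (fun m => g i m.2.2); split.
  - by move=> m; exact: fd.
  - by move=> m; exact: gd.
  - split; first by apply: uge_mono (ulimit_uge (wc i)) => m; rewrite fE.
    apply: (pull2 (fun ml => f ml.1 (x ml.2 - o)) (fun=> 0)); last exact: ulimit_cst.
    by move=> m /=; apply: (@weak_null (f m) i); [exact: (fd m).1|exact: (fd m).2].
  - split; first by apply: uge_mono (ulimit_uge (yc i)) => m; rewrite gx.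
    apply: (pull2 (fun ml => g i ml.2 (w0 ml.1 - o)) (fun m => ginf i (w0 m - o))) => //.
    by move=> m /=; exact: ginfE.
have [a [a0 al]] := @coord_ulimit_ex _ U2 UU2 z w Kz Kw.
have [b [b0 bl]] := @coord_ulimit_ex _ U2 UU2 z y Kz Ky.
have [d [d0 dl]] := @coord_ulimit_ex _ U2 UU2 w y Kw Ky.
have psia : psi a <= tau by exact: (ule_ulimit (ulimit_sumnorm al) zw).
have psib : psi b <= t0 - tau by exact: (ule_ulimit (ulimit_sumnorm bl) zy).
have psid : psi d = t0 by exact: (ulimit_uniq (ulimit_sumnorm dl) wy).
(* The functional norming [w - o] and null on [y - o] gives [c i <= d i], and the norms of [c] and
   [d] agree. *)
have dc : c = d.
  apply: (psi_le_eq psi_sm); last by rewrite psid psi_c.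
  move=> i; rewrite c0 /=; have [f [h [fd hd [fw fy] _]]] := funs i.
  apply: (uge_ulimit (dl i)); rewrite -[c i]subr0.
  apply: uge_mono (ugeB fw (ulimit_ule fy)) => m; have [fl fq] := fd m.
  by rewrite -(linB _ _ fl) opprB subrKA.
(* Coordinatewise [d] is at most [a + b], whose norm is at most [tau + (t0 - tau)]. *)
have abc : c = (fun i => a i + b i).
  apply: (psi_le_eq psi_sm) => [i|].
    rewrite c0 /= dc; apply: ulimit_le (dl i) (ulimitD (al i) (bl i)) _.
    apply: ultra_setT => m /=; rewrite (seminormB (z m) (w m) (qs i)).
    exact: seminormBD.
  by rewrite psi_c; apply: le_trans (psi_triangle _ _ _) _; lra.
have abi i : a i + b i = c i by rewrite abc.
have psia' : tau <= psi a.
  have := psi_triangle psi a b; rewrite -abc psi_c => ?; lra.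
have [i0 ai0] : exists i, 0 < a i.
  apply: contrapT => /forallNP h; move: psia'.
  suff -> : a = (fun=> 0) by rewrite psi0 leNgt tau0.
  apply/funext => i; apply/eqP; rewrite eq_le a0 andbT leNgt; exact/negP.
have /choice[mu hmu] i := @coordinate_mixture _ U2 UU2 w y z (a i) (b i) i (a0 i) (b0 i)
  (abi i) (al i) (bl i) (wc i) (funs i).
have mu0 i : 0 < mu i.
  have [_ h _ _] := hmu i; apply: h.
  have [ci|ci] := eqVneq (c i) 0; [by right|left].
  have cp : 0 < c i by rewrite lt_def ci c0.
  apply: le_lt_trans (tauc i cp); apply: le_trans psia; exact: psi_coord.
have mu1 i : mu i <= 1 by have [/andP[]] := hmu i.
have mix i : ulimit U2 (fun m => q i (z m - (mu i *: w m + (1 - mu i) *: y m))) 0.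
  by have [] := hmu i.
have wcu i : ule U2 (fun m => q i (w m - o)) (c i) by exact: ulimit_ule.
have ycu i : ule U2 (fun m => q i (y m - o)) (c i) by exact: ulimit_ule.
have zcu i : ule U2 (fun m => q i (z m - o)) (c i).
  by apply: (mixture_ule (qs i) (mix i) (wcu i) (ycu i)); rewrite (ltW (mu0 i)) mu1.
have [e [e0 el]] := @coord_ulimit_ex _ U2 UU2 z (fun=> o) Kz (fun=> Ko).
(* Extremality enters here: the new fixed net cannot be closer to [o] than [t0]. *)
have ec : e = c.
  apply: (psi_le_eq psi_sm) => [i|]; first by rewrite e0 (ule_ulimit (el i) (zcu i)).
  rewrite psi_c; exact: (far UU2 Ko Kz fz (ulimit_sumnorm el)).
have zc i : ulimit U2 (fun m => q i (z m - o)) (c i) by rewrite -ec.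
have ci0 : 0 < c i0 by rewrite -abi ltr_pwDl.
have mu01 : 0 < mu i0 < 1 by rewrite mu0 /=; have [_ _ ->] := hmu i0.
have wA i : i \in A -> split_pair (q i) U2 o w (c i).
  move=> iA; apply: (@split_pair_snd _ _ _ _ _ U1 L UU1 LL o (fun m => w0 m.1)).
  by apply: (@split_pair_fst _ _ _ _ _ U L UU LL); exact: w0A.
exists i0.
  apply/negP => iA; have [f [h [fd hd [fw fy] _]]] := funs i0.
  exact: (split_pair_contradiction (qs i0) (q_unc i0) (mix i0) (wcu i0) (ycu i0) mu01 ci0
    (wA _ iA) (ulimit_uge (zc i0)) fd fw (ulimit_ule fy)).
exists M2, U2, z; split=> //.
  split=> // i; have lg := ginf_lin i.
  have wg : ulimit U2 (fun m => ginf i (w m - o)) 0 by exact: (pullw _ _ (w0g i)).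
  have yg : ulimit U2 (fun m => ginf i (y m - o)) 0.
    by apply: (pully (fun k => ginf i (x k - o))); apply: weak_null => //; exact: ginf_le.
  have mg : ulimit U2 (fun m => ginf i (z m - (mu i *: w m + (1 - mu i) *: y m))) 0.
    apply: ulimit_squeeze0 (mix i); apply: ultra_setT => m /=.
    by apply: (lin_norm _ (qs i) lg); exact: ginf_le.
  have <- : 0 + (mu i * 0 + (1 - mu i) * 0) = 0 by rewrite !mulr0 !addr0.
  apply: eq_ulimit (ulimitD mg (ulimitD (ulimitZ (mu i) wg) (ulimitZ (1 - mu i) yg))) => m.
  by rewrite !(linB _ _ lg) !(linD _ _ lg) !(linZ _ _ lg); ring.
move=> i; rewrite in_setU1 => /predU1P[->|iA].
  apply: (split_pair_new (qs i0) (mix i0) (wcu i0) (ycu i0) mu01 ci0).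
  by apply: ulimit_uge; rewrite dc.
by apply: (split_pair_keep (qs i) (mix i) (ycu i) _ (wA _ iA)); rewrite mu0 mu1.
Qed.

Lemma no_state : False.
Proof.
have [A [hA _]] : exists A : {set 'I_r}, (#|A| > r)%N /\ state A.
  elim: (r.+1) => [|k [A [hA sA]]]; first by exists finset.set0; split=> //; exact: state0.
  have [i iA si] := state_step sA; exists (i |: A)%SET; split=> //.
  by rewrite cardsU1 iA.
by have := max_card (mem A); rewrite card_ord leqNgt hA.
Qed.

End PositiveDistance.

Lemma minimal_common_fixed : exists2 p, K p & forall j, N (S j p - p) = 0.
Proof.
have [p0 [L [x [t0 [LL Kp0 [Lin L0] [Kx fx] [xt0 far0]]]]]] := minimal_fixed_net Ns Kcvx KB KS K0 Kafp.
exists p0 => //.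
have cd := const_dist Ns Kcl Kcvx KB KS KN Kmin.
have t00 : 0 <= t0 by apply: ulimit_ge_cst xt0 _; apply: ultra_setT => l /=; exact: seminorm_ge0.
have [tz|tz] := eqVneq t0 0.
  move=> j; apply/eqP; rewrite eq_le seminorm_ge0// andbT.
  rewrite tz in xt0.
  have lim : ulimit L (fun l => N (x l - p0) + (N (S j (x l) - x l) + N (x l - p0))) (0 + (0 + 0)).
    by apply: ulimitD => //; apply: ulimitD => //; exact: fx.
  rewrite !addr0 in lim; apply: ulimit_ge_cst lim _; apply: ultra_setT => l /=.
  have := seminormBD (S j p0) (S j (x l)) p0 Ns; have := seminormBD (S j (x l)) (x l) p0 Ns.
  have := KN j Kp0 (Kx l); rewrite (seminormB p0 (x l) Ns) => ? ? ?; lra.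
have t0p : 0 < t0 by rewrite lt_def tz.
exfalso.
have [ o Ko xo] := exists_wlimit psi_sm qs q_unc Ncomplete Kcl Kcvx KB Kx.
have [c [c0 xc]] := @coord_ulimit_ex _ L LL x (fun=> o) Kx (fun=> Ko).
have /choice[g hg] i := norming_family (fun l => x l - o) i.
have gd i : dominated (q i) (g i) := (hg i).1.
have ginfE i v : ulimit L (fun l => g i l v) (ulim L (fun l => g i l v)).
  apply: (@ulimP _ _ _ _ _ (q i v)) => l.
  exact: lin_norm (qs i) (gd i l).1 (gd i l).2.
have xp p : K p -> ulimit L (fun l => N (x l - p)) t0 by move=> Kp; exact: cd xt0.
apply: (@no_state L x t0 o LL Lin L0 Kx fx Ko xp _ xo t0p c c0 xc g gd (fun i => (hg i).2) _ ginfE).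
move=> M U UU w p t Kp Kw fw lt; apply: (far0 M U UU w t) => //.
exact: cd lt.
Qed.

End MinimalSets.

(** * Commuting nonexpansive maps *)

Section CommonFixedPoints.
Variables (R : realType) (r : nat) (psi : absnorm R r) (V : lmodType R).
Hypothesis psi_sm : strictly_monotone psi.
Variable q : 'I_r -> V -> R.
Hypothesis qs : forall i, seminorm (q i).
Hypothesis q_unc : forall i, unc (q i).
Local Notation N := (sumnorm psi q).
Hypothesis Ncomplete : scomplete N.
Let Ns : seminorm N := sumnorm_seminorm psi_sm qs.

Definition body (D : set V) := [/\ D !=set0, sclosed N D, cvx D & exists B, bounded_by N D B].

(** Approximate fixed points are assumed in every body inside [D], since the minimal one is only
    supplied by Zorn's lemma. Chains have nonempty intersection by [directed_intersection]. *)
Lemma common_fixed_point (J : Type) (S : J -> V -> V) (D : set V) : body D ->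
  (forall j, stable D (S j)) -> (forall j, nonexpansive N D (S j)) ->
  (forall K, K `<=` D -> body K -> (forall j, stable K (S j)) -> approx_fixed N S K) ->
  exists2 p, D p & forall j, N (S j p - p) = 0.
Proof.
move=> [D0 Dcl Dcvx [B DB]] DS DN Dafp.
pose P (K : set V) := [/\ K `<=` D, K !=set0, sclosed N K, cvx K & forall j, stable K (S j)].
pose T := {K | P K}.
have PD : P D by split.
pose rel (K K' : T) := `[< sval K' `<=` sval K >].
have relxx K : rel K K by apply/asboolP.
have rel_trans K1 K2 K3 : rel K1 K2 -> rel K2 K3 -> rel K1 K3.
  by move=> /asboolP h1 /asboolP h2; apply/asboolP; exact: subset_trans h1.
have [A Atot|[K PK] Kmax] := @ZL_preorder T (exist _ D PD) rel relxx rel_trans.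
  have [[K0 AK0]|A0] := pselect (A !=set0); last first.
    by exists (exist _ D PD) => K AK; exfalso; apply: A0; exists K.
  have [p hp] : exists p, forall K : set V, [set sval K | K in A] K -> K p.
    apply: (directed_intersection psi_sm qs q_unc Ncomplete).
    + by exists (sval K0), K0.
    + move=> _ _ [K1 A1 <-] [K2 A2 <-].
      have [/asboolP h|/asboolP h] := Atot _ _ A1 A2.
        by exists (sval K2); [exists K2|move=> x Kx; split=> //; exact: h].
      by exists (sval K1); [exists K1|move=> x Kx; split=> //; exact: h].
    + by move=> _ [K1 A1 <-]; have [_ h1 h2 h3 _] := svalP K1.
    + have [sD [x Kx] _ _ _] := svalP K0; exists B, x => _ [K1 A1 <-].
      by have [sD1 [y Ky] _ _ _] := svalP K1; exists y => //; apply: DB; [exact: sD|exact: sD1].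
  have PI : P [set x | forall K, A K -> sval K x].
    split.
    + by move=> x h; have [sD _ _ _ _] := svalP K0; apply: sD; exact: h.
    + by exists p => K AK; apply: hp; exists K.
    + move=> v h K AK; have [_ _ cl _ _] := svalP K; apply: cl => e /h[a ha va].
      by exists a => //; exact: ha.
    + move=> x y s t hx hy s0 t0 st K AK; have [_ _ _ cv _] := svalP K.
      by apply: cv => //; [exact: hx|exact: hy].
    + by move=> j x hx K AK; have [_ _ _ _ st] := svalP K; apply: st; exact: hx.
  by exists (exist _ _ PI) => K AK; apply/asboolP => x; apply.
have [KD K0 Kcl Kcvx KS] := PK.
have KB : bounded_by N K B by move=> x y /KD ? /KD ?; exact: DB.
have Kmin A : A `<=` K -> A !=set0 -> sclosed N A -> cvx A -> (forall j, stable A (S j)) -> K `<=` A.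
  move=> AK A0 Acl Acvx AS.
  have PA : P A by split=> //; exact: subset_trans KD.
  have := Kmax (exist _ A PA); rewrite /rel /= => h.
  by apply/asboolP; apply: h; exact/asboolP.
have KN j : nonexpansive N K (S j) by move=> x y /KD ? /KD ?; exact: DN.
have Kb : body K by split=> //; exists B.
have [p Kp hp] := minimal_common_fixed psi_sm qs q_unc Ncomplete Kcl Kcvx KB K0 KS KN Kmin
  (Dafp K KD Kb KS).
by exists p => //; exact: KD.
Qed.

Lemma geometric_small (h e : R) : 0 < h -> 0 < e -> exists n, ((1 + h)^-1) ^+ n <= e.
Proof.
move=> h0 e0; have h1 : 0 < 1 + h by exact: addr_gt0.
have bern n : 1 + n%:R * h <= (1 + h) ^+ n.
  elim: n => [|n IH]; first by rewrite mul0r addr0 expr0.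
  rewrite exprS; have := ler_wpM2l (ltW h1) IH.
  have : 0 <= n%:R * h * h by rewrite !mulr_ge0// ltW.
  by rewrite -natr1; move: (n%:R) => k ? ?; lra.
have [n hn] : exists n : nat, (e * h)^-1 <= n%:R.
  exists (Num.Def.archi_bound (e * h)^-1); apply/ltW/archi_boundP.
  by rewrite invr_ge0 mulr_ge0// ltW.
exists n; rewrite exprVn invf_ple ?posrE ?exprn_gt0//.
apply: le_trans (bern n).
have -> : e^-1 = (e * h)^-1 * h by rewrite invfM mulfVK ?gt_eqF.
by apply: le_trans (ler_wpM2r (ltW h0) hn) _; rewrite lerDr ler01.
Qed.

(** The contraction sending [w] to [a *: S w + (1 - a) *: z0] is iterated finitely often, so no
    limit has to lie in [W], and the bound is uniform over the index of the net. *)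
Lemma picard_approx (K : set V) B (S : V -> V) M (W : set (M -> V)) e :
  bounded_by N K B -> nonexpansive N K S -> stable K S -> W !=set0 ->
  (forall w, W w -> forall m, K (w m)) -> cvx W -> (forall w, W w -> W (fun m => S (w m))) ->
  0 < e -> exists2 w, W w & forall m, N (S (w m) - w m) <= e.
Proof.
move=> KB KN KS [z0 Wz0] WK Wcvx WS e0.
have [[m0]|nM] := pselect (exists m : M, True); last first.
  by exists z0 => // m; exfalso; apply: nM; exists m.
move=> _; have B0 : 0 <= B.
  by apply: le_trans (KB _ _ (WK _ Wz0 m0) (WK _ Wz0 m0)); exact: seminorm_ge0.
have B1 : 0 < 2 * (B + 1) by lra.
(* The two errors [a ^+ n * B] and [(1 - a) * B] are each at most [h * B <= e / 2]. *)
pose h := e / (2 * (B + 1)).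
have h0 : 0 < h by exact: divr_gt0.
have h1 : 0 < 1 + h by exact: addr_gt0.
pose a := (1 + h)^-1.
have a0 : 0 < a by rewrite invr_gt0.
have a1 : a <= 1 by rewrite invf_le1// lerDl ltW.
have sa : 1 - a <= h.
  have : a * (1 + h) = 1 by rewrite mulVf ?gt_eqF.
  have : a * h <= 1 * h by rewrite ler_wpM2r// ltW.
  by rewrite mulrDr mulr1 => ? ?; lra.
have [n hn] := geometric_small h0 h0.
pose z k := iter k (fun w : M -> V => a *: (fun m => S (w m)) + (1 - a) *: z0) z0.
have Wz k : W (z k).
  elim: k => [|k IH] //=; apply: Wcvx => //; [exact: WS|exact: ltW|by rewrite subr_ge0|].
  by rewrite addrC subrK.
have step k m : N (z k.+1 m - z k m) <= a ^+ k * B.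
  elim: k => [|k IH].
    by rewrite expr0 mul1r; apply: KB; apply: WK; exact: Wz.
  have -> : z k.+2 m - z k.+1 m = a *: (S (z k.+1 m) - S (z k m)).
    rewrite [z k.+2]/= {2}[z k.+1]/= !fctE /=.
    by rewrite opprD addrACA subrr addr0 scalerBr.
  rewrite Ns.2 ger0_norm ?(ltW a0)// exprS -mulrA ler_wpM2l ?(ltW a0)//.
  by apply: le_trans IH; apply: KN; apply: WK; exact: Wz.
exists (z n) => // m.
apply: le_trans (seminormBD _ (z n.+1 m) _ Ns) _.
have -> : S (z n m) - z n.+1 m = (1 - a) *: (S (z n m) - z0 m).
  rewrite /= !fctE /= opprD addrA -[X in X - a *: _]scale1r -scalerBl.
  by rewrite -scalerBr.
rewrite Ns.2 ger0_norm ?subr_ge0//.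
have hB : h * B <= e / 2.
  rewrite /h invfM mulrA -mulrA; apply: ler_piMr; first by lra.
  by rewrite mulrC ler_pdivrMr; lra.
have t1 : (1 - a) * N (S (z n m) - z0 m) <= h * B.
  apply: ler_pM => //; first by rewrite subr_ge0.
    exact: seminorm_ge0.
  by apply: KB; [apply: KS; apply: WK; exact: Wz|exact: WK].
have t2 : a ^+ n * B <= h * B by exact: ler_wpM2r.
by have := step n m => ?; lra.
Qed.

Lemma fixed_point (D : set V) (S : V -> V) : body D -> stable D S -> nonexpansive N D S ->
  exists2 p, D p & N (S p - p) = 0.
Proof.
move=> Db DS DN.
have [||K KD [_ _ _ [B KB]] KS|p Dp hp] := @common_fixed_point unit (fun=> S) D Db.
- by move=> _.
- by move=> _.
- move=> M U UU W W0 WK Wcvx _ WS F e e0.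
  have KN : nonexpansive N K S by move=> x y /KD ? /KD ?; exact: DN.
  have [w Ww hw] := picard_approx KB KN (KS tt) W0 WK Wcvx (WS tt) e0.
  exists w => // j _ d d0; apply: ultra_setT => m /=.
  by apply: (le_trans (hw m)); rewrite lerDl ltW.
- by exists p => //; exact: hp tt.
Qed.

Lemma wlimit_dist M (U : set_system M) {UU : UltraFilter U} (a b : M -> V) p p' t :
  wlimit psi q U a p -> wlimit psi q U b p' -> U [set m | N (a m - b m) <= t] ->
  N (p - p') <= t.
Proof.
move=> wa wb abt; have [f [fl fN <-]] := norming (p - p') Ns.
have fb : exists k, forall x, f x <= k * N x by exists 1 => x; rewrite mul1r.
rewrite linB//; apply: ulimit_le_cst (ulimitB (wa f fl fb) (wb f fl fb)) _.
by apply: filterS abt => m /=; apply: le_trans; rewrite -linB.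
Qed.

Lemma wlimit_cst M (U : set_system M) {UU : UltraFilter U} p : wlimit psi q U (fun=> p) p.
Proof. by move=> f _ _; exact: ulimit_cst. Qed.

(** * Bruck's retraction onto common fixed points *)

Section Retraction.
Variables (s : seq (V -> V)) (D : set V) (B : R).
Hypotheses (D0 : D !=set0) (Dcl : sclosed N D) (Dcvx : cvx D) (DB : bounded_by N D B).
Hypotheses (Ds : forall S, List.In S s -> stable D S)
  (Dn : forall S, List.In S s -> nonexpansive N D S).
Hypothesis s_fixed : forall K, K `<=` D -> body K -> (forall S, List.In S s -> stable K S) ->
  exists2 p, K p & forall S, List.In S s -> N (S p - p) = 0.

Definition common_fixed p := D p /\ forall S, List.In S s -> N (S p - p) = 0.

Definition fixing f := [/\ stable D f, nonexpansive N D f &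
  forall p, common_fixed p -> N (f p - p) = 0].

Lemma fixing_id : fixing id.
Proof. by split=> // p _; rewrite subrr seminorm0. Qed.

Lemma fixing_comp f g : fixing f -> fixing g -> fixing (f \o g).
Proof.
move=> [f1 f2 f3] [g1 g2 g3]; split=> [x /g1/f1//|x y Dx Dy|p hp] /=.
  by apply: le_trans (f2 _ _ (g1 _ Dx) (g1 _ Dy)) _; exact: g2.
apply/eqP; rewrite eq_le seminorm_ge0// andbT.
apply: le_trans (seminormBD _ (f p) _ Ns) _; rewrite (f3 _ hp) addr0.
by rewrite -(g3 _ hp); apply: f2; [exact: g1 hp.1|exact: hp.1].
Qed.

Lemma fixing_map S : List.In S s -> fixing S.
Proof. by move=> Ss; split; [exact: Ds|exact: Dn|move=> p [_ /(_ _ Ss)]]. Qed.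

Lemma fixing_cvx f g a b : fixing f -> fixing g -> 0 <= a -> 0 <= b -> a + b = 1 ->
  fixing (fun x => a *: f x + b *: g x).
Proof.
move=> [f1 f2 f3] [g1 g2 g3] a0 b0 ab.
have tri x y u v : N (a *: x + b *: y - (a *: u + b *: v)) <= a * N (x - u) + b * N (y - v).
  have -> : a *: x + b *: y - (a *: u + b *: v) = a *: (x - u) + b *: (y - v).
    by rewrite !scalerBr addrACA opprD.
  by apply: le_trans (Ns.1 _ _) _; rewrite !Ns.2 !ger0_norm.
split=> [x Dx|x y Dx Dy|p hp].
- by apply: Dcvx => //; [exact: f1|exact: g1].
- apply: le_trans (tri _ _ _ _) _; rewrite -[leRHS]mul1r -ab mulrDl.
  by rewrite lerD// ler_wpM2l//; [exact: f2|exact: g2].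
- apply/eqP; rewrite eq_le seminorm_ge0// andbT.
  have pE : p = a *: p + b *: p by rewrite -scalerDl ab scale1r.
  rewrite [X in _ - X]pE.
  by apply: le_trans (tri _ _ _ _) _; rewrite f3// g3// !mulr0 addr0.
Qed.

Lemma fixing_wlimit I (U : set_system I) {UU : UltraFilter U} (f : I -> V -> V) :
  (forall i, fixing (f i)) ->
  exists g, fixing g /\ forall x, D x -> wlimit psi q U (fun i => f i x) (g x).
Proof.
move=> fP.
have /choice[g hg] x : exists p, D x -> D p /\ wlimit psi q U (fun i => f i x) p.
  have [Dx|nDx] := pselect (D x); last by exists 0.
  have fD i : D (f i x) by have [h _ _] := fP i; exact: h.
  by have [p Dp wp] := exists_wlimit psi_sm qs q_unc Ncomplete Dcl Dcvx DB fD; exists p.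
exists g; split=> [|x Dx]; last by have [] := hg x Dx.
split=> [x /hg[]//|x y Dx Dy|p hp].
  apply: wlimit_dist (hg x Dx).2 (hg y Dy).2 _; apply: ultra_setT => i /=.
  by have [_ h _] := fP i; exact: h.
apply/eqP; rewrite eq_le seminorm_ge0// andbT.
apply: wlimit_dist (hg p hp.1).2 (@wlimit_cst _ U UU p) _; apply: ultra_setT => i /=.
by have [_ _ ->] := fP i.
Qed.

(** Maps are ordered by how much they shrink distances. A chain is bounded by a weak limit along its
    tails, since the norm is weakly lower semicontinuous. *)
Lemma minimal_fixing : exists f, fixing f /\ forall g, fixing g ->
  forall x y, D x -> D y -> N (f x - f y) <= N (g (f x) - g (f y)).
Proof.
pose T := {f | fixing f}.
pose rel (f g : T) := `[< forall x y, D x -> D y -> N (sval g x - sval g y) <= N (sval f x - sval f y) >].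
have relxx f : rel f f by apply/asboolP.
have rel_trans f g h : rel f g -> rel g h -> rel f h.
  move=> /asboolP h1 /asboolP h2; apply/asboolP => x y Dx Dy.
  exact: le_trans (h2 x y Dx Dy) (h1 x y Dx Dy).
have [A Atot|[f fP] fmax] := @ZL_preorder T (exist _ id fixing_id) rel relxx rel_trans.
  have [[f0 Af0]|A0] := pselect (A !=set0); last first.
    by exists (exist _ id fixing_id) => f Af; exfalso; apply: A0; exists f.
  pose I := {f | A f}.
  have [|||U [UU UP]] := @directed_ultra I (fun f g => rel (sval f) (sval g)) (exist _ f0 Af0).
  + by move=> t; exact: relxx.
  + by move=> f g h; exact: rel_trans.
  + move=> f g; have rr (k : I) := relxx (sval k).
    by have [h|h] := Atot _ _ (svalP f) (svalP g); [exists g|exists f].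
  have [g [gP gw]] := @fixing_wlimit I U UU (fun f => sval (sval f)) (fun f => svalP (sval f)).
  exists (exist _ g gP) => f Af; apply/asboolP => x y Dx Dy /=.
  apply: wlimit_dist (gw x Dx) (gw y Dy) _.
  by apply: filterS (UP (exist _ f Af)) => k /asboolP; exact.
exists f; split=> // g gP x y Dx Dy.
have := fmax (exist _ (g \o f) (fixing_comp gP fP)).
have -> : rel (exist _ f fP) (exist _ (g \o f) (fixing_comp gP fP)).
  apply/asboolP => u v Du Dv /=; have [_ h _] := gP; have [f1 _ _] := fP.
  by apply: h; exact: f1.
by move=> /(_ isT)/asboolP; exact.
Qed.

(* Bruck: a map minimal among the nonexpansive self-maps fixing the common fixed
   points is a retraction onto them, since no such map shrinks its range further. *)
Lemma nonexpansive_retraction : exists f, fixing f /\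
  forall x, D x -> common_fixed (f x).
Proof.
have [f [fP fmin]] := minimal_fixing; exists f; split=> // x Dx.
have [f1 f2 f3] := fP.
(* The orbit of [f x] under all fixing maps, closed thanks to weak limits and invariant under
   composition. At a common fixed point [p] in it, represented by [g (f x)], minimality of [f]
   forces [f x] and [p] to distance zero. *)
pose K := [set u | D u /\ exists g, fixing g /\ N (u - g (f x)) = 0].
have KD : K `<=` D by move=> u [].
have Kfx : K (f x).
  by split; [exact: f1|exists id; split; [exact: fixing_id|rewrite subrr seminorm0]].
have [p [Dp [g [gP pg]]] hp] : exists2 p, K p & forall S, List.In S s -> N (S p - p) = 0.
  apply: s_fixed => //.
  - split.
    + by exists (f x).
    + move=> u h; split.
        by apply: Dcl => e /h[a [Da _] ua]; exists a.
      have /choice[g hg] (n : nat) : exists g, fixing g /\ N (u - g (f x)) <= n.+1%:R^-1.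
        have ni : (0 : R) < n.+1%:R^-1 by rewrite invr_gt0.
        have [a [Da [g [gP ag]]] ua] := h _ ni; exists g; split=> //.
        by apply: le_trans (seminormBD _ a _ Ns) _; rewrite ag addr0.
      have [U [UU [_ U0]]] := family_ultra R V.
      have [G [GP Gw]] := @fixing_wlimit _ U UU (fun l => g l.2) (fun l => (hg l.2).1).
      exists G; split=> //; apply/eqP; rewrite eq_le seminorm_ge0// andbT.
      apply/ler_addgt0Pr => e e0; rewrite add0r.
      apply: wlimit_dist (@wlimit_cst _ U UU u) (Gw _ (f1 _ Dx)) _.
      apply: filterS (ulimit_near U0 e0) => l /= /ltW.
      exact: le_trans (hg l.2).2.
    + move=> u v a b [Du [g [gP ug]]] [Dv [k [kP vk]]] a0 b0 ab; split; first exact: Dcvx.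
      exists (fun z => a *: g z + b *: k z); split; first exact: fixing_cvx.
      apply/eqP; rewrite eq_le seminorm_ge0// andbT.
      have -> : a *: u + b *: v - (a *: g (f x) + b *: k (f x)) =
          a *: (u - g (f x)) + b *: (v - k (f x)) by rewrite !scalerBr addrACA opprD.
      by apply: le_trans (Ns.1 _ _) _; rewrite !Ns.2 ug vk !mulr0 addr0.
    + by exists B => u v /KD ? /KD ?; exact: DB.
  - move=> S Ss u [Du [g [gP ug]]]; split; first exact: Ds.
    exists (S \o g); split; first exact: fixing_comp (fixing_map Ss) gP.
    apply/eqP; rewrite eq_le seminorm_ge0// andbT -ug; apply: Dn => //.
    by have [g1 _ _] := gP; apply: g1; exact: f1.
have cp : common_fixed p by [].
have [g1 g2 g3] := gP.
have fp := f3 p cp; have gp := g3 p cp.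
have key : N (f x - p) = 0.
  apply/eqP; rewrite eq_le seminorm_ge0// andbT.
  apply: le_trans (seminormBD _ (f p) _ Ns) _; rewrite fp addr0.
  apply: le_trans (fmin g gP x p Dx Dp) _.
  apply: le_trans (seminormBD _ p _ Ns) _; rewrite (seminormB (g (f x)) p Ns) pg add0r.
  apply: le_trans (seminormBD _ (g p) _ Ns) _; rewrite (seminormB p (g p) Ns) gp add0r -fp.
  by rewrite (seminormB (f p) p Ns); apply: g2 => //; exact: f1.
split=> [|S Ss]; first exact: f1.
apply/eqP; rewrite eq_le seminorm_ge0// andbT.
apply: le_trans (seminormBD _ (S p) _ Ns) _.
have h1 : N (S (f x) - S p) <= N (f x - p) by apply: Dn => //; exact: f1.
have := seminormBD (S p) p (f x) Ns; rewrite (hp _ Ss) (seminormB p (f x) Ns) key.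
by rewrite key in h1; lra.
Qed.

End Retraction.

(** Let [f] retract onto the common fixed points of [s], and let [S \o f] fix [p]. Each [T] in [s]
    fixes [f p] and commutes with [S], so it fixes [p]; then [f] fixes [p], and so does [S]. *)
Lemma finite_common_fixed (s : seq (V -> V)) : forall D : set V, body D ->
  (forall S, List.In S s -> stable D S) -> (forall S, List.In S s -> nonexpansive N D S) ->
  (forall S T, List.In S s -> List.In T s -> forall x, D x -> N (S (T x) - T (S x)) = 0) ->
  exists2 p, D p & forall S, List.In S s -> N (S p - p) = 0.
Proof.
elim: s => [|S s IH] D Db Ds Dn Dc; first by have [[p Dp] _ _ _] := Db; exists p.
have [D0 Dcl Dcvx [B DB]] := Db.
have [f [fP fF]] : exists f, fixing s D f /\ forall x, D x -> common_fixed s D (f x).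
  apply: (@nonexpansive_retraction s D B) => //.
  - by move=> T sT; apply: Ds; right.
  - by move=> T sT; apply: Dn; right.
  - move=> K KD Kb Ks; apply: IH => //.
      by move=> T sT x y /KD ? /KD ?; apply: Dn => //; right.
    by move=> T T' sT sT' x /KD Dx; exact: (Dc T T' (or_intror sT) (or_intror sT')).
have [f1 f2 f3] := fP.
have SD : stable D S by apply: Ds; left.
have SN : nonexpansive N D S by apply: Dn; left.
have [||p Dp pE] := @fixed_point D (S \o f) Db.
- by move=> x /f1/SD.
- by move=> x y Dx Dy /=; apply: le_trans (SN _ _ (f1 _ Dx) (f1 _ Dy)) _; exact: f2.
have [_ fp] := fF p Dp; rewrite /= in pE.
have cp : common_fixed s D p.
  split=> // T sT.
  have TN : nonexpansive N D T by apply: Dn; right.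
  have TD : stable D T by apply: Ds; right.
  have h1 : N (T (S (f p)) - S (T (f p))) = 0.
    exact: (Dc T S (or_intror sT) (or_introl erefl) _ (f1 _ Dp)).
  have h2 : N (S (T (f p)) - S (f p)) <= N (T (f p) - f p).
    by apply: SN; [apply: TD; exact: f1|exact: f1].
  have h3 : N (T p - T (S (f p))) <= N (p - S (f p)).
    by apply: TN => //; apply: SD; exact: f1.
  rewrite (fp _ sT) in h2; rewrite (seminormB p (S (f p)) Ns) pE in h3.
  have := seminormBD (T p) (T (S (f p))) p Ns.
  have := seminormBD (T (S (f p))) (S (T (f p))) p Ns.
  have := seminormBD (S (T (f p))) (S (f p)) p Ns.
  rewrite h1 pE => ? ? ?; apply/eqP; rewrite eq_le seminorm_ge0// andbT; lra.
exists p => // T [<-|sT]; last by have [_] := cp; exact.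
have fpp := f3 p cp.
have h : N (S p - S (f p)) <= N (p - f p) by apply: SN => //; exact: f1.
have := seminormBD (S p) (S (f p)) p Ns; rewrite pE.
rewrite (seminormB p (f p) Ns) fpp in h.
by move=> ?; apply/eqP; rewrite eq_le seminorm_ge0// andbT; lra.
Qed.

End CommonFixedPoints.

(** * Ultrapowers as seminormed spaces of bounded nets *)

Section BoundedNets.
Variables (R : realType) (V : lmodType R) (N : V -> R).

(* [Ns] is a parameter so that the module structure below can be inferred from the type. *)
Record bounded_net (Ns : seminorm N) (M : Type) := BNet {
  bval :> M -> V;
  bnet_bounded : exists B, forall m, N (bval m) <= B }.

Arguments BNet Ns {M bval} bnet_bounded.

Variables (Ns : seminorm N) (M : Type).
Local Notation bnet := (bounded_net Ns M).

HB.instance Definition _ := gen_eqMixin bnet.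
HB.instance Definition _ := gen_choiceMixin bnet.

Lemma bnetP (u v : bnet) : (forall m, u m = v m) -> u = v.
Proof.
case: u v => [u hu] [v hv] /= uv; have E : u = v by apply/funext.
by rewrite E in hu *; congr (@BNet Ns M v); exact: Prop_irrelevance.
Qed.

Fact bnet_zero_bounded : exists B, forall m : M, N 0 <= B.
Proof. by exists (N 0). Qed.
Definition bnet_zero := BNet Ns bnet_zero_bounded.

Fact bnet_add_bounded (u v : bnet) : exists B, forall m, N (u m + v m) <= B.
Proof.
have [[B uB] [C vC]] := (bnet_bounded u, bnet_bounded v); exists (B + C) => m.
by apply: le_trans (Ns.1 _ _) _; exact: lerD.
Qed.
Definition bnet_add u v := BNet Ns (bnet_add_bounded u v).

Fact bnet_opp_bounded (u : bnet) : exists B, forall m, N (- u m) <= B.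
Proof. by have [B uB] := bnet_bounded u; exists B => m; rewrite seminormN. Qed.
Definition bnet_opp u := BNet Ns (bnet_opp_bounded u).

Fact bnet_scale_bounded a (u : bnet) : exists B, forall m, N (a *: u m) <= B.
Proof.
have [B uB] := bnet_bounded u; exists (`|a| * B) => m.
by rewrite Ns.2 ler_wpM2l.
Qed.
Definition bnet_scale a u := BNet Ns (bnet_scale_bounded a u).

Fact bnet_addA : associative bnet_add.
Proof. by move=> u v w; apply: bnetP => m /=; rewrite addrA. Qed.
Fact bnet_addC : commutative bnet_add.
Proof. by move=> u v; apply: bnetP => m /=; rewrite addrC. Qed.
Fact bnet_add0 : left_id bnet_zero bnet_add.
Proof. by move=> u; apply: bnetP => m /=; rewrite add0r. Qed.
Fact bnet_addN : left_inverse bnet_zero bnet_opp bnet_add.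
Proof. by move=> u; apply: bnetP => m /=; rewrite addNr. Qed.

HB.instance Definition _ :=
  GRing.isZmodule.Build bnet bnet_addA bnet_addC bnet_add0 bnet_addN.

Fact bnet_scaleA a b (u : bnet) : bnet_scale a (bnet_scale b u) = bnet_scale (a * b) u.
Proof. by apply: bnetP => m /=; rewrite scalerA. Qed.
Fact bnet_scale1 : left_id 1 bnet_scale.
Proof. by move=> u; apply: bnetP => m /=; rewrite scale1r. Qed.
Fact bnet_scaleDr : right_distributive bnet_scale +%R.
Proof. by move=> a u v; apply: bnetP => m /=; rewrite scalerDr. Qed.
Fact bnet_scaleDl (u : bnet) : {morph bnet_scale^~ u : a b / a + b}.
Proof. by move=> a b; apply: bnetP => m /=; rewrite scalerDl. Qed.

HB.instance Definition _ := GRing.Zmodule_isLmodule.Build R bnet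
  bnet_scaleA bnet_scale1 bnet_scaleDr bnet_scaleDl.

End BoundedNets.

Arguments BNet {R V N} Ns {M bval} bnet_bounded.

Section Ultrapower.
Variables (R : realType) (r : nat) (psi : absnorm R r) (V : lmodType R).
Hypothesis psi_sm : strictly_monotone psi.
Variable q : 'I_r -> V -> R.
Hypothesis qs : forall i, seminorm (q i).
Hypothesis q_unc : forall i, unc (q i).
Local Notation N := (sumnorm psi q).
Hypothesis Ncomplete : scomplete N.
Variable Ns : seminorm N.
Variables (M : Type) (U : set_system M).
Context {UU : UltraFilter U}.
Local Notation B := (bounded_net Ns M).

Definition upow (i : 'I_r) (u : B) := ulim U (fun m => q i (u m)).

Lemma upowP i (u : B) : ulimit U (fun m => q i (u m)) (upow i u).
Proof.
have [b ub] := bnet_bounded u; apply: (@ulimP _ _ _ _ _ b) => m.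
rewrite ger0_norm ?seminorm_ge0//.
exact: le_trans (coord_sumnorm psi_sm qs i _) (ub m).
Qed.

Lemma upow_seminorm i : seminorm (upow i).
Proof.
split=> [u v|a u].
  apply: ulimit_le (upowP i (u + v)) (ulimitD (upowP i u) (upowP i v)) _.
  by apply: ultra_setT => m; exact: (qs i).1.
apply: ulimit_uniq (upowP i (a *: u)) _.
by apply: eq_ulimit (ulimitZ `|a| (upowP i u)) => m; rewrite -(qs i).2.
Qed.

Lemma upow_unc i : unc (upow i).
Proof.
apply: (@unc_transfer R B V (q i) (upow i) M U (fun m u => u m) UU) => //.
- exact: upow_seminorm.
- by move=> u; exact: upowP.
- by move=> u v w; apply: ultra_setT.
Qed.

Lemma upow_sumnormP (u : B) : ulimit U (fun m => N (u m)) (sumnorm psi upow u).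
Proof. by apply: (@ulimit_psi _ _ psi _ U UU (fun i m => q i (u m))) => i; exact: upowP. Qed.

(** One point serves all [k]: the limit if every step is small, and otherwise the last term before
    the first large step. The factor 2 is there because a bound in the ultrapower holds only with
    some slack at individual indices. *)
Lemma pointwise_limit (x : nat -> V) : exists v, forall k,
  (forall j, (j < k)%N -> N (x j.+1 - x j) <= 2 * (1 / 2) ^+ j) ->
  N (v - x k) <= 4 * (1 / 2) ^+ k.
Proof.
pose A k := forall j, (j < k)%N -> N (x j.+1 - x j) <= 2 * (1 / 2) ^+ j.
have pow_gt0 k : 0 < (1 / 2 : R) ^+ k by rewrite exprn_gt0//; lra.
have tele k d : A (k + d)%N -> N (x (k + d)%N - x k) <= 4 * (1 / 2) ^+ k - 4 * (1 / 2) ^+ (k + d).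
  elim: d => [|d IH] h; first by rewrite addn0 subrr seminorm0// subrr.
  have {}IH := IH (fun j jk => h j (leq_trans jk (leq_add (leqnn k) (leqnSn d)))).
  have := h (k + d)%N; rewrite addnS ltnSn => /(_ isT) h1.
  have := seminormBD (x (k + d).+1) (x (k + d)%N) (x k) Ns.
  rewrite exprS; move: ((1 / 2) ^+ (k + d)) h1 IH => e ? ? ?; lra.
have [Aall|nA] := pselect (forall k, A k).
  have [p hp] : exists p, forall e, 0 < e -> exists K, forall k, (K <= k)%N -> N (p - x k.+1) <= e.
    apply: (Ncomplete (x := fun k => x k.+1)) => k.
    apply: le_trans (Aall k.+2 k.+1 (ltnSn _)) _; rewrite exprS.
    by move: ((1 / 2) ^+ k) (pow_gt0 k) => e ?; lra.
  exists p => k _; apply/ler_addgt0Pr => e e0; have [K hK] := hp e e0.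
  have := hK (K + k)%N (leq_addr _ _).
  have := tele k K.+1 (Aall _); rewrite addnS addnC => h1 h2.
  have := seminormBD p (x (K + k).+1) (x k) Ns.
  by move: ((1 / 2) ^+ (K + k).+1) (pow_gt0 (K + k).+1) h1 => f ? ? ?; lra.
have [k [Ak nAk]] : exists k, A k /\ ~ A k.+1.
  apply: contrapT => /forallNP h; apply: nA; elim=> [//|k IH].
  by apply: contrapT => nk; apply: (h k).
exists (x k) => j Aj.
have jk : (j <= k)%N.
  by rewrite leqNgt; apply/negP => kj; apply: nAk => i ik; apply: Aj; exact: leq_trans kj.
have := tele j (k - j)%N; rewrite subnKC// => /(_ Ak).
by move: ((1 / 2) ^+ k) (pow_gt0 k) => e ? ?; lra.
Qed.

Lemma upow_complete : scomplete (sumnorm psi upow).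
Proof.
move=> u hu.
have /choice[v hv] m := pointwise_limit (fun k => u k m).
have [b0 ub] := bnet_bounded (u 0%N).
have vb : exists b, forall m, N (v m) <= b.
  exists (4 + b0) => m; have := hv m 0%N; rewrite expr0 mulr1 => /(_ _) h.
  have := Ns.1 (v m - u 0%N m) (u 0%N m); rewrite subrK => h1.
  by apply: le_trans h1 _; apply: lerD; [exact: h|exact: ub].
exists (BNet Ns vb) => e e0.
have e40 : 0 < e / 4 by lra.
have [K hK] := half_pow_small e40; exists K => k Kk.
have pk : (1 / 2 : R) ^+ k <= e / 4.
  by apply: le_trans hK; apply: ler_wiXn2l => //; lra.
apply: ulimit_le_cst (upow_sumnormP _) _.
have : U [set m | forall j, (j < k)%N -> N (u j.+1 m - u j m) <= 2 * (1 / 2) ^+ j].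
  elim: k {Kk pk} => [|k IH]; first exact: ultra_setT.
  have pk0 : 0 < (1 / 2 : R) ^+ k by rewrite exprn_gt0//; lra.
  have lt : sumnorm psi upow (u k.+1 - u k) < 2 * (1 / 2) ^+ k by have := hu k => ?; lra.
  apply: filterS (ultraI (ulimit_near (upow_sumnormP _) lt) IH) => m [/= h1 h2] j.
  by rewrite ltnS leq_eqVlt => /predU1P[->|/h2//]; exact: ltW.
apply: filterS => m /= h; apply: le_trans (hv m k h) _; lra.
Qed.

End Ultrapower.

Section Saturation.
Variables (R : realType) (V : lmodType R) (N : V -> R).
Hypothesis Ns : seminorm N.

(** Nets constrained at every index are not stable under null perturbations, so a set of them is
    closed only in this sense; its saturation is then [sclosed]. *)
Definition quasi_closed (D : set V) := forall v,
  (forall e, 0 < e -> exists2 a, D a & N (v - a) <= e) -> exists2 a, D a & N (v - a) = 0.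

Lemma null_dist u v u' v' : N (u - u') = 0 -> N (v - v') = 0 -> N (u - v) = N (u' - v').
Proof.
have aux x y x' y' : N (x - x') = 0 -> N (y - y') = 0 -> N (x - y) <= N (x' - y').
  move=> xx yy; have := seminormBD x x' y Ns; have := seminormBD x' y' y Ns.
  by rewrite (seminormB y' y Ns) xx yy => ? ?; lra.
move=> uu vv; apply/eqP; rewrite eq_le !aux// (seminormB _ _ Ns)//.
Qed.

Variable D : set V.
Hypotheses (D0 : D !=set0) (Dcl : quasi_closed D) (Dcvx : cvx D).
Hypothesis DB : exists B, bounded_by N D B.

Definition saturation := [set v | exists2 a, D a & N (v - a) = 0].

Lemma saturation_body : [/\ saturation !=set0, sclosed N saturation, cvx saturation &
  exists B, bounded_by N saturation B].
Proof.
split.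
- by have [a Da] := D0; exists a, a => //; rewrite subrr seminorm0.
- move=> v h; apply: Dcl => e /h[u [a Da ua] vu]; exists a => //.
  by apply: le_trans (seminormBD _ u _ Ns) _; rewrite ua addr0.
- move=> u v s t [a Da ua] [b Db vb] s0 t0 st; exists (s *: a + t *: b); first exact: Dcvx.
  apply/eqP; rewrite eq_le seminorm_ge0// andbT.
  have -> : s *: u + t *: v - (s *: a + t *: b) = s *: (u - a) + t *: (v - b).
    by rewrite !scalerBr addrACA opprD.
  by apply: le_trans (Ns.1 _ _) _; rewrite !Ns.2 ua vb !mulr0 addr0.
- have [B hB] := DB; exists B => u v [a Da ua] [b Db vb].
  by rewrite (null_dist ua vb); exact: hB.
Qed.

Lemma saturation_retract : exists rho : V -> V,
  forall v, saturation v -> D (rho v) /\ N (v - rho v) = 0.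
Proof.
have /choice[rho h] v : exists a, saturation v -> D a /\ N (v - a) = 0.
  by have [[a Da va]|nv] := pselect (saturation v); [exists a|exists v => /nv].
by exists rho.
Qed.

Lemma sub_saturation v : D v -> saturation v.
Proof. by move=> Dv; exists v => //; rewrite subrr seminorm0. Qed.

Variable rho : V -> V.
Hypothesis rhoP : forall v, saturation v -> D (rho v) /\ N (v - rho v) = 0.

Lemma saturation_stable S : stable D S -> stable saturation (S \o rho).
Proof. by move=> DS v /rhoP[Dv _]; apply: sub_saturation; exact: DS. Qed.

Lemma saturation_nonexpansive S : nonexpansive N D S -> nonexpansive N saturation (S \o rho).
Proof.
move=> SN u v /rhoP[Du uu] /rhoP[Dv vv] /=.
by rewrite (null_dist uu vv); exact: SN.
Qed.

Lemma saturation_commute S T : stable D S -> stable D T -> nonexpansive N D S ->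
  nonexpansive N D T -> (forall x, D x -> N (S (T x) - T (S x)) = 0) ->
  forall x, saturation x -> N ((S \o rho) ((T \o rho) x) - (T \o rho) ((S \o rho) x)) = 0.
Proof.
move=> DS DT SN TN ST x /rhoP[Dx _] /=.
have null A C : stable D A -> stable D C -> nonexpansive N D C ->
    N (C (rho (A (rho x))) - C (A (rho x))) = 0.
  move=> DA DC CN; have [Da aa] := rhoP (sub_saturation (DA _ Dx)).
  apply/eqP; rewrite eq_le seminorm_ge0// andbT -aa (seminormB (A _) _ Ns).
  by apply: CN => //; exact: DA.
by rewrite (null_dist (null T S DT DS SN) (null S T DS DT TN)) ST.
Qed.

Lemma saturation_fixed S p : stable D S -> saturation p -> N ((S \o rho) p - p) = 0 ->
  N (S (rho p) - rho p) = 0.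
Proof.
move=> DS /rhoP[_ pp] /= Sp.
by rewrite (null_dist (u' := S (rho p)) (v' := p)) ?subrr ?seminorm0// (seminormB _ _ Ns).
Qed.

End Saturation.

Lemma ulimit_le_ule (R : realType) (M : Type) (U : set_system M) {UU : UltraFilter U}
  (f : M -> R) l c : ulimit U f l -> l <= c -> ule U f c.
Proof. by move=> fl lc e e0; apply: filterS (ulimit_ule fl e0) => m /= ?; lra. Qed.

Section AllCommuting.
Variables (R : realType) (r : nat) (psi : absnorm R r) (V : lmodType R).
Hypothesis psi_sm : strictly_monotone psi.
Variable q : 'I_r -> V -> R.
Hypothesis qs : forall i, seminorm (q i).
Hypothesis q_unc : forall i, unc (q i).
Local Notation N := (sumnorm psi q).
Hypothesis Ncomplete : scomplete N.
Let Ns : seminorm N := sumnorm_seminorm psi_sm qs.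

(** Moves a net into [K] at every index at the cost of a factor 2. Off the closed set [K] the
    distance is positive, which leaves room for an almost nearest point. *)
Lemma nearest_point (K : set V) : K !=set0 -> sclosed N K -> exists c : V -> V,
  forall v, [/\ K (c v), K v -> c v = v & forall p, K p -> N (v - c v) <= 2 * N (v - p)].
Proof.
move=> K0 Kcl.
have /choice[c hc] v : exists a, [/\ K a, K v -> a = v & forall p, K p -> N (v - a) <= 2 * N (v - p)].
  have [Kv|nKv] := pselect (K v).
    by exists v; split=> // p _; rewrite subrr seminorm0// mulr_ge0// seminorm_ge0.
  have [e [e0 he]] : exists e, 0 < e /\ forall a, K a -> e < N (v - a).
    apply: contrapT => /forallNP h; apply: nKv; apply: Kcl => e e0.
    apply: contrapT => h'; apply: (h e); split=> // a Ka; rewrite ltNge.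
    by apply/negP => va; apply: h'; exists a.
  pose E := [set N (v - a) | a in K].
  have Ei : has_inf E.
    split; first by have [a Ka] := K0; exists (N (v - a)), a.
    by exists 0 => _ [a _ <-]; exact: seminorm_ge0.
  have infE : e <= inf E.
    by apply: lb_le_inf; [exact: Ei.1|move=> _ [a Ka <-]; apply/ltW; exact: he].
  have i0 : 0 < inf E by exact: lt_le_trans infE.
  have [_ [a Ka <-] ha] := inf_adherent i0 Ei.
  exists a; split=> // p Kp.
  have : inf E <= N (v - p) by apply: ge_inf; [exact: Ei.2|exists p].
  by lra.
by exists c.
Qed.

(* The bounded nets carry the ultrapower norm, so a common fixed point theorem there
   ([fixed_upow]) yields common fixed nets of maps acting on nets. *)
Lemma net_common_fixed (K : set V) M (U : set_system M) {UU : UltraFilter U}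
    (J : Type) (P : set J) (S : J -> (M -> V) -> M -> V) (W : set (M -> V)) :
  body psi q K ->
  (forall (D : set (bounded_net Ns M)) (S' : J -> bounded_net Ns M -> bounded_net Ns M),
    body psi (upow (q := q) U) D -> (forall j, stable D (S' j)) ->
    (forall j, nonexpansive (sumnorm psi (upow U)) D (S' j)) ->
    (forall i j x, D x -> sumnorm psi (upow U) (S' i (S' j x) - S' j (S' i x)) = 0) ->
    exists2 p, D p & forall j, P j -> sumnorm psi (upow U) (S' j p - p) = 0) ->
  W !=set0 -> (forall w, W w -> forall m, K (w m)) -> cvx W ->
  (forall v, (forall m, K (v m)) ->
    (forall e, 0 < e -> exists2 w, W w & ule U (fun m => N (v m - w m)) e) -> W v) ->
  (forall j w, W w -> W (S j w)) ->
  (forall j w w' t, W w -> W w' -> ule U (fun m => N (w m - w' m)) t ->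
    ule U (fun m => N (S j w m - S j w' m)) t) ->
  (forall i j w, W w -> forall m, N (S i (S j w) m - S j (S i w) m) = 0) ->
  exists2 w, W w & forall j, P j -> ulimit U (fun m => N (S j w m - w m)) 0.
Proof.
move=> [K0 Kcl Kcvx [B KB]] fixed_upow W0 WK Wcvx Wcl WS WN WC.
have [c hc] := nearest_point K0 Kcl.
have cK v : K (c v) by case: (hc v).
have [k0 Kk0] := K0.
have Kbd (w : M -> V) : (forall m, K (w m)) -> exists b, forall m, N (w m) <= b.
  move=> Kw; exists (B + N k0) => m.
  have := Ns.1 (w m - k0) k0; rewrite subrK => h; apply: (le_trans h).
  by rewrite lerD2r; exact: KB.
pose lift w Kw : bounded_net Ns M := BNet Ns (@Kbd w Kw).
pose clip (u : M -> V) m := c (u m).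
have clipK u m : K (clip u m) by exact: cK.
have QN (u : bounded_net Ns M) : ulimit U (fun m => N (u m)) (sumnorm psi (upow U) u).
  exact: upow_sumnormP.
have QNs : seminorm (sumnorm psi (upow (Ns := Ns) (q := q) U)).
  by apply: sumnorm_seminorm => // i; exact: upow_seminorm.
set Q := sumnorm psi (upow (Ns := Ns) U) in QN QNs *.
pose D := [set u : bounded_net Ns M | W u].
have cE (u : M -> V) : W u -> clip u = u.
  by move=> Wu; apply/funext => m; have [_ h _] := hc (u m); exact: h (WK u Wu m).
(* Clipping before and after gives a total map on bounded nets which agrees with [S j] on [W]. *)
pose S' j (u : bounded_net Ns M) : bounded_net Ns M :=
  lift (fun m => c (S j (clip u) m)) (fun m => cK _).
have S'E j u : D u -> S' j u = S j u :> (M -> V).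
  by move=> Du; rewrite /S' /= cE//; exact: (cE _ (WS j _ Du)).
have D0 : D !=set0 by have [w Ww] := W0; exists (lift w (WK w Ww)).
have Dcvx : cvx D by move=> u v s t Du Dv s0 t0 st; exact: Wcvx.
have DB : bounded_by Q D B.
  move=> u v Du Dv; apply: ulimit_le_cst (QN (u - v)) _; apply: ultra_setT => m /=.
  by apply: KB; exact: WK.
have Dcl : quasi_closed Q D.
  move=> v h; pose w := clip v.
  have vw d : 0 < d -> ule U (fun m => N (v m - w m)) (2 * d).
    move=> d0; have [a Da va] := h d d0.
    apply: ule_mono (uleZ _ (_ : ule U (fun m => N (v m - a m)) d)) => //.
      by move=> m; have [_ _] := hc (v m); apply; exact: WK.
    exact: ulimit_le_ule (QN (v - a)) va.
  exists (lift w (clipK v)); last first.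
    apply/eqP; rewrite eq_le seminorm_ge0// andbT; apply/ler_addgt0Pr => d d0.
    have d20 : 0 < d / 2 by lra.
    rewrite add0r; have -> : d = 2 * (d / 2) by lra.
    exact: (ule_ulimit (QN (v - lift w (clipK v))) (vw _ d20)).
  apply: Wcl => [|d d0]; first exact: clipK.
  have d30 : 0 < d / 3 by lra.
  have [a Da va] := h _ d30; exists a => //.
  have va' : ule U (fun m => N (v m - a m)) (d / 3) by exact: ulimit_le_ule (QN (v - a)) va.
  have -> : d = 2 * (d / 3) + d / 3 by lra.
  apply: ule_mono (uleD (vw _ d30) va') => m.
  by have := seminormBD (w m) (v m) (a m) Ns; rewrite (seminormB (w m) (v m) Ns).
have D'S j : stable D (S' j) by move=> u Du; rewrite /D -[_ (S' j u)]/(W (S' j u)) S'E//; exact: WS.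
have D'N j : nonexpansive Q D (S' j).
  move=> u v Du Dv; apply: (ule_ulimit (QN (S' j u - S' j v))).
  apply: ule_mono (WN j u v _ Du Dv (ulimit_ule (QN (u - v)))) => m.
  by rewrite -!S'E.
have D'C i j u : D u -> Q (S' i (S' j u) - S' j (S' i u)) = 0.
  move=> Du; apply: ulimit_uniq (QN _) _.
  apply: eq_ulimit (ulimit_cst 0) => m; rewrite -[RHS]/(N (S' i (S' j u) m - S' j (S' i u) m)).
  have E k l : S' k (S' l u) = S k (S l u) :> (M -> V).
    by rewrite (S'E k _ (D'S l u Du)) S'E.
  by rewrite !E WC.
have DBex : exists b, bounded_by Q D b by exists B.
have [rho rhoP] := saturation_retract Q D.
have [| | | |p Dp hp] := fixed_upow (saturation Q D) (fun j => S' j \o rho).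
- exact: saturation_body.
- by move=> j; exact: saturation_stable.
- by move=> j; exact: saturation_nonexpansive.
- by move=> i j; apply: saturation_commute => //; exact: D'C.
have [Dr pr] := rhoP _ Dp.
exists (rho p) => // j /hp /(saturation_fixed QNs rhoP (D'S j) Dp) fz.
by have := QN (S' j (rho p) - rho p); rewrite fz -(S'E j (rho p)).
Qed.

Variables (J : Type) (S : J -> V -> V).

(** On the ultrapower a finite subfamily acts as finitely many commuting maps, which have a common
    fixed net; it serves for every accuracy. *)
Lemma commuting_approx_fixed (K : set V) : body psi q K -> (forall j, stable K (S j)) ->
  (forall j, nonexpansive N K (S j)) ->
  (forall i j x, K x -> N (S i (S j x) - S j (S i x)) = 0) -> approx_fixed N S K.
Proof.
move=> Kb KS KN KC M U UU W W0 WK Wcvx Wcl WS F e e0.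
have [| | |w Ww hw] := @net_common_fixed K M U UU J (fun j => List.In j F)
    (fun j w m => S j (w m)) W Kb _ W0 WK Wcvx Wcl WS.
- move=> D S' Db DS DN DC.
  have Qs i : seminorm (upow (Ns := Ns) (q := q) U i) by exact: upow_seminorm.
  have Qu i : unc (upow (Ns := Ns) (q := q) U i) by exact: upow_unc.
  have Qc : scomplete (sumnorm psi (upow (Ns := Ns) (q := q) U)) by exact: upow_complete.
  have [| | |p Dp hp] := finite_common_fixed psi_sm Qs Qu Qc (s := List.map S' F) Db.
  + by move=> _ /List.in_map_iff[j [<- _]]; exact: DS.
  + by move=> _ /List.in_map_iff[j [<- _]]; exact: DN.
  + by move=> _ _ /List.in_map_iff[i [<- _]] /List.in_map_iff[j [<- _]]; exact: DC.
  exists p => // j Fj; apply: hp; apply/List.in_map_iff; by exists j.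
- move=> j w w' t Ww Ww'; apply: ule_mono => m; apply: KN; exact: WK.
- by move=> i j w Ww m; apply: KC; exact: WK.
by exists w => // j /hw h; exact: ulimit_le_ule h (ltW e0).
Qed.

Lemma commuting_common_fixed (D : set V) : body psi q D -> (forall j, stable D (S j)) ->
  (forall j, nonexpansive N D (S j)) ->
  (forall i j x, D x -> N (S i (S j x) - S j (S i x)) = 0) ->
  exists2 p, D p & forall j, N (S j p - p) = 0.
Proof.
move=> Db DS DN DC; apply: (common_fixed_point psi_sm qs q_unc Ncomplete) => // K KD Kb KS.
apply: commuting_approx_fixed => //.
- by move=> j x y /KD ? /KD ?; exact: DN.
- by move=> i j x /KD ?; exact: DC.
Qed.

End AllCommuting.

(** * Asymptotically nonexpansive maps *)

Section IntermediateSense.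
Variables (R : realType) (r : nat) (psi : absnorm R r) (V : lmodType R).
Hypothesis psi_sm : strictly_monotone psi.
Variable q : 'I_r -> V -> R.
Hypothesis qs : forall i, seminorm (q i).
Hypothesis q_unc : forall i, unc (q i).
Local Notation N := (sumnorm psi q).
Hypothesis Ncomplete : scomplete N.
Let Ns : seminorm N := sumnorm_seminorm psi_sm qs.

Variables (C : set V) (T : V -> V).
Hypotheses (Cb : body psi q C) (CT : stable C T).
Hypothesis T_intermediate : forall e, 0 < e -> exists n0, forall n, (n0 <= n)%N ->
  forall x y, C x -> C y -> N (iter n T x - iter n T y) <= N (x - y) + e.

Lemma iter_stable n x : C x -> C (iter n T x).
Proof. by move=> Cx; elim: n => [//|n IH]; exact: CT. Qed.

Definition almost_fixed z a := exists n0, forall n, (n0 <= n)%N -> N (iter n T z - z) <= a.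

(* The maps [u |-> (T^(mu n + n) (u n))_n] on nets commute and are nonexpansive in the
   ultrapower, and a common fixed net must be almost fixed pointwise, as [mu] is arbitrary. *)
Lemma almost_fixed_improve z a : C z -> 0 < a -> almost_fixed z a ->
  exists z', [/\ C z', N (z' - z) <= 3 * a & almost_fixed z' (a / 2)].
Proof.
move=> Cz a0 [n0 hn0].
have [U [UU tails]] : exists U : set_system nat, UltraFilter U /\
    forall t, U [set n | (t <= n)%N].
  apply: (@directed_ultra nat (fun s t => (s <= t)%N) 0%N) => [//|s t u|s t].
    exact: leq_trans.
  by exists (maxn s t); rewrite leq_maxl leq_maxr.
(* Nets within about [a] of the orbit of [z] at all sufficiently late times. The threshold [k] may
   depend on [n] in any way, which makes the set invariant for every [mu]. *)
pose W := [set u : nat -> V | (forall n, C (u n)) /\ forall e, 0 < e -> exists k : nat -> nat,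
  forall nu, (forall n, (k n <= nu n)%N) -> ule U (fun n => N (u n - iter (nu n) T z)) (a + e)].
have iterN e : 0 < e -> U [set n | forall m x y, C x -> C y ->
    N (iter (m + n) T x - iter (m + n) T y) <= N (x - y) + e].
  move=> /T_intermediate[n1 hn1]; apply: filterS (tails n1) => n /= n1n m x y Cx Cy.
  by apply: hn1 => //; apply: leq_trans n1n (leq_addl _ _).
have [| | | | | | | |w [wC ww] hw] := @net_common_fixed R r psi V psi_sm q qs C nat U UU
    (nat -> nat) setT (fun mu u n => iter (mu n + n) T (u n)) W Cb.
- move=> D S Db DS DN DC.
  have Qs i : seminorm (upow (Ns := Ns) (q := q) U i) by exact: upow_seminorm.
  have Qu i : unc (upow (Ns := Ns) (q := q) U i) by exact: upow_unc.
  have Qc : scomplete (sumnorm psi (upow (Ns := Ns) (q := q) U)) by exact: upow_complete.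
  have [p Dp hp] := commuting_common_fixed psi_sm Qs Qu Qc Db DS DN DC.
  by exists p.
- exists (fun=> z); split=> // e e0; exists (fun=> n0) => nu hnu d d0.
  apply: ultra_setT => n /=; rewrite (seminormB _ _ Ns).
  by apply: (le_trans (hn0 _ (hnu n))); lra.
- by move=> w [].
- move=> u v s t [uC hu] [vC hv] s0 t0 st; split=> [n|e e0].
    by have [_ _ Ccvx _] := Cb; exact: Ccvx.
  have [[k hk] [l hl]] := (hu e e0, hv e e0); exists (fun n => maxn (k n) (l n)) => nu hnu.
  have h1 : forall n, (k n <= nu n)%N by move=> n; apply: leq_trans (hnu n); exact: leq_maxl.
  have h2 : forall n, (l n <= nu n)%N by move=> n; apply: leq_trans (hnu n); exact: leq_maxr.
  have -> : a + e = s * (a + e) + t * (a + e) by rewrite -mulrDl st mul1r.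
  apply: ule_mono (uleD (uleZ s0 (hk _ h1)) (uleZ t0 (hl _ h2))) => n /=.
  move: (iter _ T z) => x; rewrite -[x in X in X <= _]scale1r -st scalerDl.
  rewrite opprD addrACA -!scalerBr; apply: (le_trans (Ns.1 _ _)).
  by rewrite !Ns.2 !ger0_norm.
- move=> v vC hv; split=> // e e0; have e20 : 0 < e / 2 by lra.
  have [w [wC hw] vw] := hv _ e20; have [k hk] := hw _ e20; exists k => nu /hk h.
  have -> : a + e = e / 2 + (a + e / 2) by lra.
  by apply: ule_mono (uleD vw h) => n /=; exact: seminormBD.
- move=> mu u [uC hu]; split=> [n|e e0]; first exact: iter_stable.
  have e20 : 0 < e / 2 by lra.
  (* Applying the power [mu n + n] advances the orbit of [z] by as much, so the threshold rises
     accordingly. The summand [n] drives the powers into the range where they are almost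
     nonexpansive, whatever [mu] is. *)
  have [k hk] := hu _ e20; exists (fun n => k n + (mu n + n))%N => nu hnu d d0.
  have h1 : forall n, (k n <= nu n - (mu n + n))%N.
    by move=> n; rewrite leq_subRL ?(addnC _ (k n))// (leq_trans _ (hnu n))// leq_addl.
  apply: filterS (ultraI (hk _ h1 d d0) (iterN _ e20)) => n [/= h2 h3].
  have -> : iter (nu n) T z = iter (mu n + n) T (iter (nu n - (mu n + n)) T z).
    by rewrite -iterD subnKC// (leq_trans _ (hnu n))// leq_addl.
  by apply: le_trans (h3 _ _ _ (uC n) (iter_stable _ Cz)) _; lra.
- move=> mu u v t [uC _] [vC _] huv e e0; have e20 : 0 < e / 2 by lra.
  apply: filterS (ultraI (huv _ e20) (iterN _ e20)) => n [/= h1 h2].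
  by apply: le_trans (h2 _ _ _ (uC n) (vC n)) _; lra.
- move=> mu nu u _ n /=.
  by rewrite -!iterD addnC subrr seminorm0.
have near_fixed : U [set n | almost_fixed (w n) (a / 2)].
  apply: contrapT => /ultra_notin bad.
  have /choice[mu hmu] n : exists m, ~ almost_fixed (w n) (a / 2) ->
      a / 2 < N (iter (m + n) T (w n) - w n).
    apply: contrapT => /forallNP h.
    have [fz|nfz] := pselect (almost_fixed (w n) (a / 2)); first by apply: (h 0%N) => /(_ fz).
    apply: nfz; exists n => m nm; rewrite leNgt; apply/negP => lt.
    by apply: (h (m - n)%N) => _; rewrite subnK.
  have a20 : 0 < a / 2 by lra.
  have [n [/= nfz lt]] := ultra_ex (ultraI bad (ulimit_near (hw mu I) a20)).
  by have := hmu _ nfz; lra.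
have a40 : 0 < a / 4 by lra.
have [k hk] := ww _ a40.
have hk' := hk (fun n => k n + n0)%N (fun n => leq_addr _ _) _ a40.
have [n [/= near_z wfix]] := ultra_ex (ultraI hk' near_fixed).
(* The distance is at most [a + a / 4 + a / 4] to the orbit and [a] from there to [z], below
   [3 * a]. *)
exists (w n); split=> //; apply: le_trans (seminormBD _ (iter (k n + n0) T z) _ Ns) _.
by have := hn0 _ (leq_addl (k n) n0) => ?; lra.
Qed.

Lemma intermediate_limit : exists2 z, C z &
  forall e, 0 < e -> exists n0, forall n, (n0 <= n)%N -> N (iter n T z - z) <= e.
Proof.
have [[x0 Cx0] Ccl _ [B CB]] := Cb.
have B0 : 0 <= B by apply: le_trans (CB _ _ Cx0 Cx0); exact: seminorm_ge0.
(* [b] bounds the diameter of [C], so any starting point is almost fixed up to [a 0]. *)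
pose b := B + 1; have b0 : 0 < b by rewrite /b; lra.
pose a k := b * (1 / 2) ^+ k.
have a_gt0 k : 0 < a k by rewrite mulr_gt0// exprn_gt0//; lra.
have /choice[f hf] (p : nat * V) : exists z', C p.2 -> almost_fixed p.2 (a p.1) ->
    [/\ C z', N (z' - p.2) <= 3 * a p.1 & almost_fixed z' (a p.1 / 2)].
  have [[Cz az]|h] := pselect (C p.2 /\ almost_fixed p.2 (a p.1)).
    by have [z' hz'] := almost_fixed_improve Cz (a_gt0 _) az; exists z'.
  by exists p.2 => Cz az; exfalso; apply: h.
pose z := fix z k := if k is j.+1 then f (j, z j) else x0.
have zP k : C (z k) /\ almost_fixed (z k) (a k).
  elim: k => [|k [Ck ak]].
    split=> //; exists 0%N => n _; rewrite /a expr0 mulr1.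
    by have := CB _ _ (iter_stable n Cx0) Cx0; rewrite /b /=; lra.
  have [? _ h] := hf (k, z k) Ck ak; split=> //.
  suff -> : a k.+1 = a k / 2 by [].
  by rewrite /a exprS mulrCA mul1r mulrC.
have z_step k : N (z k.+1 - z k) <= 3 * a k by have [Ck ak] := zP k; have [] := hf (k, z k) Ck ak.
have b30 : 0 < (3 * b)^-1 by rewrite invr_gt0; lra.
(* A shift by [l] absorbs the factor [3 * b] and gives the rate of [scomplete]. *)
have [l hl] := half_pow_small b30.
have [p hp] : exists p, forall e, 0 < e -> exists K, forall k, (K <= k)%N ->
    N (p - z (k + l)%N) <= e.
  apply: (Ncomplete (x := fun k => z (k + l)%N)) => k; rewrite addSn.
  apply: le_trans (z_step _) _.
  have -> : 3 * a (k + l)%N = (1 / 2) ^+ k * (3 * b * (1 / 2) ^+ l) by rewrite /a exprD; ring.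
  apply: ler_piMr; first by rewrite exprn_ge0//; lra.
  have b3 : 0 < 3 * b by lra.
  by have := ler_wpM2l (ltW b3) hl; rewrite mulfV ?gt_eqF.
have Cp : C p.
  apply: Ccl => e /hp[K hK]; exists (z (K + l)%N); first by case: (zP (K + l)%N).
  exact: hK.
exists p => // e e0; have e40 : 0 < e / 4 by lra.
have [K hK] := hp _ e40.
have e4b : 0 < e / 4 / b by rewrite divr_gt0.
have [L hL] := half_pow_small e4b.
have [k [Kk Lk]] : exists k, (K <= k)%N /\ (L <= k + l)%N.
  by exists (K + L)%N; rewrite leq_addr -addnA addnCA leq_addr.
have [n0 hn0] := T_intermediate e40.
have [Ck [n1 hn1]] := zP (k + l)%N.
exists (maxn n0 n1) => n; rewrite geq_max => /andP[nn0 nn1].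
have aL : a (k + l)%N <= e / 4.
  have : (1 / 2 : R) ^+ (k + l) <= e / 4 / b.
    by apply: le_trans hL; apply: ler_wiXn2l => //; lra.
  by rewrite ler_pdivlMr// mulrC.
have := seminormBD (iter n T p) (iter n T (z (k + l)%N)) p Ns.
have := seminormBD (iter n T (z (k + l)%N)) (z (k + l)%N) p Ns.
have := hn0 n nn0 _ _ Cp Ck; have := hn1 n nn1; have := hK k Kk.
by rewrite (seminormB p _ Ns); lra.
Qed.

End IntermediateSense.

(** * Spaces representable in a direct sum *)

Section NoncreasyNorm.
Variables (R : realType) (X : normedModType R).

Lemma norm_seminorm : seminorm (fun x : X => `|x|).
Proof. by split=> [x y|a x]; [exact: ler_normD|exact: normrZ]. Qed.

Lemma dual_norm_ub (f : X -> R) K x : (forall x, `|f x| <= K * `|x|) -> 0 <= K -> `|x| <= 1 ->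
  `|f x| <= dual_norm f.
Proof.
move=> fK K0 x1; apply: ub_le_sup; last by exists x.
exists K => _ [y y1 <-]; apply: le_trans (fK y) _.
by rewrite -[leRHS]mulr1; exact: ler_wpM2l.
Qed.

Lemma dual_norm_le (f : X -> R) K : (forall x, `|x| <= 1 -> `|f x| <= K) -> dual_norm f <= K.
Proof.
move=> fK; apply: sup_le_ub; last by move=> _ [y y1 <-]; exact: fK.
by exists `|f 0|, 0 => //; rewrite /unit_ball /= normr0.
Qed.

Lemma lin_dual_elt (f : X -> R) K : lin f -> (forall x, `|f x| <= K * `|x|) -> dual_elt f.
Proof.
move=> fl fK; split=> [x y|a x|x]; [exact: linD|exact: linZ|].
apply/cvgrPdist_lt => e e0.
have K0 : 0 < `|K| + 1 by rewrite ltr_wpDl.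
apply/nbhs_normP; exists (e / (`|K| + 1)); first by rewrite /= divr_gt0.
move=> y /=; rewrite ltr_pdivlMr// => xy; rewrite -linB//.
apply: le_lt_trans xy; apply: le_trans (fK _) _; rewrite mulrC ler_wpM2l//.
by apply: le_trans (ler_norm K) _; rewrite lerDl.
Qed.

(** Points are scaled into the unit ball by [l]. A functional below the norm that almost norms [u]
    has dual norm at least [1 - 2 * d], so dividing by it reaches the dual sphere with little
    change. *)
Lemma noncreasy_unc : uniformly_noncreasy X -> unc (fun x : X => `|x|).
Proof.
move=> Xnc e e0; have e40 : 0 < e / 4 by lra.
have [dl dl0 hdl] := Xnc _ e40.
(* [dl / 2] makes [1 - 2 * d] at least [1 - dl], [e / 16] keeps the changes of both functionals
   together within [e / 4], and [1 / 4] keeps their dual norms at least [1 / 2]. *)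
pose d := Num.min (dl / 2) (Num.min (e / 16) (1 / 4)).
have d0 : 0 < d by rewrite !lt_min; apply/and3P; split; lra.
have [d1 d2 d3] : [/\ d <= dl / 2, d <= e / 16 & d <= 1 / 4].
  by rewrite /d !ge_min !lexx !orbT.
exists d => // f g u v p fl gl fN gN u1 v1 p1 fu fv gu gv fgp.
pose l := (1 + d)^-1.
have l0 : 0 < l by rewrite invr_gt0; lra.
have lE : l * (1 + d) = 1 by rewrite mulVf//; lra.
have l12 : 1 / 2 <= l by rewrite -(ler_pM2r (_ : 0 < 1 + d)) ?lE//; lra.
have lball (x : X) : `|x| <= 1 + d -> `|l *: x| <= 1.
  by move=> x1; rewrite normrZ gtr0_norm// -lE ler_wpM2l// ltW.
have l1d a : 1 - d <= a -> 1 - 2 * d <= l * a.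
  move=> ha; have := ler_wpM2l (ltW l0) ha.
  have -> : l * (1 - d) = l * (1 + d) - 2 * (l * d) by ring.
  rewrite lE.
  have : l * d <= 1 * d by rewrite ler_pM2r//; move: lE; rewrite mulrDr mulr1; have := mulr_gt0 l0 d0; lra.
  by rewrite mul1r; lra.
have dualP (h : X -> R) : lin h -> (forall x, h x <= `|x|) -> 1 - d <= h u ->
    exists h', [/\ dual_sphere h', forall x, `|h' x| <= 2 * `|x|, forall x, `|x| <= 1 -> `|h' x - h x| <= 2 * d &
      forall x, 1 - d <= h x -> 1 - 2 * d <= h' (l *: x)].
  move=> hl hN hu; have h_le x : `|h x| <= `|x| by exact: (lin_norm _ norm_seminorm).
  pose n := dual_norm h.
  have h1 x : `|h x| <= 1 * `|x| by rewrite mul1r.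
  have hn x : `|x| <= 1 -> `|h x| <= n by apply: dual_norm_ub h1 _ => //; exact: ler01.
  have n1 : n <= 1 by apply: dual_norm_le => x; exact: le_trans.
  have nd : 1 - 2 * d <= n.
    apply: le_trans (hn _ (lball _ u1)); rewrite (linZ _ _ hl).
    by apply: le_trans (ler_norm _); exact: l1d.
  have n0 : 0 < n.
    apply: lt_le_trans (hn _ (lball _ u1)); rewrite (linZ _ _ hl) gtr0_norm; first by apply: mulr_gt0 => //; lra.
    by apply: mulr_gt0 => //; lra.
  have n0' : 0 <= n^-1 by rewrite invr_ge0 ltW.
  have h'le x : `|n^-1 * h x| <= n^-1 * `|x|.
    by rewrite normrM ger0_norm// ler_wpM2l.
  exists (fun x => n^-1 * h x); split.
  - split; first exact: lin_dual_elt (linMl _ hl) h'le.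
    apply/eqP; rewrite eq_le; apply/andP; split.
      apply: dual_norm_le => x x1; rewrite normrM ger0_norm// mulrC ler_pdivrMr// mul1r.
      exact: hn.
    rewrite -(ler_pM2l n0) mulr1; apply: dual_norm_le => x x1.
    have := dual_norm_ub h'le n0' x1; rewrite normrM ger0_norm// mulrC ler_pdivrMr//.
    by rewrite mulrC.
  - move=> x; apply: le_trans (h'le x) _; rewrite ler_wpM2r//.
    by rewrite -[n^-1]mul1r ler_pdivrMr//; lra.
  - move=> x x1; have -> : n^-1 * h x - h x = (n^-1 * h x) * (1 - n).
      by rewrite mulrBr mulr1 mulrAC mulVf ?mul1r// gt_eqF.
    rewrite normrM (ger0_norm (_ : 0 <= 1 - n)); last by lra.
    rewrite -[leRHS]mul1r; apply: ler_pM => //; first by lra.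
      by rewrite normrM ger0_norm// mulrC ler_pdivrMr// mul1r; exact: hn.
    by lra.
  - move=> x hx; rewrite (linZ _ _ (linMl _ hl)); apply: le_trans (l1d _ hx) _.
    have lhx : 0 <= l * h x by apply: mulr_ge0; lra.
    by rewrite mulrCA ler_peMl// invf_ge1.
have [F [Fs F2 Fd Fl]] := dualP f fl fN fu.
have [G [Gs G2 Gd Gl]] := dualP g gl gN gu.
have FG : e / 4 <= dual_norm (F \- G).
  have p1' := lball _ p1.
  apply: (@le_trans _ _ `|(F \- G) (l *: p)|); last first.
    apply: (@dual_norm_ub _ 4) => // x; apply: le_trans (ler_normB _ _) _.
    by have := F2 x; have := G2 x; lra.
  apply: le_trans (ler_norm _) => /=.
  have := Fd _ p1'; have := Gd _ p1'; rewrite !ler_norml (linZ _ _ fl) (linZ _ _ gl) => /andP[? ?] /andP[? ?].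
  have : 1 / 2 * e <= l * (f p - g p) by apply: ler_pM => //; lra.
  by rewrite mulrBr => ?; lra.
have diam_le := hdl F G Fs Gs FG.
have uv : `|l *: u - l *: v| <= e / 4.
  apply: le_trans diam_le; apply: ub_le_sup.
    exists 2 => _ [x [x1 _] [y [y1 _] <-]]; apply: le_trans (ler_normB _ _) _.
    by have : `|x| <= 1 by []; have : `|y| <= 1 by []; lra.
  have mem x : `|x| <= 1 + d -> 1 - d <= f x -> 1 - d <= g x ->
      unit_ball (l *: x) /\ 1 - dl <= F (l *: x) /\ 1 - dl <= G (l *: x).
    move=> x1 fx gx; split; first exact: lball.
    by have := Fl _ fx; have := Gl _ gx; lra.
  by exists (l *: u); [exact: mem|exists (l *: v); [exact: mem|]].
move: uv; rewrite -scalerBr normrZ gtr0_norm// => uv.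
have := ler_wpM2r (normr_ge0 (u - v)) l12; lra.
Qed.

End NoncreasyNorm.

Section FiniteRepresentability.
Variables (R : realType) (r : nat) (X : 'I_r -> normedModType R) (psi : absnorm R r).
Hypothesis psi_sm : strictly_monotone psi.
Variable Y : normedModType R.
Hypothesis Yrep : fin_representable Y (psum_norm (X := X) psi).

Let c i (x : psum_type X) := `|x i|.

Lemma coord_seminorm i : seminorm (c i).
Proof.
by rewrite /c; split=> [x y|a x]; rewrite ffunE; [exact: ler_normD|exact: normrZ].
Qed.

Lemma psum_norm_eq0 (x : psum_type X) : psum_norm psi x = 0 -> x = 0.
Proof.
move=> x0; apply/ffunP => i; rewrite ffunE; apply/normr0_eq0.
apply/eqP; rewrite eq_le normr_ge0 andbT -[leRHS]x0.
exact: (coord_sumnorm psi_sm coord_seminorm).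
Qed.

Lemma lin_comb (W : lmodType R) n (y : 'I_n -> W) (a b d : 'I_n -> R) s t w :
  \sum_i (s * a i + t * b i + w * d i) *: y i =
  s *: (\sum_i a i *: y i) + t *: (\sum_i b i *: y i) + w *: (\sum_i d i *: y i).
Proof.
rewrite !scaler_sumr -!big_split; apply: eq_bigr => i _ /=.
by rewrite !scalerA !scalerDl.
Qed.

(** [T] is defined by coordinates on the span of the list, consistently because the upper bound
    sends a vanishing combination to zero, and is zero off the span. The bound by 2 on all vectors
    lets limits over growing lists exist. *)
Lemma local_embedding (s : seq Y) (k : nat) : exists T : Y -> psum_type X,
  [/\ forall u v w, u \in s -> v \in s -> w \in s -> forall a b d,
        T (a *: u + b *: v + d *: w) = a *: T u + b *: T v + d *: T w,
      forall v, v \in s -> `|v| <= psum_norm psi (T v) <= (1 + k.+1%:R^-1) * `|v| &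
      forall v, psum_norm psi (T v) <= 2 * `|v|].
Proof.
have k0 : 0 < k.+1%:R^-1 :> R by rewrite invr_gt0.
have [z hz] := Yrep (fun i : 'I_(size s) => s`_i) k0.
pose y (i : 'I_(size s)) := s`_i.
have ext a b : \sum_i a i *: y i = \sum_i b i *: y i -> \sum_i a i *: z i = \sum_i b i *: z i.
  move=> ab; apply/subr0_eq; apply: psum_norm_eq0.
  have E (W : lmodType R) (x : 'I_(size s) -> W) :
      \sum_i a i *: x i - \sum_i b i *: x i = \sum_i (a i - b i) *: x i.
    by rewrite -sumrB; apply: eq_bigr => i _; rewrite scalerBl.
  have /andP[_] := hz (fun i => a i - b i).
  rewrite -!E -/y ab subrr normr0 mulr0 => h.
  apply/eqP; rewrite eq_le h andTb.
  exact: (seminorm_ge0 _ (sumnorm_seminorm psi_sm coord_seminorm)).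
have /choice[T hT] v : exists x, (forall a, v = \sum_i a i *: y i -> x = \sum_i a i *: z i) /\
    ((forall a, v <> \sum_i a i *: y i) -> x = 0).
  have [[a va]|nv] := pselect (exists a, v = \sum_i a i *: y i).
    exists (\sum_i a i *: z i); split=> [b vb|/(_ a)//]; apply: ext; by rewrite -va.
  by exists 0; split=> // a va; exfalso; apply: nv; exists a.
have span v : v \in s -> exists a, v = \sum_i a i *: y i.
  move=> vs; have iv : (index v s < size s)%N by rewrite index_mem.
  exists (fun j => (j == Ordinal iv)%:R); rewrite (bigD1 (Ordinal iv))//= eqxx scale1r.
  rewrite big1 ?addr0 /y /= ?nth_index// => j /negPf ->; by rewrite scale0r.
have TE a : T (\sum_i a i *: y i) = \sum_i a i *: z i by have [h _] := hT (\sum_i a i *: y i); exact: h.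
exists T; split.
- move=> u v w /span[a ->] /span[b ->] /span[d ->] s1 s2 s3.
  by rewrite -lin_comb !TE lin_comb.
- by move=> v /span[a ->]; rewrite TE; exact: hz.
- move=> v; have [[a va]|nv] := pselect (exists a, v = \sum_i a i *: y i).
    rewrite va TE; have /andP[_ h] := hz a; apply: (le_trans h).
    rewrite ler_wpM2r// (_ : 2 = 1 + 1)// lerD2l invf_le1// ler1n//.
  have [_ ->] := hT v; last by move=> a va; apply: nv; exists a.
  have -> : psum_norm psi (0 : psum_type X) = 0 := seminorm0 (sumnorm_seminorm psi_sm coord_seminorm).
  exact: mulr_ge0.
Qed.

(** [q i] is the limit of the [i]-th coordinate norm over almost isometries on growing finite lists.
    Linearity on each triple from some list onwards is all that [unc_transfer] asks for. *)
Lemma representable_seminorms : (forall i, unc (fun x : X i => `|x|)) ->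
  exists q : 'I_r -> Y -> R,
  [/\ forall i, seminorm (q i), forall i, unc (q i) & forall v, sumnorm psi q v = `|v|].
Proof.
move=> Xunc.
pose P (s t : seq Y * nat) := {subset s.1 <= t.1} /\ (s.2 <= t.2)%N.
have [U [UU PU]] : exists U : set_system (seq Y * nat), UltraFilter U /\
    forall t, U [set s | P t s].
  apply: (@directed_ultra _ P ([::], 0%N)) => [t|s t u [st1 st2] [tu1 tu2]|s t].
  - by split.
  - by split; [move=> x /st1 /tu1|exact: leq_trans tu2].
  - exists (s.1 ++ t.1, maxn s.2 t.2).
    by split; split=> [x xs|]; rewrite /= ?mem_cat ?xs ?orbT ?leq_maxl ?leq_maxr.
have /choice[T hT] (m : seq Y * nat) := local_embedding m.1 m.2.
have mem3 u v w : U [set m : seq Y * nat | [/\ u \in m.1, v \in m.1 & w \in m.1]].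
  apply: filterS (PU ([:: u; v; w], 0%N)) => m [sub _].
  by split; apply: sub; rewrite !inE eqxx ?orbT.
have Tb v m : psum_norm psi (T m v) <= 2 * `|v| by have [_ _] := hT m.
pose q i (v : Y) := ulim U (fun m => `|T m v i|).
have qP i v : ulimit U (fun m => `|T m v i|) (q i v).
  apply: (@ulimP _ _ _ _ _ (2 * `|v|)) => m; rewrite normr_id.
  by apply: le_trans (Tb v m); exact: (coord_sumnorm psi_sm coord_seminorm).
have Tlin i u v w : U [set m | forall a b d,
    T m (a *: u + b *: v + d *: w) i = a *: T m u i + b *: T m v i + d *: T m w i].
  apply: filterS (mem3 u v w) => m [um vm wm] a b d; have [h _ _] := hT m.
  by rewrite h// !ffunE.
have qs i : seminorm (q i).
  split=> [u v|a u].
    apply: ulimit_le (qP i (u + v)) (ulimitD (qP i u) (qP i v)) _.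
    apply: filterS (Tlin i u v 0) => m /(_ 1 1 0) /=.
    by rewrite !scale1r !scale0r !addr0 => ->; exact: ler_normD.
  apply: ulimit_uniq (qP i (a *: u)) _.
  apply: ulimit_near_eq (ulimitZ `|a| (qP i u)).
  apply: filterS (Tlin i u 0 0) => m /(_ a 0 0) /=.
  by rewrite !scale0r !addr0 => ->; rewrite normrZ.
exists q; split=> // [i|v].
  exact: (unc_transfer (@norm_seminorm R (X i)) (qs i) (qP i) (Tlin i)).
have qN : ulimit U (fun m => psum_norm psi (T m v)) (sumnorm psi q v).
  by apply: (@ulimit_psi _ _ psi _ U UU (fun i m => `|T m v i|)) => i; exact: qP.
apply/eqP; rewrite eq_le; apply/andP; split; last first.
  apply: ulimit_ge_cst qN _; apply: filterS (mem3 v v v) => m [vm _ _] /=.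
  by have [_ h _] := hT m; have /andP[] := h v vm.
apply/ler_addgt0Pr => e e0.
have v0 : 0 < `|v| + 1 by rewrite ltr_wpDl.
have [k hk] : exists k : nat, (`|v| + 1) / e <= k%:R.
  by exists (Num.Def.archi_bound ((`|v| + 1) / e)); apply/ltW/archi_boundP; rewrite divr_ge0// ltW.
apply: ulimit_le_cst qN _; apply: filterS (PU ([:: v], k)) => m [sub km] /=.
have vm : v \in m.1 by apply: sub; rewrite inE.
have [_ h _] := hT m; have /andP[_ h1] := h v vm; apply: (le_trans h1).
rewrite mulrDl mul1r lerD2l mulrC ler_pdivrMr//.
have h2 : (`|v| + 1) / e <= m.2.+1%:R.
  by apply: (le_trans hk); rewrite ler_nat; exact: leq_trans km _.
rewrite ler_pdivrMr// in h2; rewrite mulrC; apply: le_trans h2; by rewrite lerDl.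
Qed.

End FiniteRepresentability.

Section Translation.
Variables (R : realType) (Y : completeNormedModType R).
Local Notation norm := (fun x : Y => `|x|).

Lemma complete_scomplete : scomplete norm.
Proof.
move=> x hx.
have tele k d : `|x (k + d)%N - x k| <= 2 * (1 / 2) ^+ k - 2 * (1 / 2) ^+ (k + d).
  elim: d => [|d IH]; first by rewrite addn0 !subrr normr0.
  have := hx (k + d)%N; rewrite addnS exprS.
  have := ler_distD (x (k + d)%N) (x (k + d).+1) (x k).
  by move: ((1 / 2) ^+ (k + d)) IH => e ? ? ?; lra.
have pow_gt0 k : 0 < (1 / 2 : R) ^+ k by rewrite exprn_gt0//; lra.
have x_cauchy : cauchy (x @ \oo).
  apply: cauchy_exP => e e0; have e40 : 0 < e / 4 by lra.
  have [K hK] := half_pow_small e40; exists (x K); exists K => // k /= Kk.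
  rewrite -ball_normE /= distrC.
  by have := tele K (k - K)%N; rewrite subnKC// => h; have := pow_gt0 k; lra.
have /cauchy_cvgP/cvg_ex[/= p xp] := x_cauchy; exists p => e e0.
have /cvgrPdist_lt/(_ e e0)[K _ hK] := xp.
by exists K => k Kk; apply/ltW; exact: hK.
Qed.

Lemma closed_sclosed (C : set Y) : closed C -> sclosed norm C.
Proof.
move=> Ccl v hv; apply: Ccl => B /nbhs_normP[e /= e0 vB].
have e20 : 0 < e / 2 by lra.
have [a Ca va] := hv _ e20; exists a; split=> //; apply: vB => /=.
by apply: le_lt_trans va _; lra.
Qed.

Lemma convex_cvx (C : set Y) : @convex_set R Y C -> cvx C.
Proof.
move=> Ccvx x y s t Cx Cy s0 t0 st.
have s1 : s <= 1 by lra.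
have := Ccvx x y (Itv01 s0 s1); rewrite !inE => /(_ Cx Cy).
by have -> : t = 1 - s by lra.
Qed.

Lemma bounded_bounded_by (C : set Y) : bounded_set C -> exists B, bounded_by norm C B.
Proof.
move=> [M [_ hM]]; exists (2 * (`|M| + 1)) => x y Cx Cy /=.
have M1 : M < `|M| + 1 by apply: le_lt_trans (ler_norm M) _; rewrite ltrDl.
have := hM _ M1 x Cx; have := hM _ M1 y Cy => /= hy hx.
by apply: le_trans (ler_normB _ _) _; lra.
Qed.

Lemma intermediate_sense (C : set Y) (T : Y -> Y) e :
  asymp_nonexp_intermediate C T -> 0 < e -> exists n0, forall n, (n0 <= n)%N ->
  forall x y, C x -> C y -> `|iter n T x - iter n T y| <= `|x - y| + e.
Proof.
move=> [_ _ h] e0.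
have e0' : (0 < e%:E)%E by rewrite lte_fin.
(* The upper limit is an infimum of suprema over sets of the filter, so one tail already has
   supremum below [e]. *)
have [_ [A [n0 _ hA] <-] lt] := ereal_inf_lt (le_lt_trans h e0').
exists n0 => n n0n x y Cx Cy; rewrite -lerBlDl -lee_fin.
apply: le_trans (ltW lt); apply: (le_trans (y := ereal_sup _)); last first.
  by apply: ereal_sup_ubound; exists n => //; exact: hA.
by apply: ereal_sup_ubound; exists x => //; exists y.
Qed.

Lemma within_limit_fixed (C : set Y) (T : Y -> Y) z : (forall x, C x -> C (T x)) ->
  {within C, continuous T} -> C z ->
  (forall e, 0 < e -> exists n0, forall n, (n0 <= n)%N -> `|iter n T z - z| <= e) -> T z = z.
Proof.
move=> CT Tc Cz hz; apply/subr0_eq/normr0_eq0/eqP; rewrite eq_le normr_ge0 andbT.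
apply/ler_addgt0Pr => e e0; rewrite add0r; have e20 : 0 < e / 2 by lra.
have /cvgrPdist_lt/(_ _ e20) : T @ within C (nbhs z) --> T z.
  by move/subspace_continuousP : Tc; exact.
move=> /nbhs_normP[d /= d0 hd].
have md0 : 0 < Num.min (d / 2) (e / 2) by rewrite lt_min; lra.
have [n hn] := hz _ md0.
have Cn : C (iter n T z) by elim: n {hn} => [//|n IH]; exact: CT.
have := hn n.+1 (leqnSn n); have := hn n (leqnn n).
rewrite !le_min => /andP[h1 _] /andP[_ h2].
have zn : `|z - iter n T z| < d by rewrite distrC; apply: le_lt_trans h1 _; lra.
have := hd _ zn Cn; have := ler_distD (iter n.+1 T z) (T z) z; rewrite /=; lra.
Qed.

End Translation.

Theorem theorem3p9 (R : realType) (r : nat)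
    (X : 'I_r -> completeNormedModType R) (psi : absnorm R r) :
  (forall i, uniformly_noncreasy (X i)) ->
  strictly_monotone psi ->
  super_fpp_ani (psum_norm (X := fun i => X i) psi).
Proof.
move=> Xnc psi_sm Y Yrep C C0 Cbd Ccl Ccvx T Tani.
have [q [qs q_unc qN]] := representable_seminorms psi_sm Yrep (fun i => noncreasy_unc (Xnc i)).
have NE : sumnorm psi q = (fun x : Y => `|x|) by apply/funext.
have Nc : scomplete (sumnorm psi q) by rewrite NE; exact: complete_scomplete.
have Cb : body psi q C.
  split=> //; [|exact: convex_cvx|]; rewrite NE; first exact: closed_sclosed.
  exact: bounded_bounded_by.
have [CT Tc _] := Tani.
have Th e : 0 < e -> exists n0, forall n, (n0 <= n)%N -> forall x y, C x -> C y ->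
    sumnorm psi q (iter n T x - iter n T y) <= sumnorm psi q (x - y) + e.
  by rewrite NE => e0; exact: intermediate_sense.
have [z Cz hz] := intermediate_limit psi_sm qs q_unc Nc Cb CT Th.
by exists z => //; apply: within_limit_fixed CT Tc Cz _; rewrite NE in hz.
Qed.
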